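(* Let $\kappa\in\mathbb R$, let $(Y,d)$ be a complete and separable local $\mathrm{CAT}(\kappa)$ space equipped with a Borel measure $\mu$ finite on bounded sets, and let $b_1,b_2\in\mathrm{Der}^{2,2}(Y;\mu)$. Then for $\mu$-a.e. $x\in Y$ we have $$\mathscr F(b_1+b_2)(x)=\mathscr F(b_1)(x)\oplus\mathscr F(b_2)(x),$$ $$d_x\big(\mathscr F(b_1)(x),\mathscr F(b_2)(x)\big)=|b_1-b_2|(x),$$ $$|\mathscr F(b_1+b_2)(x)|_x^2+|\mathscr F(b_1-b_2)(x)|_x^2=2\big(|\mathscr F(b_1)(x)|_x^2+|\mathscr F(b_2)(x)|_x^2\big).$$
   Context: **$\mathrm{CAT}(\kappa)$ spaces.** Geodesics are minimizing and of constant speed. $\mathbb M_\kappa$ is the complete, simply connected 2-dimensional Riemannian manifold of constant curvature $\kappa$, with distance $d_\kappa$ and diameter $D_\kappa$. A metric space $(Y,d)$ is $\mathrm{CAT}(\kappa)$ if it is geodesic and for all $a,b,c\in Y$ with $d(a,b)+d(b,c)+d(c,a)<2D_\kappa$ and every $p$ with $d(b,p)+d(p,c)=d(b,c)$ there are points $\bar a,\bar b,\bar c,\bar p\in\mathbb M_\kappa$ with the same mutual distances $ab,bc,ca,pb,pc$ and $d(a,p)\le d_\kappa(\bar a,\bar p)$. $(Y,d)$ is local $\mathrm{CAT}(\kappa)$ if every point has a neighbourhood which is $\mathrm{CAT}(\kappa)$ with the restricted distance. For $x\in Y$ put $r_x=\sup\{r\le D_\kappa/2:\bar B_r(x)\text{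 is a }\mathrm{CAT}(\kappa)\text{ space}\}$, and $\mathrm{dist}_y=d(y,\cdot)$. **Tangent cones.** $\mathrm{Geo}_xY$ is the set of geodesics starting at $x$ and defined on some right neighbourhood of $0$; $d_x(\gamma,\eta)=\limsup_{t\downarrow0}d(\gamma_t,\eta_t)/t$ is a pseudodistance on it; $\gamma'_0$ is the class of $\gamma$ modulo $d_x=0$, and $(T_xY,d_x)$ is the completion of the quotient; $0\in T_xY$ is the class of the constant geodesic. $T_xY$ is a $\mathrm{CAT}(0)$ space. For $\lambda\ge0$, $\lambda\gamma_0'$ is the class of $t\mapsto\gamma_{\lambda t}$, extended by continuity to $T_xY$; $|v|_x=d_x(v,0)$; $v\oplus w=2m_{v,w}$ with $m_{v,w}$ the midpoint of $v$ and $w$ in $T_xY$. **Geometric tangent bundle.** $T_GY=\{(x,v):x\in Y,v\in T_xY\}$, $\pi^Y(x,v)=x$. For $x\in Y$ and $y,z\in B_{r_x}(x)$, $d_z\mathrm{dist}_y:T_zY\to\mathbb R$ is the unique continuous map with $d_z\mathrm{dist}_y(\gamma_0')=\lim_{h\downarrow0}\frac{d(\gamma_h,y)-d(z,y)}{h}$ for $\gamma\in\mathrm{Geo}_zY$. $\mathcal B(T_GY)$ is the smallest $\sigma$-algebra such that $\pi^Y$ is measurable ($Y$ having the Borel $\sigma$-algebra) and, for every $x\in Y$ and $y\in B_{r_x}(x)$, the function equal to $d_z\mathrm{dist}_y(v)$ at $(z,v)$ with $z\in B_{r_x}(x)$ and $0$ elsewhere is measurable. A Borel section is a map $v:Y\to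 T_GY$ with $\pi^Y(v(x))=x$, measurable from the Borel sets of $Y$ to $\mathcal B(T_GY)$. $L^2(T_GY;\mu)$ is the set of Borel sections with $\int|v(x)|_x^2d\mu<\infty$, modulo $\mu$-a.e. equality. **Derivations.** $\mathrm{LIP}_b(Y)$: bounded real Lipschitz functions; $\mathrm{lip}_af(x)=\lim_{r\downarrow 0}\mathrm{Lip}(f|_{B_r(x)})$. A derivation is a linear map $b:\mathrm{LIP}_b(Y)\to L^0(\mu)$ with $b(fh)=fb(h)+hb(f)$ a.e. and, for some $g\in L^0(\mu)$, $|b(f)|\le g\,\mathrm{lip}_af$ a.e. for all $f$; $|b|=\operatorname{ess\,sup}\{b(f):f\in\mathrm{LIP}_b(Y),\mathrm{Lip}(f)\le1\}$. By locality, $b$ extends to all Lipschitz functions $f$: on every open ball $B$, $b(f)=b(\tilde f)$ a.e. for any $\tilde f\in\mathrm{LIP}_b(Y)$ with $\tilde f=f$ on $B$. A derivation with $|b|$ integrable on bounded sets has divergence $\mathrm{div}\,b=h$ if $h$ is integrable on bounded sets and $\int b(f)d\mu=-\int fh\,d\mu$ for all Lipschitz $f$ with bounded support. $\mathrm{Der}^{2,2}(Y;\mu)$ is the space of derivations having divergence and with $|b|,\mathrm{div}\,b\in L^2(\mu)$. **The map $\mathscr F$.** For $b\in\mathrm{Der}^{2,2}(Y;\mu)$, $\mathscr F(b)$ denotes the unique $v\in L^2(T_GY;\mu)$ such that for any $\bar x\in Y$ and $y\in B_{r_{\bar x}}(\bar x)$ one has $d_x\mathrm{dist}_y(v(x))=b(\mathrm{dist}_y)(x)$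 for $\mu$-a.e. $x\in B_{r_{\bar x}}(\bar x)$ (existence and uniqueness of such $v$ is a known fact here; it also satisfies $|v(x)|_x=|b|(x)$ for $\mu$-a.e. $x$). *)

(* Defs.v *)
From HB Require Import structures.
From mathcomp Require Import all_boot all_order all_algebra generic_quotient.
From mathcomp Require Import lra.
From mathcomp Require Import all_classical all_reals all_analysis.

Set Implicit Arguments.
Unset Strict Implicit.
Unset Printing Implicit Defensive.

Import Order.TTheory GRing.Theory Num.Theory.
Import numFieldNormedType.Exports.

Local Open Scope classical_set_scope.
Local Open Scope ring_scope.
Local Open Scope quotient_scope.

#[short(type="completeMetricType")]
HB.structure Definition CompleteMetric (R : numFieldType) :=
  {T of Complete T & Metric R T}.

Record pseudodist (R : realType) (G : Type) := PseudoDist {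
  pd :> G -> G -> R ;
  pd_xx : forall x, pd x x = 0 ;
  pd_sym : forall x y, pd x y = pd y x ;
  pd_triangle : forall y x z, pd x z <= pd x y + pd y z }.

Section pseudodist_theory.
Context {R : realType} {G : Type} (d : pseudodist R G).

Lemma pd_ge0 x y : 0 <= d x y.
Proof.
rewrite -(@pmulrn_lge0 _ _ 2)// -(pd_xx d x).
by rewrite (le_trans (pd_triangle d y _ _))// (pd_sym d y) -mulr2n.
Qed.

Lemma pd_dist4 x y z t : `|d x y - d z t| <= d x z + d y t.
Proof.
have h1 := pd_triangle d z x y; have h2 := pd_triangle d t z y.
have h3 := pd_triangle d x z t; have h4 := pd_triangle d y x t.
rewrite (pd_sym d t y) in h2; rewrite (pd_sym d z x) in h3.
by rewrite ler_norml; apply/andP; split; lra.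
Qed.

Record cauchy_seq := CauchySeq {
  cseq :> nat -> G ;
  cseqP : forall e : R, 0 < e ->
    exists N, forall m n, (N <= m)%N -> (N <= n)%N -> d (cseq m) (cseq n) < e }.

HB.instance Definition _ := gen_eqMixin cauchy_seq.
HB.instance Definition _ := gen_choiceMixin cauchy_seq.

Definition cseq_dist (u v : cauchy_seq) : R := lim (d (u n) (v n) @[n --> \oo]).

Lemma is_cvg_cseq_dist (u v : cauchy_seq) : cvg (d (u n) (v n) @[n --> \oo]).
Proof.
apply: cauchy_cvg; apply/cauchy_exP => e e0.
have e20 : 0 < e / 2 by rewrite divr_gt0.
have [N hN] := cseqP u e20; have [M hM] := cseqP v e20.
exists (d (u (maxn N M)) (v (maxn N M))); exists (maxn N M) => // n /= hn.
rewrite /ball/= (le_lt_trans (pd_dist4 _ _ _ _))// [ltRHS](splitr e) ltrD//.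
- by apply: hN; [exact: leq_maxl|exact: leq_trans (leq_maxl _ _) hn].
- by apply: hM; [exact: leq_maxr|exact: leq_trans (leq_maxr _ _) hn].
Qed.

Lemma cseq_distxx u : cseq_dist u u = 0.
Proof.
by apply: cvg_lim => //; under eq_fun do rewrite pd_xx; exact: cvg_cst.
Qed.

Lemma cseq_dist_sym u v : cseq_dist u v = cseq_dist v u.
Proof. by rewrite /cseq_dist; under eq_fun do rewrite pd_sym. Qed.

Lemma cseq_dist_triangle v u w :
  cseq_dist u w <= cseq_dist u v + cseq_dist v w.
Proof.
rewrite /cseq_dist -limD; [|exact: is_cvg_cseq_dist..].
apply: ler_lim; [exact: is_cvg_cseq_dist| |].
  by apply: is_cvgD; exact: is_cvg_cseq_dist.
by near=> n; exact: pd_triangle.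
Unshelve. all: by end_near. Qed.

Lemma cseq_dist_ge0 u v : 0 <= cseq_dist u v.
Proof.
apply: limr_ge; first exact: is_cvg_cseq_dist.
by near=> n; exact: pd_ge0.
Unshelve. all: by end_near. Qed.

Definition cseq_equiv u v : bool := cseq_dist u v == 0.

Lemma cseq_equiv_refl : reflexive cseq_equiv.
Proof. by move=> u; rewrite /cseq_equiv cseq_distxx. Qed.

Lemma cseq_equiv_sym : symmetric cseq_equiv.
Proof. by move=> u v; rewrite /cseq_equiv cseq_dist_sym. Qed.

Lemma cseq_equiv_trans : transitive cseq_equiv.
Proof.
move=> v u w /eqP uv /eqP vw; rewrite /cseq_equiv eq_le cseq_dist_ge0 andbT.
by rewrite (le_trans (cseq_dist_triangle v _ _))// uv vw addr0.
Qed.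

Canonical cseq_equiv_rel :=
  EquivRel cseq_equiv cseq_equiv_refl cseq_equiv_sym cseq_equiv_trans.

(** Taking Cauchy sequences in [G] itself, rather than in its metric quotient,
    and identifying those at distance [0] performs both quotients at once. *)
Definition completion : Type := {eq_quot cseq_equiv}.

HB.instance Definition _ := Choice.on completion.
HB.instance Definition _ := EqQuotient.on completion.

Definition cdist (a b : completion) : R := cseq_dist (repr a) (repr b).

Lemma cdistE (u v : cauchy_seq) :
  cdist (\pi_completion u) (\pi_completion v) = cseq_dist u v.
Proof.
have hr (w : cauchy_seq) : cseq_dist (repr (\pi_completion w)) w = 0.
  by apply/eqP; have /eqmodP := reprK (\pi_completion w); apply.
rewrite /cdist; apply/eqP; rewrite eq_le; apply/andP; split.
- rewrite (le_trans (cseq_dist_triangle u _ _))// hr add0r.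
  rewrite (le_trans (cseq_dist_triangle v _ _))// (cseq_dist_sym v) hr.
  by rewrite addr0.
- rewrite (le_trans (cseq_dist_triangle (repr (\pi_completion u)) _ _))//.
  rewrite cseq_dist_sym hr add0r.
  rewrite (le_trans (cseq_dist_triangle (repr (\pi_completion v)) _ _))//.
  by rewrite hr addr0.
Qed.

Lemma cdistxx a : cdist a a = 0.
Proof. exact: cseq_distxx. Qed.

Lemma cdist_positivity a b : cdist a b = 0 -> a = b.
Proof.
move=> ab; rewrite -(reprK a) -(reprK b); apply/eqmodP.
by rewrite /= /cseq_equiv; apply/eqP.
Qed.

Lemma cdist_sym a b : cdist a b = cdist b a.
Proof. exact: cseq_dist_sym. Qed.

Lemma cdist_triangle b a c : cdist a c <= cdist a b + cdist b c.
Proof. exact: cseq_dist_triangle. Qed.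

HB.instance Definition _ := @isMetric.Build R completion
  cdist cdistxx cdist_positivity cdist_sym cdist_triangle.

Lemma cst_cauchy (g : G) (e : R) : 0 < e ->
  exists N, forall m n : nat, (N <= m)%N -> (N <= n)%N -> d g g < e.
Proof. by move=> e0; exists 0%N => m n _ _; rewrite pd_xx. Qed.

Definition to_completion (g : G) : completion :=
  \pi_completion (@CauchySeq (fun=> g) (cst_cauchy g)).

Lemma to_completion_dist g h :
  mdist (to_completion g) (to_completion h) = d g h.
Proof. rewrite [LHS]cdistE /cseq_dist /=; exact: lim_cst. Qed.

End pseudodist_theory.

Section cat.
Context {R : realType}.
Implicit Type kappa : R.

Definition arcosh (u : R) : R := ln (u + Num.sqrt (u ^+ 2 - 1)).

Definition diam_model kappa : \bar R :=
  if 0 < kappa then (pi / Num.sqrt kappa)%:E else +oo%E.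

(** The simply connected surface of constant curvature [kappa]: the unit sphere
    with its angular distance divided by [sqrt kappa], the upper sheet of the
    unit hyperboloid with the hyperbolic distance divided by
    [sqrt (- kappa)], or the Euclidean plane [p.2 = 0]. *)
Definition model kappa : set (R * R * R) :=
  if 0 < kappa then [set p | p.1.1 ^+ 2 + p.1.2 ^+ 2 + p.2 ^+ 2 = 1]
  else if kappa < 0 then
    [set p | p.2 ^+ 2 - p.1.1 ^+ 2 - p.1.2 ^+ 2 = 1 /\ 0 < p.2]
  else [set p | p.2 = 0].

Definition dmodel kappa (p q : R * R * R) : R :=
  if 0 < kappa then
    acos (p.1.1 * q.1.1 + p.1.2 * q.1.2 + p.2 * q.2) / Num.sqrt kappa
  else if kappa < 0 then
    arcosh (p.2 * q.2 - p.1.1 * q.1.1 - p.1.2 * q.1.2) / Num.sqrt (- kappa)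
  else Num.sqrt ((p.1.1 - q.1.1) ^+ 2 + (p.1.2 - q.1.2) ^+ 2).

Context {Y : metricType R}.
Implicit Types (x y z : Y) (U A : set Y).

Definition is_geodesic U : Prop := forall a b, U a -> U b ->
  exists g : R -> Y,
    [/\ g 0 = a, g 1 = b, forall t, 0 <= t <= 1 -> U (g t)
      & forall s t, 0 <= s <= 1 -> 0 <= t <= 1 ->
          mdist (g s) (g t) = mdist a b * `|s - t|].

Definition CAT kappa U : Prop := is_geodesic U /\
  forall a b c p, U a -> U b -> U c -> U p ->
    ((mdist a b + mdist b c + mdist c a)%:E < 2%:E * diam_model kappa)%E ->
    mdist b p + mdist p c = mdist b c ->
    exists a' b' c' p', [/\ model kappa a', model kappa b',
        model kappa c' & model kappa p'] /\
      [/\ dmodel kappa a' b' = mdist a b, dmodel kappa b' c' = mdist b c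
        & dmodel kappa c' a' = mdist c a] /\
      [/\ dmodel kappa p' b' = mdist p b, dmodel kappa p' c' = mdist p c
        & mdist a p <= dmodel kappa a' p'].

Definition catrad kappa x : \bar R :=
  ereal_sup [set r%:E | r in [set r : R |
    (r%:E <= 2^-1%:E * diam_model kappa)%E /\
    CAT kappa [set y | mdist x y <= r]]].

Definition catball kappa x : set Y :=
  [set y | ((mdist x y)%:E < catrad kappa x)%E].

Definition mbounded A : Prop :=
  exists M : R, forall y z, A y -> A z -> mdist y z <= M.

End cat.

Definition local_CAT (R : realType) (kappa : R) (Y : metricType R) : Prop :=
  forall x : Y, exists2 U : set Y, nbhs x U & CAT kappa U.

Definition separable (T : topologicalType) : Prop :=
  exists2 D : set T, countable D & dense D.

(** A geodesic starting at [x] and defined on [0, e), represented by a total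
    function whose values off that interval are irrelevant: the distance
    [geo_dist] below only sees the germ at [0]. *)
Record geo (R : realType) (Y : metricType R) (x : Y) := Geo {
  geo_fun :> R -> Y ;
  geo0 : geo_fun 0 = x ;
  geoP : exists e c : R, 0 < e /\ forall s t, 0 <= s < e -> 0 <= t < e ->
    mdist (geo_fun s) (geo_fun t) = c * `|s - t| }.

Section limf_esup_facts.
Context {R : realType} {X : choiceType} {T : filteredType X}.
Context (F : set_system T) {FF : ProperFilter F}.
Implicit Types f g : T -> \bar R.

Lemma limf_esup_le f (l : \bar R) :
  (\forall t \near F, (f t <= l)%E) -> (limf_esup f F <= l)%E.
Proof.
move=> Fl; apply: (@le_trans _ _ (ereal_sup (f @` [set t | (f t <= l)%E]))).
  by apply: ereal_inf_lbound; exists [set t | (f t <= l)%E].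
by apply: ge_ereal_sup => _ /= [t tl <-].
Qed.

Lemma limf_esup_lt f (l : \bar R) :
  (limf_esup f F < l)%E -> \forall t \near F, (f t < l)%E.
Proof.
move=> /ereal_inf_lt[_ /= [V FV <-] Vl]; apply: filterS FV => t Vt.
by apply: le_lt_trans Vl; apply: ereal_sup_ubound; exists t.
Qed.

Lemma limf_esup_eq f g : (\forall t \near F, f t = g t) ->
  limf_esup f F = limf_esup g F.
Proof.
move=> fg; apply/eqP; rewrite eq_le; apply/andP; split.
- apply/le_ereal_inf_tmp => _ /= [V FV <-].
  apply: limf_esup_le; apply: filterS2 fg FV => t -> Vt.
  by apply: ereal_sup_ubound; exists t.
- apply/le_ereal_inf_tmp => _ /= [V FV <-].
  apply: limf_esup_le; apply: filterS2 fg FV => t <- Vt.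
  by apply: ereal_sup_ubound; exists t.
Qed.

End limf_esup_facts.

Section tangent_cone.
Context {R : realType} {Y : metricType R}.
Implicit Types x y z : Y.

Definition geo_edist x (g h : geo x) : \bar R :=
  limf_esup (fun t => (mdist (g t) (h t) / t)%:E) (0 : R)^'+.

Definition geo_dist x (g h : geo x) : R := fine (geo_edist g h).

Lemma geo_speed x (g : geo x) :
  exists c : R, \forall t \near (0 : R)^'+, mdist x (g t) = c * t.
Proof.
have [e [c [e0 gc]]] := geoP g; exists c; near=> t.
have t0 : 0 < t by near: t; exact: nbhs_right_gt.
have te : t < e by near: t; exact: nbhs_right_lt.
by rewrite -{1}(geo0 g) gc ?lexx ?(ltW t0)//= sub0r normrN gtr0_norm.
Unshelve. all: by end_near. Qed.

Lemma geo_edist_fin x (g h : geo x) : geo_edist g h \is a fin_num.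
Proof.
have [c hc] := geo_speed g; have [c' hc'] := geo_speed h.
rewrite fin_numElt; apply/andP; split.
- rewrite (@lt_le_trans _ _ 0%E)//; apply/le_ereal_inf_tmp => _ /= [V FV <-].
  have [t [Vt t0]] : exists t, V t /\ 0 < t.
    near (0 : R)^'+ => t; exists t; split; near: t => //.
    exact: nbhs_right_gt.
  rewrite (@le_trans _ _ (mdist (g t) (h t) / t)%:E)//.
    by rewrite lee_fin divr_ge0 ?mdist_ge0// ltW.
  by apply: ereal_sup_ubound; exists t.
- rewrite (@le_lt_trans _ _ (c + c')%:E) ?ltry//; apply: limf_esup_le.
  near=> t.
  have t0 : 0 < t by near: t; exact: nbhs_right_gt.
  have gt : mdist x (g t) = c * t by near: t.
  have ht : mdist x (h t) = c' * t by near: t.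
  rewrite lee_fin ler_pdivrMr// (le_trans (metric_triangle _ x _))//.
  by rewrite metric_sym gt ht mulrDl.
Unshelve. all: by end_near. Qed.

Lemma geo_distE x (g h : geo x) : (geo_dist g h)%:E = geo_edist g h.
Proof. by rewrite fineK// geo_edist_fin. Qed.

Lemma geo_distxx x (g : geo x) : geo_dist g g = 0.
Proof.
have h0 : geo_edist g g = limf_esup (fun=> 0%E) (0 : R)^'+.
  by apply: limf_esup_eq; near=> t; rewrite mdistxx mul0r.
apply: EFin_inj; rewrite geo_distE h0; apply/eqP; rewrite eq_le.
rewrite limf_esup_le ?limf_esup_ge0//; exact: nearW.
Unshelve. all: by end_near. Qed.

Lemma geo_dist_sym x (g h : geo x) : geo_dist g h = geo_dist h g.
Proof.
by congr fine; congr limf_esup; apply/funext => t; rewrite metric_sym.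
Qed.

Lemma geo_dist_triangle x (h g k : geo x) :
  geo_dist g k <= geo_dist g h + geo_dist h k.
Proof.
apply/ler_addgt0Pl => e e0; rewrite -lee_fin geo_distE; apply: limf_esup_le.
have near_lt (a b : geo x) : \forall t \near (0 : R)^'+,
    mdist (a t) (b t) / t < geo_dist a b + e / 2.
  have := limf_esup_lt (F := (0 : R)^'+)
    (f := fun t => (mdist (a t) (b t) / t)%:E) (l := (geo_dist a b + e / 2)%:E).
  rewrite -/(geo_edist a b) -geo_distE lte_fin ltrDl divr_gt0// => /(_ _ isT).
  by apply: filterS => t; rewrite lte_fin.
near=> t.
have t0 : 0 < t by near: t; exact: nbhs_right_gt.
have h1 : mdist (g t) (h t) / t < geo_dist g h + e / 2.
  by near: t; exact: near_lt.
have h2 : mdist (h t) (k t) / t < geo_dist h k + e / 2.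
  by near: t; exact: near_lt.
have h3 : mdist (g t) (k t) / t <= mdist (g t) (h t) / t + mdist (h t) (k t) / t.
  by rewrite -mulrDl ler_pM2r ?invr_gt0// metric_triangle.
rewrite lee_fin; lra.
Unshelve. all: by end_near. Qed.

Definition geo_pseudodist x : pseudodist R (geo x) :=
  PseudoDist (@geo_distxx x) (@geo_dist_sym x) (@geo_dist_triangle x).

Definition tcone x : Type := completion (geo_pseudodist x).

HB.instance Definition _ x := Metric.on (tcone x).

Definition velocity x (g : geo x) : tcone x :=
  to_completion (geo_pseudodist x) g.

Lemma geo_cst_subproof x : exists e c : R, 0 < e /\
  forall s t, 0 <= s < e -> 0 <= t < e -> mdist x x = c * `|s - t|.
Proof. by exists 1, 0; split=> // s t _ _; rewrite mdistxx mul0r. Qed.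

Definition geo_cst x : geo x :=
  @Geo R Y x (fun=> x) erefl (geo_cst_subproof x).

Definition tzero x : tcone x := velocity (geo_cst x).

HB.instance Definition _ x := isPointed.Build (tcone x) (tzero x).

Definition tnorm x (v : tcone x) : R := mdist v (tzero x).

Lemma geo_scale_subproof0 x (l : {nonneg R}) (g : geo x) : g (l%:num * 0) = x.
Proof. by rewrite mulr0 geo0. Qed.

Lemma geo_scale_subproof x (l : {nonneg R}) (g : geo x) :
  exists e c : R, 0 < e /\ forall s t, 0 <= s < e -> 0 <= t < e ->
    mdist (g (l%:num * s)) (g (l%:num * t)) = c * `|s - t|.
Proof.
have [e [c [e0 gc]]] := geoP g.
have l1 : 0 < l%:num + 1 by rewrite ltr_wpDl.
exists (e / (l%:num + 1)), (c * l%:num); split; first by rewrite divr_gt0.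
have lt_e s : 0 <= s < e / (l%:num + 1) -> 0 <= l%:num * s < e.
  move=> /andP[s0 se]; rewrite mulr_ge0//=.
  rewrite ltr_pdivlMr// mulrDr mulr1 in se.
  by rewrite (le_lt_trans _ se)// mulrC lerDl.
move=> s t /lt_e hs /lt_e ht.
by rewrite gc// -mulrBr normrM ger0_norm// mulrA.
Qed.

Definition geo_scale x (l : {nonneg R}) (g : geo x) : geo x :=
  Geo (geo_scale_subproof0 l g) (geo_scale_subproof l g).

(** Scaling by [l]: the continuous extension to [T_x Y] of the map induced on
    velocities by [geo_scale l]. *)
Definition tscale x (l : {nonneg R}) : tcone x -> tcone x :=
  get [set S : tcone x -> tcone x | continuous S /\
    forall g : geo x, S (velocity g) = velocity (geo_scale l g)].

(** [T_x Y] is CAT(0) when [Y] is local CAT(kappa), hence its midpoints exist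
    and are unique. *)
Definition tmidpoint x (v w : tcone x) : tcone x :=
  get [set m : tcone x | mdist v m = mdist v w / 2 /\
    mdist m w = mdist v w / 2].

Definition toplus x (v w : tcone x) : tcone x :=
  tscale 2%:nng (tmidpoint v w).

(** For [Y] local CAT(kappa), there is exactly one such map as soon as [y] and
    [z] belong to [catball kappa x] for some [x]; the value is junk otherwise. *)
Definition ddist z y : tcone z -> R :=
  get [set D : tcone z -> R | continuous D /\
    forall g : geo z,
      (mdist (g h) y - mdist z y) / h @[h --> (0 : R)^'+] --> D (velocity g)].

Definition tbundle : Type := {x : Y & tcone x}.

End tangent_cone.
Arguments tbundle {R} Y.

Section derivations.
Context {R : realType} {Y : metricType R}.
Implicit Types (f : Y -> R) (A : set Y).

Definition is_lipschitz f : Prop :=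
  exists L : R, forall y z, `|f y - f z| <= L * mdist y z.

Definition Lip f A : R :=
  inf [set L : R | 0 <= L /\
    forall y z, A y -> A z -> `|f y - f z| <= L * mdist y z].

Definition lipa f (x : Y) : R := lim (Lip f (ball x r) @[r --> (0 : R)^'+]).

Definition LIPb f : Prop :=
  is_lipschitz f /\ exists M : R, forall x, `|f x| <= M.

End derivations.

Notation borel Y := (g_sigma_algebraType (@open Y)).

Section measured_derivations.
Context {R : realType} {Y : completeMetricType R}.
Variable mu : {measure set (borel Y) -> \bar R}.

(** Elements of [L^0(mu)] are represented by Borel functions; only the values
    of [b] on [LIPb] matter. *)
Definition is_derivation (b : (Y -> R) -> (Y -> R)) : Prop :=
  [/\ forall f, LIPb f -> measurable_fun setT (b f : borel Y -> R),
      forall (a : R) f h, LIPb f -> LIPb h ->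
        {ae mu, forall x, b (fun y => a * f y + h y) x = a * b f x + b h x},
      forall f h, LIPb f -> LIPb h ->
        {ae mu, forall x, b (fun y => f y * h y) x = f x * b h x + h x * b f x}
    & exists2 g : borel Y -> R, measurable_fun setT g &
        forall f, LIPb f -> {ae mu, forall x, `|b f x| <= g x * lipa f x}].

(** [g] is the essential supremum, in the lattice [L^0(mu)], of the family
    of the functions satisfying [P]. *)
Definition is_ess_sup (P : set (Y -> R)) (g : Y -> R) : Prop :=
  [/\ measurable_fun setT (g : borel Y -> R),
      forall f, P f -> {ae mu, forall x, f x <= g x}
    & forall g' : Y -> R, measurable_fun setT (g' : borel Y -> R) ->
        (forall f, P f -> {ae mu, forall x, f x <= g' x}) ->
        {ae mu, forall x, g x <= g' x}].

(** The essential supremum is unique up to [mu]-a.e. equality; [get] picks a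
    representative. *)
Definition der_norm (b : (Y -> R) -> (Y -> R)) : Y -> R :=
  get (is_ess_sup [set b f | f in [set f | LIPb f /\ Lip f setT <= 1]]).

Definition der_ext (b : (Y -> R) -> (Y -> R)) (f : Y -> R) : Y -> R :=
  get [set h : Y -> R | measurable_fun setT (h : borel Y -> R) /\
    forall (c : Y) (r : R) (f' : Y -> R), LIPb f' ->
      (forall y, ball c r y -> f' y = f y) ->
      {ae mu, forall x, ball c r x -> h x = b f' x}].

Definition integrable_on_bounded (g : Y -> R) : Prop :=
  forall B : set (borel Y), measurable B -> mbounded (B : set Y) ->
    mu.-integrable B (EFin \o (g : borel Y -> R)).

(** Lipschitz functions with bounded support belong to [LIPb]. *)
Definition is_divergence (b : (Y -> R) -> (Y -> R)) (h : Y -> R) : Prop :=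
  [/\ integrable_on_bounded (der_norm b), integrable_on_bounded h
    & forall f, is_lipschitz f -> mbounded [set x | f x != 0] ->
        (\int[mu]_x (b f x)%:E = - \int[mu]_x (f x * h x)%:E)%E].

Definition Der22 (b : (Y -> R) -> (Y -> R)) : Prop :=
  [/\ is_derivation b, (der_norm b : borel Y -> R) \in Lfun mu 2%:E
    & exists2 h : Y -> R, is_divergence b h &
        (h : borel Y -> R) \in Lfun mu 2%:E].

End measured_derivations.

Section tangent_bundle.
Context {R : realType} (kappa : R) {Y : completeMetricType R}.

HB.instance Definition _ := gen_eqMixin (tbundle Y).
HB.instance Definition _ := gen_choiceMixin (tbundle Y).
HB.instance Definition _ :=
  isPointed.Build (tbundle Y) (existT _ (point : Y) (tzero point)).

Definition tbundle_ddist (x y : Y) (p : tbundle Y) : R :=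
  if ((mdist x (projT1 p))%:E < catrad kappa x)%E
  then ddist y (projT2 p) else 0.

Definition tbundle_gen : set (set (tbundle Y)) :=
  [set (@projT1 Y (@tcone R Y)) @^-1` B
    | B in (measurable : set (set (borel Y)))] `|`
  [set A | exists x y (B : set R),
    [/\ catball kappa x y, measurable B & A = tbundle_ddist x y @^-1` B]].

Definition borel_section (v : forall x : Y, tcone x) : Prop :=
  measurable_fun setT
    ((fun x => existT _ x (v x)) : borel Y -> g_sigma_algebraType tbundle_gen).

Variable mu : {measure set (borel Y) -> \bar R}.

Definition L2_section (v : forall x : Y, tcone x) : Prop :=
  borel_section v /\ (\int[mu]_x ((tnorm (v x)) ^+ 2)%:E < +oo)%E.

(** [F(b)] is the [mu]-a.e. class of the sections [v] with this property, any
    two of which are [mu]-a.e. equal. *)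
Definition represents_F (b : (Y -> R) -> (Y -> R)) (v : forall x : Y, tcone x)
    : Prop :=
  L2_section v /\
  forall xb y : Y, catball kappa xb y ->
    {ae mu, forall x, catball kappa xb x ->
      ddist y (v x) = der_ext mu b (mdist y) x}.

End tangent_bundle.

(* Main.v *)
Require Import Defs.
From HB Require Import structures.
From mathcomp Require Import all_boot all_order all_algebra.
From mathcomp Require Import ring lra.
From mathcomp Require Import all_classical all_reals all_analysis.
From mathcomp Require Import measurable_realfun.

Set Implicit Arguments.
Unset Strict Implicit.
Unset Printing Implicit Defensive.

Import Order.TTheory GRing.Theory Num.Theory.
Import numFieldNormedType.Exports.

Local Open Scope classical_set_scope.
Local Open Scope ring_scope.

(** A tangent vector [v] of [T_x Y] is known through its scalar products
    [ip v w], the polarization of the metric of the cone with respect to its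
    apex. The theorem amounts to the linearity of [b |-> ip (F(b)(x)) w] for all
    [w]: if [ip a w = ip v1 w + ip v2 w] and [ip s w = ip v1 w - ip v2 w] for all
    [w], then half of [a] is a midpoint of [v1] and [v2], midpoints are unique,
    and the norms of [a] and [s] satisfy the parallelogram identity, with
    [mdist v1 v2 = tnorm s] ([cone_sum]).

    Linearity is read off distance functions. The value of a derivation at
    [mdist y] is additive in the derivation, also after the extension from bounded
    functions ([der_ext_comb]), and it equals the differential of [mdist y] along
    [F(b)]. In a CAT(kappa) neighborhood, the first variation
    formula ([first_variation]) identifies this differential with
    [- ip v w], where [w] is the direction of the geodesic from [x] to [y].
    Letting [y] range over a countable dense set, so that null sets can be
    discarded, the multiples of these directions are dense in the cone
    ([directions_dense]); as [ip] is homogeneous ([ip_scale]), linearity holds for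
    all [w] ([ip_of_ddist], [represents_ip]). All these facts come from a single
    inequality, Stewart's theorem for the triangles of a CAT(kappa) space
    ([CAT_stewart]), by expansions to the second order at [x]; they are
    collected in [good_ball].

    There remains [tnorm (vsub x) = |b1 - b2| (x)], that is [|F(b)| = |b|] almost
    everywhere ([represents_norm]). That the norm is at most any bound of the
    [b f] follows from the density of directions. Conversely one has to bound
    [b f], for all [f] with Lipschitz constant [1], by a function [G] which bounds
    the derivatives of the distance functions. Locally such an [f] is the
    infimum of countably many functions [f y + mdist y]; upper bounds pass to
    minima of two functions by the Leibniz rule, applied to a square root which
    approximates the absolute value ([der_le_min]), and to limits of functions
    because the existence of a divergence permits to integrate by parts
    ([der_le_lim], [der_le_dist]). *)

(** * Stewart's inequality *)

Section model_functions.
Context {R : realType} (kappa : R).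

(** The solution of [s'' = - kappa * s], [s 0 = 0], [s' 0 = 1], and its
    derivative. *)
Definition sn (r : R) : R :=
  if 0 < kappa then sin (Num.sqrt kappa * r) / Num.sqrt kappa
  else if kappa < 0 then
    (expR (Num.sqrt (- kappa) * r) - expR (- (Num.sqrt (- kappa) * r)))
      / (2 * Num.sqrt (- kappa))
  else r.

Definition cn (r : R) : R :=
  if 0 < kappa then cos (Num.sqrt kappa * r)
  else if kappa < 0 then
    (expR (Num.sqrt (- kappa) * r) + expR (- (Num.sqrt (- kappa) * r))) / 2
  else 1.

(** This is [(1 - cn r) / kappa], see [cn_md], written so as to make sense for
    [kappa = 0] as well, where it is [r ^+ 2 / 2]: the modified distance in which
    Stewart's theorem takes the same form for all [kappa]. *)
Definition md (r : R) : R := 2 * sn (r / 2) ^+ 2.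

Lemma sn0 : sn 0 = 0.
Proof.
rewrite /sn; case: ifP => _; first by rewrite mulr0 sin0 mul0r.
by case: ifP => _ //; rewrite mulr0 oppr0 subrr mul0r.
Qed.

Lemma snN r : sn (- r) = - sn r.
Proof.
rewrite /sn; case: ifP => _; first by rewrite mulrN sinN mulNr.
by case: ifP => _ //; rewrite mulrN opprK; ring.
Qed.

Lemma cnN r : cn (- r) = cn r.
Proof.
rewrite /cn; case: ifP => _; first by rewrite mulrN cosN.
by case: ifP => _ //; rewrite mulrN opprK addrC.
Qed.

Lemma expRNK (x : R) : expR x * expR (- x) = 1.
Proof. by rewrite expRN divff// gt_eqF// expR_gt0. Qed.

Lemma snD r s : sn (r + s) = sn r * cn s + cn r * sn s.
Proof.
rewrite /sn /cn; case: ifP => [k0|_].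
  by rewrite mulrDr sinD; ring.
case: ifP => [k0|_]; last by rewrite mul1r mulr1.
have k1 : Num.sqrt (- kappa) != 0 by rewrite gt_eqF// sqrtr_gt0 oppr_gt0.
by rewrite mulrDr opprD !expRD; field.
Qed.

Lemma cnD r s : cn (r + s) = cn r * cn s - kappa * (sn r * sn s).
Proof.
rewrite /sn /cn; case: ifP => [k0|/negbT k0].
  have k1 : Num.sqrt kappa != 0 by rewrite gt_eqF// sqrtr_gt0.
  have kE := sqr_sqrtr (ltW k0).
  rewrite mulrDr cosD; move: (Num.sqrt kappa) k1 kE => k k1 <-.
  by field.
case: ifP => [k1|/negbT k1]; last first.
  by rewrite (_ : kappa = 0) ?mulr1 ?mul0r ?subr0//; lra.
have k2 : Num.sqrt (- kappa) != 0 by rewrite gt_eqF// sqrtr_gt0 oppr_gt0.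
have kE : kappa = - Num.sqrt (- kappa) ^+ 2.
  by rewrite sqr_sqrtr ?opprK// oppr_ge0 ltW.
rewrite mulrDr opprD; move: (Num.sqrt (- kappa)) k2 kE => k k2 ->.
by rewrite !expRD; field.
Qed.

Lemma cn2sn2 r : cn r ^+ 2 + kappa * sn r ^+ 2 = 1.
Proof.
have := cnD r (- r); rewrite snN cnN subrr => H.
have -> : cn r ^+ 2 + kappa * sn r ^+ 2 = cn 0 by rewrite H; ring.
rewrite /cn; case: ifP => _; first by rewrite mulr0 cos0.
by case: ifP => _ //; rewrite mulr0 oppr0 expR0; field.
Qed.

Lemma cn0 : cn 0 = 1.
Proof.
rewrite /cn; case: ifP => _; first by rewrite mulr0 cos0.
by case: ifP => _ //; rewrite mulr0 oppr0 expR0; field.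
Qed.

Lemma md0 : md 0 = 0.
Proof. by rewrite /md mul0r sn0 expr0n mulr0. Qed.

Lemma cn_md r : cn r = 1 - kappa * md r.
Proof.
rewrite /md {1}(splitr r) cnD.
by have := cn2sn2 (r / 2); lra.
Qed.

Lemma snD4 r s : sn (r + s) = sn r + sn s
  - 4 * kappa * (sn ((r + s) / 2) * sn (r / 2) * sn (s / 2)).
Proof.
rewrite (mulrDl r s); have [] := (splitr r, splitr s).
move: (r / 2) (s / 2) => x y -> ->; rewrite !(snD, cnD).
have h3 : cn x * sn x * (cn y ^+ 2 + kappa * sn y ^+ 2) = cn x * sn x.
  by rewrite cn2sn2 mulr1.
have h4 : cn y * sn y * (cn x ^+ 2 + kappa * sn x ^+ 2) = cn y * sn y.
  by rewrite cn2sn2 mulr1.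
lra.
Qed.

Lemma sn_sub r s :
  sn s - sn r = 2 * (cn ((r + s) / 2) * sn ((s - r) / 2)).
Proof.
transitivity (sn ((r + s) / 2 + (s - r) / 2)
    - sn ((r + s) / 2 - (s - r) / 2)).
  by congr (sn _ - sn _); field.
by rewrite !snD snN cnN; ring.
Qed.

(** In a triangle with base [r], for the point of the base at distance [s] from
    one of its ends, this collects the terms which remain in Stewart's inequality
    after the side from the apex to the other end is compared with [r]. *)
Lemma stewart_base r s :
  sn s * md r - 4 * (sn (r / 2) * sn (s / 2) * sn ((r - s) / 2))
  = sn r * md s.
Proof.
rewrite (mulrDl r (- s)) mulNr /md; have [] := (splitr r, splitr s).
move: (r / 2) (s / 2) => x y -> ->; rewrite !(snD, snN, cnN); ring.
Qed.

Lemma is_derive_sn (r : R) : is_derive r 1 sn (cn r).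
Proof.
rewrite /sn /cn; case: ifP => [k0|_].
  have k1 : Num.sqrt kappa != 0 by rewrite gt_eqF// sqrtr_gt0.
  have H : is_derive r 1 (fun x => Num.sqrt kappa * x) (Num.sqrt kappa).
    by apply: is_derive_eq; rewrite /GRing.scale/= mulr1.
  apply: is_derive_eq.
  by rewrite /GRing.scale/=; field.
case: ifP => [k0|_]; last exact: is_derive_id.
have k1 : Num.sqrt (- kappa) != 0 by rewrite gt_eqF// sqrtr_gt0 oppr_gt0.
apply: is_derive_eq.
rewrite /GRing.scale/=; field.
exact: k1.
Qed.

Lemma continuous_sn : continuous sn.
Proof.
move=> r; apply: differentiable_continuous; apply/derivable1_diffP.
exact: (@ex_derive _ _ _ _ _ _ _ (is_derive_sn r)).
Qed.

Lemma continuous_md : continuous md.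
Proof.
move=> r; rewrite /md; apply: cvgM; first exact: cvg_cst.
have H : sn (x / 2) @[x --> r] --> sn (r / 2).
  apply: (@cvg_comp _ _ _ (fun x => x / 2) sn); last exact: continuous_sn.
  by apply: cvgM; [exact: cvg_id|exact: cvg_cst].
by rewrite expr2; exact: cvgM.
Qed.

(** Below half of the diameter of the model surface, all the functions above
    are monotone. For [kappa <= 0] the value only has to be positive. *)
Definition rad : R := if 0 < kappa then pi / (2 * Num.sqrt kappa) else 1.

Lemma rad_gt0 : 0 < rad.
Proof.
rewrite /rad; case: ifP => // k0.
by rewrite divr_gt0 ?pi_gt0// mulr_gt0// sqrtr_gt0.
Qed.

Lemma rad_diam : ((4 * rad)%:E <= 2%:E * diam_model kappa)%E.
Proof.
rewrite /rad /diam_model; case: ifP => [k0|_]; last first.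
  by rewrite mulry gtr0_sg// mul1e leey.
rewrite -EFinM lee_fin.
have k1 : Num.sqrt kappa != 0 by rewrite gt_eqF// sqrtr_gt0.
rewrite le_eqVlt; apply/orP; left; apply/eqP; field.
exact: k1.
Qed.

Lemma cn_ge0 r : 0 <= r <= rad -> 0 <= cn r.
Proof.
rewrite /rad /cn => /andP[r0]; case: ifP => [k0 rr|_ _].
  have k1 : 0 < Num.sqrt kappa by rewrite sqrtr_gt0.
  apply: cos_ge0_pihalf; rewrite (@le_trans _ _ 0)/= ?mulr_ge0 ?(ltW k1)//.
    rewrite mulrC -ler_pdivlMr// (le_trans rr)// le_eqVlt; apply/orP; left.
    by apply/eqP; field; rewrite gt_eqF.
  by rewrite oppr_le0 divr_ge0// pi_ge0.
by case: ifP => // _; rewrite divr_ge0// addr_ge0// expR_ge0.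
Qed.

Lemma cn_gt0 r : 0 <= r < rad -> 0 < cn r.
Proof.
rewrite /rad /cn => /andP[r0]; case: ifP => [k0 rr|_ _].
  have k1 : 0 < Num.sqrt kappa by rewrite sqrtr_gt0.
  apply: cos_gt0_pihalf; rewrite (@lt_le_trans _ _ 0)/= ?mulr_ge0 ?(ltW k1)//.
    rewrite mulrC -ltr_pdivlMr// (lt_le_trans rr)// le_eqVlt; apply/orP; left.
    by apply/eqP; field; rewrite gt_eqF.
  by rewrite oppr_lt0 divr_gt0// pi_gt0.
by case: ifP => // _; rewrite divr_gt0// addr_gt0// expR_gt0.
Qed.

Lemma sn_gt0 r : 0 < r <= rad -> 0 < sn r.
Proof.
rewrite /rad /sn => /andP[r0]; case: ifP => [k0 rr|_ _].
  have k1 : 0 < Num.sqrt kappa by rewrite sqrtr_gt0.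
  rewrite divr_gt0//; apply: sin_gt0_pi; rewrite mulr_gt0//= mulrC -ltr_pdivlMr//.
  rewrite (le_lt_trans rr)// ltr_pM2l ?pi_gt0// ltf_pV2 ?posrE ?mulr_gt0//.
  by rewrite ltr_pMl// ltr1n.
case: ifP => // k0.
have k1 : 0 < Num.sqrt (- kappa) by rewrite sqrtr_gt0 oppr_gt0.
rewrite divr_gt0 ?mulr_gt0// subr_gt0 ltr_expR.
have : 0 < Num.sqrt (- kappa) * r by rewrite mulr_gt0.
lra.
Qed.

Lemma sn_ge0 r : 0 <= r <= rad -> 0 <= sn r.
Proof.
move=> /andP[]; rewrite le_eqVlt => /predU1P[<- _|r0 rr]; first by rewrite sn0.
by rewrite ltW// sn_gt0// r0.
Qed.

Lemma sn_lt r s : 0 <= r -> r < s -> s <= rad -> sn r < sn s.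
Proof.
move=> r0 rs sr; rewrite -subr_gt0 sn_sub mulr_gt0// mulr_gt0//.
  by apply: cn_gt0; apply/andP; split; lra.
by apply: sn_gt0; apply/andP; split; lra.
Qed.

Lemma md_ge0 r : 0 <= md r.
Proof. by rewrite mulr_ge0// sqr_ge0. Qed.

Lemma md_lt r s : 0 <= r -> r < s -> s <= rad -> md r < md s.
Proof.
move=> r0 rs sr; rewrite /md ltr_pM2l// ltr_sqr ?nnegrE.
- by apply: sn_lt; lra.
- by apply: sn_ge0; apply/andP; split; lra.
- by apply: sn_ge0; apply/andP; split; lra.
Qed.

Lemma md_le r s : 0 <= r -> r <= s -> s <= rad -> md r <= md s.
Proof.
move=> r0; rewrite le_eqVlt => /predU1P[->//|rs sr].
by rewrite ltW// md_lt.
Qed.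

Lemma is_derive_md (r : R) : is_derive r 1 md (sn r).
Proof.
have H := is_derive_sn (r / 2).
have H1 : is_derive r 1 (fun x : R => x / 2) 2^-1.
  rewrite (_ : (fun x : R => x / 2) = (fun x : R => 2^-1 * x)).
    by apply: is_derive_eq; rewrite /GRing.scale/= mulr1.
  by apply/funext => x; rewrite mulrC.
have H2 : is_derive r 1 (fun x => sn (x / 2)) (cn (r / 2) * 2^-1).
  by apply: (is_derive1_comp (f := sn) (g := fun x : R => x / 2)).
rewrite /md; apply: is_derive_eq.
by rewrite [in RHS](splitr r) snD /GRing.scale/=; field.
Qed.

Lemma cvg_sn (k : R) : sn (k * h) / h @[h --> 0^'+] --> k.
Proof.
have H1 : is_derive (0 : R) 1 (fun x : R => k * x) k.
  by apply: is_derive_eq; rewrite /GRing.scale/= mulr1.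
have H0 : is_derive (k * 0) 1 sn 1.
  by rewrite mulr0 -[X in is_derive _ _ _ X]cn0; exact: is_derive_sn.
have H2 : is_derive (0 : R) 1 (fun x => sn (k * x)) (1 * k).
  by apply: (is_derive1_comp (f := sn) (g := fun x : R => k * x)).
have := @ex_derive _ _ _ _ _ _ _ H2 => /cvg_ex[l Hl].
have lE : l = k.
  by rewrite -(mul1r k) -(@derive_val _ _ _ _ _ _ _ H2); apply/esym/cvg_lim.
move: Hl; rewrite lE => Hl.
move/cvg_dnbhs_at_right: Hl => Hl.
apply: cvg_trans Hl; apply: near_eq_cvg; near=> h.
by rewrite /= mulr0 sn0 subr0 addr0 /GRing.scale/= mulr1 mulrC.
Unshelve. all: by end_near. Qed.

Lemma cvg_md (k : R) : md (k * h) / h ^+ 2 @[h --> 0^'+] --> k ^+ 2 / 2.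
Proof.
have H : sn (k / 2 * h) / h @[h --> 0^'+] --> k / 2 by exact: cvg_sn.
have -> : k ^+ 2 / 2 = 2 * (k / 2 * (k / 2)) by field.
have H2 : 2 * (sn (k / 2 * h) / h * (sn (k / 2 * h) / h)) @[h --> 0^'+]
    --> 2 * (k / 2 * (k / 2)).
  by apply: cvgM; [exact: cvg_cst|exact: cvgM].
apply: cvg_trans H2; apply: near_eq_cvg; near=> h.
have h0 : h != 0 by rewrite gt_eqF//; near: h; exact: nbhs_right_gt.
rewrite /md (_ : k * h / 2 = k / 2 * h); last by field.
by field.
Unshelve. all: by end_near. Qed.

(** In Minkowski space, an isotropic vector orthogonal to a timelike one
    vanishes, by the equality case of the Cauchy-Schwarz inequality. *)
Lemma lightlike_eq0 (w1 w2 w3 p1 p2 p3 : R) :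
  w3 ^+ 2 = w1 ^+ 2 + w2 ^+ 2 -> p3 ^+ 2 = 1 + p1 ^+ 2 + p2 ^+ 2 ->
  w3 * p3 = w1 * p1 + w2 * p2 -> [/\ w1 = 0, w2 = 0 & w3 = 0].
Proof.
move=> hw hp h.
have h1 : (w1 * p1 + w2 * p2) ^+ 2 = (w1 ^+ 2 + w2 ^+ 2) * (1 + p1 ^+ 2 + p2 ^+ 2).
  by rewrite -h exprMn hw hp.
have h2 : w1 ^+ 2 + w2 ^+ 2 + (w1 * p2 - w2 * p1) ^+ 2 = 0 by lra.
have w10 := sqr_ge0 w1; have w20 := sqr_ge0 w2.
have c0 := sqr_ge0 (w1 * p2 - w2 * p1).
have /eqP := (ltac:(lra) : w1 ^+ 2 = 0); rewrite sqrf_eq0 => /eqP ->.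
have /eqP := (ltac:(lra) : w2 ^+ 2 = 0); rewrite sqrf_eq0 => /eqP ->.
by have /eqP := (ltac:(lra) : w3 ^+ 2 = 0); rewrite sqrf_eq0 => /eqP ->.
Qed.

(** The bilinear form whose restriction to the model surface is the cosine,
    resp. hyperbolic cosine, of the rescaled distance. *)
Definition gram (p q : R * R * R) : R :=
  if 0 < kappa then p.1.1 * q.1.1 + p.1.2 * q.1.2 + p.2 * q.2
  else p.2 * q.2 - p.1.1 * q.1.1 - p.1.2 * q.1.2.

Lemma gramC p q : gram p q = gram q p.
Proof. by rewrite /gram; case: ifP => _; ring. Qed.

Lemma cn_dmodel p q : kappa != 0 -> model kappa p -> model kappa q ->
  cn (dmodel kappa p q) = gram p q.
Proof.
rewrite /cn /dmodel /model /gram => k0; case: ifP => [kp /= hp hq|kp].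
  have k1 : Num.sqrt kappa != 0 by rewrite gt_eqF// sqrtr_gt0.
  rewrite mulrCA mulfV// mulr1 acosK// in_itv/=.
  have := sqr_ge0 (p.1.1 - q.1.1); have := sqr_ge0 (p.1.2 - q.1.2).
  have := sqr_ge0 (p.2 - q.2); have := sqr_ge0 (p.1.1 + q.1.1).
  have := sqr_ge0 (p.1.2 + q.1.2); have := sqr_ge0 (p.2 + q.2).
  by move=> *; apply/andP; split; lra.
have kn : kappa < 0 by rewrite lt_neqAle k0 leNgt kp.
rewrite kn /= => -[hp p0] [hq q0].
have k1 : Num.sqrt (- kappa) != 0 by rewrite gt_eqF// sqrtr_gt0 oppr_gt0.
rewrite mulrCA mulfV// mulr1 /arcosh.
set u := _ - _ - _.
have u1 : 1 <= u.
  rewrite /u; move: p0 q0 hp hq {u}.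
  move: (p.1.1) (p.1.2) (p.2) (q.1.1) (q.1.2) (q.2) => a b c d e f c0 f0 hp hq.
  rewrite lerBrDl lerBrDl; set x := _ + _.
  have [x0|x0] := leP x 0; first by rewrite (le_trans x0)// mulr_ge0// ltW.
  rewrite -ler_sqr ?nnegrE ?mulr_ge0 ?(ltW x0) ?(ltW c0) ?(ltW f0)//.
  have hc : c ^+ 2 = 1 + a ^+ 2 + b ^+ 2 by lra.
  have hf : f ^+ 2 = 1 + d ^+ 2 + e ^+ 2 by lra.
  rewrite exprMn hc hf /x.
  have := sqr_ge0 (a * e - b * d); have := sqr_ge0 (a - d).
  have := sqr_ge0 (b - e); lra.
set s := Num.sqrt _.
have s2 : s ^+ 2 = u ^+ 2 - 1 by rewrite sqr_sqrtr// subr_ge0 exprn_ege1.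
have us : 0 < u + s by rewrite ltr_wpDr ?sqrtr_ge0// (lt_le_trans ltr01).
rewrite expRN lnK ?posrE//.
have us0 : u + s != 0 by rewrite gt_eqF.
have -> : (u + s)^-1 = u - s.
  by apply: (mulfI us0); rewrite mulfV// [RHS]mulrC -subr_sqr s2; ring.
by field.
Qed.

Lemma gramxx p : kappa != 0 -> model kappa p -> gram p p = 1.
Proof.
rewrite /gram /model => k0; case: ifP => [_ /= <-|kp]; first by ring.
have kn : kappa < 0 by rewrite lt_neqAle k0 leNgt kp.
by rewrite kn/= => -[<- _]; ring.
Qed.

(** A point [p] on the segment [b c] is the combination of [b] and [c] with
    weights [sn (d p c)] and [sn (d p b)] over [sn (d b c)]: the difference is
    isotropic, and moreover orthogonal to [p] in the hyperbolic case. *)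
Lemma gram_segment a b c p : kappa != 0 ->
  model kappa b -> model kappa c -> model kappa p ->
  dmodel kappa p b + dmodel kappa p c = dmodel kappa b c ->
  gram a p * sn (dmodel kappa b c)
  = sn (dmodel kappa p c) * gram a b + sn (dmodel kappa p b) * gram a c.
Proof.
move=> k0 hb hc hp hL.
have := cn_dmodel k0 hp hb; have := cn_dmodel k0 hp hc.
have := cn_dmodel k0 hb hc; rewrite -hL.
move: (dmodel _ _ _) (dmodel _ _ _) => ga be; rewrite snD cnD.
have := cn2sn2 be; have := cn2sn2 ga.
move: (sn be) (cn be) (sn ga) (cn ga) => sb cb sg cg h1 h2.
have := gramxx k0 hb; have := gramxx k0 hc; have := gramxx k0 hp.
rewrite /gram; set L := sb * cg + cb * sg.
set w1 := L * p.1.1 - sg * b.1.1 - sb * c.1.1.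
set w2 := L * p.1.2 - sg * b.1.2 - sb * c.1.2.
set w3 := L * p.2 - sg * b.2 - sb * c.2.
have hL2 : L ^+ 2 = sb ^+ 2 + sg ^+ 2
    + 2 * (sb * sg * (cb * cg - kappa * (sb * sg))).
  have e1 : sb ^+ 2 * (cg ^+ 2 + kappa * sg ^+ 2) = sb ^+ 2 by rewrite h1 mulr1.
  have e2 : sg ^+ 2 * (cb ^+ 2 + kappa * sb ^+ 2) = sg ^+ 2 by rewrite h2 mulr1.
  rewrite /L; lra.
case: ifP => kp gpp gcc gbb gbc gpc gpb.
- have hw : w1 ^+ 2 + w2 ^+ 2 + w3 ^+ 2 = 0.
    have -> : w1 ^+ 2 + w2 ^+ 2 + w3 ^+ 2 =
      L ^+ 2 * (p.1.1 * p.1.1 + p.1.2 * p.1.2 + p.2 * p.2)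
      + sg ^+ 2 * (b.1.1 * b.1.1 + b.1.2 * b.1.2 + b.2 * b.2)
      + sb ^+ 2 * (c.1.1 * c.1.1 + c.1.2 * c.1.2 + c.2 * c.2)
      - 2 * L * sg * (p.1.1 * b.1.1 + p.1.2 * b.1.2 + p.2 * b.2)
      - 2 * L * sb * (p.1.1 * c.1.1 + p.1.2 * c.1.2 + p.2 * c.2)
      + 2 * (sb * sg * (b.1.1 * c.1.1 + b.1.2 * c.1.2 + b.2 * c.2)).
      by rewrite /w1 /w2 /w3; ring.
    rewrite gpp gbb gcc -gpb -gpc -gbc.
    have : 2 * L * (sb * cg + cb * sg) = 2 * L ^+ 2 by rewrite -/L; ring.
    lra.
  have w10 := sqr_ge0 w1; have w20 := sqr_ge0 w2; have w30 := sqr_ge0 w3.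
  have /eqP := (ltac:(lra) : w1 ^+ 2 = 0); rewrite sqrf_eq0 => /eqP e1.
  have /eqP := (ltac:(lra) : w2 ^+ 2 = 0); rewrite sqrf_eq0 => /eqP e2.
  have /eqP := (ltac:(lra) : w3 ^+ 2 = 0); rewrite sqrf_eq0 => /eqP e3.
  have : a.1.1 * w1 + a.1.2 * w2 + a.2 * w3 = 0 by rewrite e1 e2 e3; ring.
  by rewrite /w1 /w2 /w3; lra.
- have hw : w3 ^+ 2 = w1 ^+ 2 + w2 ^+ 2.
    apply/eqP; rewrite -subr_eq0; apply/eqP.
    have -> : w3 ^+ 2 - (w1 ^+ 2 + w2 ^+ 2) =
      L ^+ 2 * (p.2 * p.2 - p.1.1 * p.1.1 - p.1.2 * p.1.2)
      + sg ^+ 2 * (b.2 * b.2 - b.1.1 * b.1.1 - b.1.2 * b.1.2)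
      + sb ^+ 2 * (c.2 * c.2 - c.1.1 * c.1.1 - c.1.2 * c.1.2)
      - 2 * L * sg * (p.2 * b.2 - p.1.1 * b.1.1 - p.1.2 * b.1.2)
      - 2 * L * sb * (p.2 * c.2 - p.1.1 * c.1.1 - p.1.2 * c.1.2)
      + 2 * (sb * sg * (b.2 * c.2 - b.1.1 * c.1.1 - b.1.2 * c.1.2)).
      by rewrite /w1 /w2 /w3; ring.
    rewrite gpp gbb gcc -gpb -gpc -gbc.
    have : 2 * L * (sb * cg + cb * sg) = 2 * L ^+ 2 by rewrite -/L; ring.
    lra.
  have hwp : w3 * p.2 = w1 * p.1.1 + w2 * p.1.2.
    apply/eqP; rewrite -subr_eq0; apply/eqP.
    have -> : w3 * p.2 - (w1 * p.1.1 + w2 * p.1.2) =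
      L * (p.2 * p.2 - p.1.1 * p.1.1 - p.1.2 * p.1.2)
      - sg * (p.2 * b.2 - p.1.1 * b.1.1 - p.1.2 * b.1.2)
      - sb * (p.2 * c.2 - p.1.1 * c.1.1 - p.1.2 * c.1.2).
      by rewrite /w1 /w2 /w3; ring.
    by rewrite gpp -gpb -gpc /L; ring.
  have hp2 : p.2 ^+ 2 = 1 + p.1.1 ^+ 2 + p.1.2 ^+ 2 by lra.
  have [e1 e2 e3] := lightlike_eq0 hw hp2 hwp.
  have : a.2 * w3 - a.1.1 * w1 - a.1.2 * w2 = 0 by rewrite e1 e2 e3; ring.
  by rewrite /w1 /w2 /w3; lra.
Qed.

(** Stewart's theorem in the plane: the equality case of the triangle inequality
    makes [p] a barycenter of [b] and [c]. *)
Lemma euclid_segment (a b c p : R * R) (be ga : R) : 0 <= be -> 0 <= ga ->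
  (p.1 - b.1) ^+ 2 + (p.2 - b.2) ^+ 2 = be ^+ 2 ->
  (p.1 - c.1) ^+ 2 + (p.2 - c.2) ^+ 2 = ga ^+ 2 ->
  (b.1 - c.1) ^+ 2 + (b.2 - c.2) ^+ 2 = (be + ga) ^+ 2 ->
  ((a.1 - p.1) ^+ 2 + (a.2 - p.2) ^+ 2) * (be + ga) =
  ga * ((a.1 - b.1) ^+ 2 + (a.2 - b.2) ^+ 2)
  + be * ((a.1 - c.1) ^+ 2 + (a.2 - c.2) ^+ 2) - be * ga * (be + ga).
Proof.
move: a b c p => [a1 a2] [b1 b2] [c1 c2] [p1 p2] /= be0 ga0 hb hc hL.
have [L0|L0] := leP (be + ga) 0.
  have [-> ->] : be = 0 /\ ga = 0 by split; lra.
  by ring.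
set w1 := ga * (p1 - b1) + be * (p1 - c1).
set w2 := ga * (p2 - b2) + be * (p2 - c2).
have hw : w1 ^+ 2 + w2 ^+ 2 = 0.
  have -> : w1 ^+ 2 + w2 ^+ 2 =
    ga * (ga + be) * ((p1 - b1) ^+ 2 + (p2 - b2) ^+ 2)
    + be * (ga + be) * ((p1 - c1) ^+ 2 + (p2 - c2) ^+ 2)
    - ga * be * ((b1 - c1) ^+ 2 + (b2 - c2) ^+ 2).
    by rewrite /w1 /w2; ring.
  by rewrite hb hc hL; ring.
have w10 := sqr_ge0 w1; have w20 := sqr_ge0 w2.
have /eqP := (ltac:(lra) : w1 ^+ 2 = 0); rewrite sqrf_eq0 => /eqP e1.
have /eqP := (ltac:(lra) : w2 ^+ 2 = 0); rewrite sqrf_eq0 => /eqP e2.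
have L1 : be + ga != 0 by rewrite gt_eqF.
have q1 : p1 = (ga * b1 + be * c1) / (be + ga).
  by apply: (mulIf L1); rewrite divfK//; move: e1; rewrite /w1; lra.
have q2 : p2 = (ga * b2 + be * c2) / (be + ga).
  by apply: (mulIf L1); rewrite divfK//; move: e2; rewrite /w2; lra.
have -> : be * ga * (be + ga) = be * ga * (be + ga) ^+ 2 / (be + ga).
  by field.
rewrite -hL q1 q2; field.
exact: L1.
Qed.

(** Stewart's theorem, as an inequality for the triangles of a CAT(kappa)
    space. For [kappa = 0] it reads
    [d(a,p)^2 * d(b,c) <= d(p,c) * d(a,b)^2 + d(b,p) * d(a,c)^2
     - d(b,p) * d(p,c) * d(b,c)] up to a factor [1/2]. All that is used of the
    comparison hypothesis is contained in it. *)
Lemma CAT_stewart (Y : metricType R) (U : set Y) (a b c p : Y) :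
  CAT kappa U -> U a -> U b -> U c -> U p ->
  mdist a b <= rad -> mdist a c <= rad -> mdist b c <= rad ->
  mdist b p + mdist p c = mdist b c ->
  md (mdist a p) * sn (mdist b c) <=
  sn (mdist p c) * md (mdist a b) + sn (mdist b p) * md (mdist a c)
  - 4 * (sn (mdist b c / 2) * sn (mdist b p / 2) * sn (mdist p c / 2)).
Proof.
move=> [_ HU] Ua Ub Uc Up rab rac rbc hL.
have r0 := rad_gt0.
have hper : ((mdist a b + mdist b c + mdist c a)%:E < 2%:E * diam_model kappa)%E.
  apply: lt_le_trans rad_diam; rewrite lte_fin (metric_sym c a); lra.
have [a' [b' [c' [p' [[ma mb mc mp] [[dab dbc dca] [dpb dpc dap]]]]]]] :=
  HU a b c p Ua Ub Uc Up hper hL.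
rewrite metric_sym in dpb.
have L0 : 0 <= mdist b c by exact: mdist_ge0.
have snL : 0 <= sn (mdist b c) by apply: sn_ge0; apply/andP.
have [k0|k0] := eqVneq kappa 0.
  move: ma mb mc mp dab dbc dca dpb dpc dap.
  rewrite /model /dmodel /md /sn k0 ltxx /= => _ _ _ _ dab dbc dca dpb dpc dap.
  have nn (x y : R) : 0 <= x ^+ 2 + y ^+ 2 by rewrite addr_ge0// sqr_ge0.
  have sq (x y z : R) : Num.sqrt (x ^+ 2 + y ^+ 2) = z -> x ^+ 2 + y ^+ 2 = z ^+ 2.
    by move=> <-; rewrite sqr_sqrtr// nn.
  have hb := sq _ _ _ dpb; have hc := sq _ _ _ dpc.
  have hL' := sq _ _ _ dbc; rewrite -hL in hL'.
  have := @euclid_segment a'.1 b'.1 c'.1 p'.1 _ _ (mdist_ge0 b p)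
    (mdist_ge0 p c) hb hc hL'.
  have := sq _ _ _ dab => ->.
  have -> : (a'.1.1 - c'.1.1) ^+ 2 + (a'.1.2 - c'.1.2) ^+ 2 = mdist a c ^+ 2.
    by rewrite metric_sym -(sq _ _ _ dca); ring.
  have hap : mdist a p ^+ 2 <= (a'.1.1 - p'.1.1) ^+ 2 + (a'.1.2 - p'.1.2) ^+ 2.
    by rewrite -[leRHS]sqr_sqrtr ?nn// ler_sqr ?nnegrE ?mdist_ge0 ?sqrtr_ge0.
  rewrite hL => hs.
  have : mdist a p ^+ 2 * mdist b c <=
      ((a'.1.1 - p'.1.1) ^+ 2 + (a'.1.2 - p'.1.2) ^+ 2) * mdist b c.
    by rewrite ler_wpM2r.
  rewrite hs; lra.
have hs : dmodel kappa p' b' + dmodel kappa p' c' = dmodel kappa b' c'.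
  by rewrite dpb dpc dbc hL.
have := gram_segment a' k0 mb mc mp hs.
rewrite -!cn_dmodel// dpb dpc dbc dab.
rewrite (cn_dmodel k0 ma mc) gramC -(cn_dmodel k0 mc ma) dca (metric_sym c a).
move=> hG.
have := snD4 (mdist b p) (mdist p c); rewrite hL => h4.
have sab := cn_md (mdist a b); have sac := cn_md (mdist a c).
have sap := cn_md (mdist a p).
set E := sn (mdist b c / 2) * _ * _ in h4 *.
(* multiplied by [kappa], the claim compares values of [cn], which is
   decreasing for [0 < kappa] and increasing for [kappa < 0] *)
have key : 0 <= kappa * (sn (mdist p c) * md (mdist a b)
    + sn (mdist b p) * md (mdist a c) - 4 * E - md (mdist a p) * sn (mdist b c))
    <-> 0 <= (cn (mdist a p) - cn (dmodel kappa a' p')) * sn (mdist b c).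
  suff -> : kappa * (sn (mdist p c) * md (mdist a b)
    + sn (mdist b p) * md (mdist a c) - 4 * E - md (mdist a p) * sn (mdist b c))
    = (cn (mdist a p) - cn (dmodel kappa a' p')) * sn (mdist b c) by [].
  rewrite mulrBl hG sab sac sap; lra.
have [kp|kp] := ltP 0 kappa.
  rewrite -subr_ge0 -(pmulr_rge0 _ kp); apply/key.
  rewrite mulr_ge0// subr_ge0 /cn kp.
  have k1 : 0 < Num.sqrt kappa by rewrite sqrtr_gt0.
  have hpi : Num.sqrt kappa * dmodel kappa a' p' <= pi.
    have := cn_dmodel k0 ma mp.
    rewrite /dmodel /cn kp mulrCA mulfV ?gt_eqF// mulr1 => h.
    apply: acos_lepi; move: h; rewrite /gram kp => <-.
    by rewrite cos_geN1 cos_le1.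
  have l1 : 0 <= Num.sqrt kappa * mdist a p by rewrite mulr_ge0 ?mdist_ge0// ltW.
  have l2 : Num.sqrt kappa * mdist a p <= Num.sqrt kappa * dmodel kappa a' p'.
    by rewrite ler_pM2l.
  rewrite leNgt; apply/negP.
  rewrite ltr_cos ?in_itv/= ?l1 ?hpi ?(le_trans l2 hpi) ?(le_trans l1 l2)//.
  by rewrite ltNge l2.
have kn : kappa < 0 by rewrite lt_neqAle k0.
rewrite -subr_ge0 -(nmulr_rle0 _ kn); set X := (X in X <= 0).
have key' : X = (cn (mdist a p) - cn (dmodel kappa a' p')) * sn (mdist b c).
  by rewrite /X mulrBl hG sab sac sap; lra.
rewrite key' mulr_le0_ge0// subr_le0 /cn ltNge kp/= kn ler_pM2r ?invr_gt0//.
have k1 : 0 < Num.sqrt (- kappa) by rewrite sqrtr_gt0 oppr_gt0.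
have l1 : 0 <= Num.sqrt (- kappa) * mdist a p by rewrite mulr_ge0 ?mdist_ge0// ltW.
have l2 : Num.sqrt (- kappa) * mdist a p <= Num.sqrt (- kappa) * dmodel kappa a' p'.
  by rewrite ler_pM2l.
move: (Num.sqrt (- kappa) * mdist a p) (Num.sqrt (- kappa) * dmodel kappa a' p')
  l1 l2 => x y x0 xy.
have hx := expRNK x; have hy := expRNK y.
have ex : 1 <= expR x by rewrite -expR0 ler_expR.
have exy : expR x <= expR y by rewrite ler_expR.
have h1 : 0 <= (expR y - expR x) * (1 - expR (- x) * expR (- y)).
  rewrite mulr_ge0// ?subr_ge0// -expRD -expR0 ler_expR; lra.
have e1 : expR y * (expR (- x) * expR (- y)) = expR (- x).
  by rewrite mulrCA hy mulr1.
have e2 : expR x * (expR (- x) * expR (- y)) = expR (- y).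
  by rewrite mulrA hx mul1r.
lra.
Qed.

End model_functions.

(** * Tangent cones of metric spaces *)

Section metric_facts.
Context {R : realType}.

Lemma nbhs_mdist_ex (T : metricType R) (x : T) (U : set T) : nbhs x U ->
  exists2 r : R, 0 < r & forall y, mdist x y < r -> U y.
Proof.
by move=> /metricType_numDomainType.nbhs_mdistP[r /= r0 rU]; exists r.
Qed.

Lemma nbhs_mdist_in (T : metricType R) (x : T) (r : R) (U : set T) : 0 < r ->
  (forall y, mdist x y < r -> U y) -> nbhs x U.
Proof.
by move=> r0 rU; apply/metricType_numDomainType.nbhs_mdistP; exists r.
Qed.

Lemma dense_mdist (T : metricType R) (A : set T) (x : T) (e : R) :
  dense A -> 0 < e -> exists2 y, A y & mdist x y < e.
Proof.
move=> dA e0; have [|y [yB Ay]] := dA (ball x e)^° _ (@open_interior _ _).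
  by exists x; exact: nbhsx_ballx.
by exists y => //; have := interior_subset yB; rewrite ballEmdist.
Qed.

Lemma near_at_rightP (P : set R) : (\forall t \near 0^'+, P t) <->
  exists2 e : R, 0 < e & forall t, 0 < t < e -> P t.
Proof.
split=> [[e /= e0 eP]|[e e0 eP]].
  exists e => // t /andP[t0 te]; apply: eP => //=.
  by rewrite sub0r normrN gtr0_norm.
exists e => // t /=; rewrite sub0r normrN => te t0.
by apply: eP; rewrite t0 -(gtr0_norm t0).
Qed.

Lemma near_at_right_scale (l : R) (P : set R) : 0 < l ->
  (\forall t \near 0^'+, P t) -> \forall t \near 0^'+, P (l * t).
Proof.
move=> l0 /near_at_rightP[e e0 eP]; apply/near_at_rightP; exists (e / l).
  by rewrite divr_gt0.
move=> t /andP[t0 te]; apply: eP; rewrite mulr_gt0//=.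
by rewrite mulrC -ltr_pdivlMr.
Qed.

Lemma lipschitz_continuous (T : metricType R) (f : T -> R) (K : R) :
  (forall y z, `|f y - f z| <= K * mdist y z) -> continuous f.
Proof.
move=> fK y; apply/cvgrPdist_lt => e e0.
apply: (@nbhs_mdist_in _ _ (e / (`|K| + 1))).
  by rewrite divr_gt0// ltr_wpDl.
move=> z /=; rewrite ltr_pdivlMr ?ltr_wpDl// => h.
apply: (le_lt_trans (fK y z)); apply: le_lt_trans h.
rewrite mulrC ler_wpM2l ?mdist_ge0//.
by rewrite (le_trans (ler_norm K))// lerDl.
Qed.

Lemma mdist_lip (T : metricType R) (y z w : T) :
  `|mdist y w - mdist z w| <= mdist y z.
Proof.
have h1 := metric_triangle y z w; have h2 := metric_triangle z y w.
by rewrite (metric_sym z y) in h2; rewrite ler_norml; apply/andP; split; lra.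
Qed.

Lemma continuous_mdist (T : metricType R) (w : T) : continuous (fun y => mdist y w).
Proof. by apply: (@lipschitz_continuous _ _ 1) => y z; rewrite mul1r mdist_lip. Qed.

Lemma continuous_polar (T : metricType R) (o w : T) (a : R) :
  continuous (fun v => (mdist v o ^+ 2 + a - mdist v w ^+ 2) / 2).
Proof.
move=> v; apply: cvgM; last exact: cvg_cst.
apply: cvgB; last by rewrite expr2; apply: cvgM; exact: continuous_mdist.
apply: cvgD; last exact: cvg_cst.
by rewrite expr2; apply: cvgM; exact: continuous_mdist.
Qed.

Lemma continuous_mull (T : metricType R) (l : R) (f : T -> R) :
  continuous f -> continuous (fun v => l * f v).
Proof. by move=> cf v; apply: cvgM; [exact: cvg_cst|exact: cf]. Qed.

End metric_facts.

Section tangent_cone_limits.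
Context {R : realType} {Y : metricType R} {x : Y}.
Implicit Types g h : geo x.

Lemma geo_dist_ge0 g h : 0 <= geo_dist g h.
Proof. exact: (pd_ge0 (geo_pseudodist x)). Qed.

Lemma geo_dist_lt g h (l : R) : geo_dist g h < l ->
  \forall t \near 0^'+, mdist (g t) (h t) < l * t.
Proof.
rewrite -lte_fin geo_distE => /limf_esup_lt H; near=> t.
have t0 : 0 < t by near: t; exact: nbhs_right_gt.
have : ((mdist (g t) (h t) / t)%:E < l%:E)%E by near: t.
by rewrite lte_fin ltr_pdivrMr.
Unshelve. all: by end_near. Qed.

Lemma geo_dist_le g h (l : R) :
  (\forall t \near 0^'+, mdist (g t) (h t) <= l * t) -> geo_dist g h <= l.
Proof.
move=> H; rewrite -lee_fin geo_distE; apply: limf_esup_le; near=> t.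
have t0 : 0 < t by near: t; exact: nbhs_right_gt.
by rewrite lee_fin ler_pdivrMr//; near: t.
Unshelve. all: by end_near. Qed.

Lemma geo_dist_ge g h (l : R) :
  (\forall t \near 0^'+, l * t <= mdist (g t) (h t)) -> l <= geo_dist g h.
Proof.
move=> H; rewrite leNgt; apply/negP => /geo_dist_lt H1.
have [t] : exists t : R, l * t < l * t.
  near (0 : R)^'+ => t; exists t.
  by apply: (@le_lt_trans _ _ (mdist (g t) (h t))); near: t.
by rewrite ltxx.
Unshelve. all: by end_near. Qed.

Lemma mdist_velocity g h : mdist (velocity g) (velocity h) = geo_dist g h.
Proof. exact: (to_completion_dist (geo_pseudodist x)). Qed.

Lemma tnorm_ge0 (v : tcone x) : 0 <= tnorm v.
Proof. exact: mdist_ge0. Qed.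

Lemma tnorm_eq0 (v : tcone x) : tnorm v = 0 -> v = tzero x.
Proof. exact: mdist_positivity. Qed.

Lemma tnorm_tzero : tnorm (tzero x) = 0.
Proof. exact: mdistxx. Qed.

Lemma geo_tnorm g : exists2 e : R, 0 < e & forall s t, 0 <= s < e ->
  0 <= t < e -> mdist (g s) (g t) = tnorm (velocity g) * `|s - t|.
Proof.
have [e [c [e0 gc]]] := geoP g; exists e => //.
suff -> : tnorm (velocity g) = c by [].
have H : \forall t \near (0 : R)^'+, mdist (g t) x = c * t.
  near=> t.
  have t0 : 0 < t by near: t; exact: nbhs_right_gt.
  have te : t < e by near: t; exact: nbhs_right_lt.
  by rewrite -{2}(geo0 g) gc ?lexx ?(ltW t0)//= subr0 gtr0_norm.
rewrite /tnorm [LHS]mdist_velocity; apply/eqP; rewrite eq_le; apply/andP; split.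
- by apply: geo_dist_le; apply: filterS H => t ->.
- by apply: geo_dist_ge; apply: filterS H => t ->.
Unshelve. all: by end_near. Qed.

Lemma near_geo_tnorm g :
  \forall t \near (0 : R)^'+, mdist x (g t) = tnorm (velocity g) * t.
Proof.
have [e e0 gc] := geo_tnorm g; near=> t.
have t0 : 0 < t by near: t; exact: nbhs_right_gt.
have te : t < e by near: t; exact: nbhs_right_lt.
by rewrite -{1}(geo0 g) gc ?lexx ?(ltW t0)//= sub0r normrN gtr0_norm.
Unshelve. all: by end_near. Qed.

Lemma near_geo g (U : set Y) : nbhs x U -> \forall t \near (0 : R)^'+, U (g t).
Proof.
move=> /nbhs_mdist_ex[r r0 rU].
have c0 := tnorm_ge0 (velocity g).
have c1 : 0 < tnorm (velocity g) + 1 by rewrite ltr_wpDl.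
have rc : 0 < r / (tnorm (velocity g) + 1) by rewrite divr_gt0.
near=> t; apply: rU => /=.
have t0 : 0 < t by near: t; exact: nbhs_right_gt.
have -> : mdist x (g t) = tnorm (velocity g) * t.
  by near: t; exact: near_geo_tnorm.
have h : tnorm (velocity g) * t <= (tnorm (velocity g) + 1) * t.
  by rewrite ler_pM2r// lerDl.
by rewrite (le_lt_trans h)// mulrC -ltr_pdivlMr.
Unshelve. all: by end_near. Qed.

Lemma tcone_dense (v : tcone x) (e : R) : 0 < e ->
  exists g : geo x, mdist v (velocity g) < e.
Proof.
move=> e0; have e20 : 0 < e / 2 by rewrite divr_gt0.
rewrite -(reprK v); have [N hN] := cseqP (repr v) e20.
exists (repr v N); rewrite [ltLHS](@cdistE _ _ (geo_pseudodist x)).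
apply: (@le_lt_trans _ _ (e / 2)); last by rewrite ltr_pdivrMr// ltr_pMr// ltr1n.
apply: limr_le; first exact: is_cvg_cseq_dist.
by exists N => // n /= hn; apply/ltW/hN.
Qed.

(** Velocities are dense, so that continuous functions on the tangent cone are
    determined by geodesics. *)
Lemma tcone_eq (f1 f2 : tcone x -> R) : continuous f1 -> continuous f2 ->
  (forall g, f1 (velocity g) = f2 (velocity g)) -> f1 =1 f2.
Proof.
move=> c1 c2 H v; apply/eqP; rewrite -subr_eq0 -normr_le0 leNgt; apply/negP => e0.
set e := `|_| in e0.
have e20 : 0 < e / 2 by rewrite divr_gt0.
have /cvgrPdist_lt/(_ _ e20) := c1 v.
have /cvgrPdist_lt/(_ _ e20) := c2 v.
move=> /nbhs_mdist_ex[r2 r20 hr2] /nbhs_mdist_ex[r1 r10 hr1].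
have r0 : 0 < Num.min r1 r2 by rewrite lt_min r10.
have [g vg] := tcone_dense v r0.
move: vg; rewrite lt_min => /andP[/hr1 + /hr2]; rewrite H => b a.
have : `|f1 v - f2 v| < e.
  rewrite (_ : f1 v - f2 v = (f1 v - f2 (velocity g)) - (f2 v - f2 (velocity g))).
    by rewrite (le_lt_trans (ler_normB _ _))// [ltRHS](splitr e) ltrD.
  by ring.
by rewrite ltxx.
Qed.

Lemma geo_dist_scale (l : {nonneg R}) g h :
  geo_dist (geo_scale l g) (geo_scale l h) = l%:num * geo_dist g h.
Proof.
have [l0|l0] := eqVneq l%:num 0.
  rewrite l0 mul0r; apply/eqP; rewrite eq_le geo_dist_ge0 andbT.
  apply: geo_dist_le; near=> t.
  by rewrite /= l0 !mul0r !geo0 mdistxx.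
have lp : 0 < l%:num by rewrite lt_neqAle eq_sym l0/=.
apply/eqP; rewrite eq_le; apply/andP; split.
- apply/ler_addgt0Pl => e e0; apply: geo_dist_le.
  have : geo_dist g h < geo_dist g h + e / l%:num by rewrite ltrDl divr_gt0.
  move=> /geo_dist_lt/(near_at_right_scale lp); apply: filterS => t /ltW.
  suff -> : (geo_dist g h + e / l%:num) * (l%:num * t)
    = (e + l%:num * geo_dist g h) * t by [].
  by field.
- rewrite -ler_pdivlMl//; apply/ler_addgt0Pl => e e0; apply: geo_dist_le.
  set s := geo_dist (geo_scale l g) (geo_scale l h).
  have : s < s + e * l%:num by rewrite ltrDl mulr_gt0.
  have lv : 0 < l%:num^-1 by rewrite invr_gt0.
  move=> /geo_dist_lt/(near_at_right_scale lv); apply: filterS => t /ltW.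
  rewrite /= !mulrA !divff// !mul1r mulrDl mulfK// => h1.
  by rewrite addrC (mulrC _ s).
Unshelve. all: by end_near. Qed.

Lemma velocity_eq g h : (\forall t \near 0^'+, g t = h t) ->
  velocity g = velocity h.
Proof.
move=> H; apply: mdist_positivity; rewrite mdist_velocity.
apply/eqP; rewrite eq_le geo_dist_ge0 andbT; apply: geo_dist_le.
by apply: filterS H => t ->; rewrite mdistxx mul0r.
Qed.

Let cauchy_scale (l : {nonneg R}) (u : cauchy_seq (geo_pseudodist x)) (e : R) :
  0 < e -> exists N, forall m n : nat, (N <= m)%N -> (N <= n)%N ->
  geo_pseudodist x (geo_scale l (u m)) (geo_scale l (u n)) < e.
Proof.
move=> e0; have l1 : 0 < l%:num + 1 by rewrite ltr_wpDl.
have [N hN] := cseqP u (divr_gt0 e0 l1); exists N => m n hm hn /=.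
rewrite geo_dist_scale (@le_lt_trans _ _ ((l%:num + 1) * geo_dist (u m) (u n)))//.
  by rewrite ler_wpM2r ?geo_dist_ge0// lerDl.
by rewrite mulrC -ltr_pdivlMr//; exact: hN.
Qed.

Let tscale_fun (l : {nonneg R}) (v : tcone x) : tcone x :=
  \pi_(completion (geo_pseudodist x))%qT (CauchySeq (cauchy_scale l (repr v))).

Let tscale_fun_dist l v w :
  mdist (tscale_fun l v) (tscale_fun l w) = l%:num * mdist v w.
Proof.
rewrite [LHS](@cdistE _ _ (geo_pseudodist x)) /cseq_dist /=.
under eq_fun do rewrite geo_dist_scale.
rewrite limM; [|exact: is_cvg_cst|exact: (@is_cvg_cseq_dist _ _ (geo_pseudodist x))].
by rewrite lim_cst.
Qed.

(** Scaling acts on Cauchy sequences of geodesics termwise, which realizes the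
    continuous extension that [tscale] selects. *)
Lemma tscaleP (l : {nonneg R}) : continuous (@tscale R Y x l) /\
  forall g, tscale l (velocity g) = velocity (geo_scale l g).
Proof.
rewrite /tscale; set P := (X in get X).
suff : P (get P) by [].
apply: getPex; exists (tscale_fun l); split.
  move=> v; apply/(@metricType_numDomainType.cvgrPdist_lt R (tcone x) (tcone x)
    (nbhs v)) => e e0.
  apply: (@nbhs_mdist_in _ _ _ (e / (l%:num + 1))).
    by rewrite divr_gt0// ltr_wpDl.
  move=> w /=; rewrite ltr_pdivlMr ?ltr_wpDl// => h.
  rewrite tscale_fun_dist (le_lt_trans _ h)// mulrC ler_wpM2l ?mdist_ge0//.
  by rewrite lerDl.
move=> g; apply: mdist_positivity.
have : l%:num * mdist (velocity g) (velocity g) = 0 by rewrite mdistxx mulr0.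
rewrite -{1}(reprK (velocity g)) => <-.
rewrite [LHS](@cdistE _ _ (geo_pseudodist x)).
rewrite [X in _ = _ * X](@cdistE _ _ (geo_pseudodist x)) /cseq_dist /=.
under eq_fun do rewrite geo_dist_scale.
rewrite limM; [|exact: is_cvg_cst|].
  by rewrite lim_cst.
exact: (@is_cvg_cseq_dist _ _ (geo_pseudodist x) (repr (velocity g))
  (CauchySeq (@cst_cauchy _ _ (geo_pseudodist x) g))).
Qed.

Lemma tscale_velocity l g : tscale l (velocity g) = velocity (geo_scale l g).
Proof. by have [] := tscaleP l. Qed.

Lemma continuous_tscale l : continuous (@tscale R Y x l).
Proof. by have [] := tscaleP l. Qed.

Lemma tscale_dist l (v w : tcone x) :
  mdist (tscale l v) (tscale l w) = l%:num * mdist v w.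
Proof.
have H (z : tcone x) : continuous (fun v => mdist (tscale l v) z).
  move=> u; apply: (@continuous_comp _ _ _ (tscale l) (fun v => mdist v z)).
    exact: continuous_tscale.
  exact: continuous_mdist.
have H1 (z : tcone x) : continuous (fun v => l%:num * mdist v z).
  apply: (@lipschitz_continuous _ (tcone x) _ l%:num) => u u'.
  by rewrite -mulrBr normrM ger0_norm// ler_wpM2l// mdist_lip.
apply: (@tcone_eq (fun v => mdist (tscale l v) (tscale l w))
  (fun v => l%:num * mdist v w)) => // g.
rewrite metric_sym (metric_sym _ w).
apply: (@tcone_eq (fun w => mdist (tscale l w) (tscale l (velocity g)))
  (fun w => l%:num * mdist w (velocity g))) => // h.
by rewrite !tscale_velocity !mdist_velocity geo_dist_scale.
Qed.

Lemma tscale0 (l : {nonneg R}) : tscale l (tzero x) = tzero x.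
Proof.
by rewrite /tzero tscale_velocity; apply: velocity_eq; near=> t.
Unshelve. all: by end_near. Qed.

Lemma tnorm_scale l (v : tcone x) : tnorm (tscale l v) = l%:num * tnorm v.
Proof. by rewrite /tnorm -{1}(tscale0 l) tscale_dist. Qed.

(** The scalar product on the cone, by polarization. *)
Definition ip (v w : tcone x) : R :=
  (tnorm v ^+ 2 + tnorm w ^+ 2 - mdist v w ^+ 2) / 2.

Lemma ipC v w : ip v w = ip w v.
Proof. by rewrite /ip metric_sym (addrC (tnorm v ^+ 2)). Qed.

Lemma ipvv v : ip v v = tnorm v ^+ 2.
Proof. by rewrite /ip mdistxx expr0n subr0; field. Qed.

Lemma ipv0 v : ip v (tzero x) = 0.
Proof. by rewrite /ip tnorm_tzero -/(tnorm v) expr0n addr0 subrr mul0r. Qed.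

Lemma ip_mdist v w :
  mdist v w ^+ 2 = tnorm v ^+ 2 + tnorm w ^+ 2 - 2 * ip v w.
Proof. by rewrite /ip; field. Qed.

Lemma norm_ip v w : `|ip v w| <= tnorm v * tnorm w.
Proof.
have h1 : mdist v w <= tnorm v + tnorm w.
  by rewrite /tnorm (metric_sym w); exact: metric_triangle.
have h2 : `|tnorm v - tnorm w| <= mdist v w by exact: mdist_lip.
have v0 := tnorm_ge0 v; have w0 := tnorm_ge0 w; have d0 := mdist_ge0 v w.
rewrite ler_norml /ip; move: (tnorm v) (tnorm w) (mdist v w) v0 w0 d0 h1 h2.
move=> a b d a0 b0 d0 h1 /ler_normlP[h2 h3].
by apply/andP; split; nra.
Qed.

Lemma continuous_ip w : continuous (fun v => ip v w).
Proof. exact: (@continuous_polar _ (tcone x)). Qed.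

Lemma continuous_ipZ l w : continuous (fun v => l * ip v w).
Proof. by apply: (@continuous_mull _ (tcone x)); exact: continuous_ip. Qed.

Lemma ip_scale2 l v w : ip (tscale l v) (tscale l w) = l%:num ^+ 2 * ip v w.
Proof. by rewrite /ip !tnorm_scale tscale_dist; field. Qed.

End tangent_cone_limits.

(** * Homogeneity of the scalar product on tangent cones *)

Section cat_cone.
Context {R : realType} {kappa : R} {Y : metricType R} {x : Y} {U : set Y}.
Context (catU : CAT kappa U) (xU : nbhs x U).
Local Notation sn := (sn kappa).
Local Notation cn := (cn kappa).
Local Notation md := (md kappa).
Local Notation rad := (rad kappa).
Implicit Types g h : geo x.

Lemma sqr_le_of (G A : R) : 0 <= G -> 0 <= A ->
  (forall l, 0 <= l -> A < l ^+ 2 -> G <= l) -> G ^+ 2 <= A.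
Proof.
move=> G0 A0 H; rewrite leNgt; apply/negP => AG.
pose B := (A + G ^+ 2) / 2.
have B0 : 0 <= B by rewrite divr_ge0// addr_ge0// sqr_ge0.
have sB : Num.sqrt B ^+ 2 = B by rewrite sqr_sqrtr.
have := H _ (sqrtr_ge0 B); rewrite sB => /(_ _)/wrap[].
  by rewrite /B; lra.
rewrite -ler_sqr ?nnegrE ?sqrtr_ge0// sB /B; lra.
Qed.

Lemma near_geo_lt g (r : R) : 0 < r -> \forall t \near 0^'+, mdist x (g t) < r.
Proof.
move=> r0; have : nbhs x [set y | mdist x y < r] by exact: (nbhs_mdist_in r0).
exact: near_geo.
Qed.

(** Bounds on [md] of a distance bound speeds, as [md r] is [r ^+ 2 / 2] to the
    second order at [0]. *)
Lemma geo_dist_sqr_le g h (F : R -> R) (B : R) :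
  (\forall t \near 0^'+, md (mdist (g t) (h t)) / t ^+ 2 <= F t) ->
  F t @[t --> 0^'+] --> B -> 0 <= B -> geo_dist g h ^+ 2 <= 2 * B.
Proof.
move=> H FB B0; apply: sqr_le_of; [exact: geo_dist_ge0|by rewrite mulr_ge0|].
move=> l l0 Bl; apply: geo_dist_le.
have r2 : 0 < rad / 2 by rewrite divr_gt0// rad_gt0.
have Bl2 : B < l ^+ 2 / 2 by lra.
pose z := (B + l ^+ 2 / 2) / 2.
have [zB zl] : B < z /\ z < l ^+ 2 / 2 by rewrite /z; split; lra.
have HF : \forall t \near 0^'+, F t < z by exact: (cvgr_lt _ FB).
have Hm : \forall t \near 0^'+, z < md (l * t) / t ^+ 2.
  by apply: (cvgr_gt _ _ _ zl); exact: cvg_md.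
near=> t.
have t0 : 0 < t by near: t; exact: nbhs_right_gt.
rewrite leNgt; apply/negP => lt.
have dr : mdist (g t) (h t) <= rad.
  rewrite (le_trans (metric_triangle _ x _))// (metric_sym _ x) [leRHS]splitr.
  by apply: lerD; apply/ltW; near: t; exact: near_geo_lt.
have h1 : md (l * t) < md (mdist (g t) (h t)).
  by apply: md_lt => //; rewrite mulr_ge0// ltW.
have h2 : md (l * t) / t ^+ 2 < md (mdist (g t) (h t)) / t ^+ 2.
  by rewrite ltr_pM2r// invr_gt0 exprn_gt0.
have h3 : z < md (l * t) / t ^+ 2 by near: t.
have h4 : F t < z by near: t.
have h5 : md (mdist (g t) (h t)) / t ^+ 2 <= F t by near: t.
lra.
Unshelve. all: by end_near. Qed.

Lemma tnorm_velocity_scale g (l : {nonneg R}) :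
  tnorm (velocity (geo_scale l g)) = l%:num * tnorm (velocity g).
Proof. by rewrite -tscale_velocity tnorm_scale. Qed.

(** Stewart's inequality in the triangle [g t, x, h t] at the point [h (l t)],
    divided by [t ^+ 3], in the limit of small [t]. *)
Lemma geo_dist_scale_le g h (l : {nonneg R}) : l%:num <= 1 ->
  geo_dist g (geo_scale l h) ^+ 2 <=
  (1 - l%:num) * tnorm (velocity g) ^+ 2 + l%:num * geo_dist g h ^+ 2
  - l%:num * (1 - l%:num) * tnorm (velocity h) ^+ 2.
Proof.
move=> l1; have l0 : 0 <= l%:num by [].
have [c'0|c'0] := eqVneq (tnorm (velocity h)) 0.
  have h0 : velocity h = tzero x by exact: tnorm_eq0.
  have -> : geo_dist g (geo_scale l h) = tnorm (velocity g).
    by rewrite -mdist_velocity -tscale_velocity h0 tscale0.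
  have -> : geo_dist g h = tnorm (velocity g) by rewrite -mdist_velocity h0.
  by rewrite c'0; lra.
have Mc : `|tnorm (velocity g) - tnorm (velocity h)| <= geo_dist g h.
  by rewrite -mdist_velocity; exact: mdist_lip.
have Hg := near_geo_tnorm g; have Hh := near_geo_tnorm h.
have Hp := near_geo_tnorm (geo_scale l h); rewrite tnorm_velocity_scale in Hp.
have [e' e'0 hd] := geo_tnorm h.
have c0 := tnorm_ge0 (velocity g); have c'_ge0 := tnorm_ge0 (velocity h).
have M0 := geo_dist_ge0 g h; have ghlt := @geo_dist_lt _ _ _ g h.
move: c'0 Mc Hg Hh Hp hd c0 c'_ge0 M0 ghlt.
move: (tnorm (velocity g)) (tnorm (velocity h)) (geo_dist g h) => c c' M.
move=> c'0 Mc Hg Hh Hp hd c0 c'_ge0 M0 ghlt.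
have c'p : 0 < c' by rewrite lt_neqAle eq_sym c'0.
have {}Mc : (c - c') ^+ 2 <= M ^+ 2.
  by rewrite -real_normK ?num_real// ler_sqr ?nnegrE.
apply/ler_addgt0Pl => e e0.
(* as [geo_dist g h] is only an upper limit, the side [g t, h t] is bounded by
   [m * t] for [m] slightly larger than it *)
have M2 : 0 <= M ^+ 2 + e by rewrite addr_ge0 ?sqr_ge0 ?ltW.
set m := Num.sqrt (M ^+ 2 + e).
have m2 : m ^+ 2 = M ^+ 2 + e by rewrite sqr_sqrtr.
have Mm : M < m.
  by rewrite -ltr_sqr ?nnegrE ?sqrtr_ge0// m2 ltrDl.
pose F t : R := (sn ((1 - l%:num) * c' * t) / t * (md (c * t) / t ^+ 2)
  + sn (l%:num * c' * t) / t * (md (m * t) / t ^+ 2)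
  - 4 * (sn (c' / 2 * t) / t * (sn (l%:num * c' / 2 * t) / t)
       * (sn ((1 - l%:num) * c' / 2 * t) / t))) / (sn (c' * t) / t).
pose B := ((1 - l%:num) * c' * (c ^+ 2 / 2) + l%:num * c' * (m ^+ 2 / 2)
  - 4 * (c' / 2 * (l%:num * c' / 2) * ((1 - l%:num) * c' / 2))) / c'.
have BE : 2 * B = (1 - l%:num) * c ^+ 2 + l%:num * m ^+ 2
    - l%:num * (1 - l%:num) * c' ^+ 2.
  rewrite /B; field.
  exact: c'0.
have FB : F t @[t --> 0^'+] --> B.
  apply: cvgM; last by apply: cvgV => //; exact: cvg_sn.
  apply: cvgB.
    by apply: cvgD; apply: cvgM; (try exact: cvg_sn); exact: cvg_md.
  apply: cvgM; first exact: cvg_cst.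
  by apply: cvgM; [apply: cvgM|]; exact: cvg_sn.
have B0 : 0 <= B.
  rewrite -(@pmulr_rge0 _ 2)// BE m2.
  have h1 : 0 <= l%:num * (M ^+ 2 - (c - c') ^+ 2) by rewrite mulr_ge0// subr_ge0.
  have h2 := sqr_ge0 (c - l%:num * c').
  have h3 : 0 <= l%:num * e by rewrite mulr_ge0// ltW.
  lra.
apply: (@le_trans _ _ (2 * B)).
  apply: (geo_dist_sqr_le _ FB B0).
  have r2 : 0 < rad / 2 by rewrite divr_gt0// rad_gt0.
  have r0 := rad_gt0 kappa.
  have m1 : 0 < m + 1 by rewrite ltr_wpDl ?sqrtr_ge0.
  have rm : 0 < rad / (m + 1) by rewrite divr_gt0.
  near=> t.
  have t0 : 0 < t by near: t; exact: nbhs_right_gt.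
  have te' : t < e' by near: t; exact: nbhs_right_lt.
  have lt1 : l%:num * t <= t by rewrite ler_piMl// ltW.
  have lt0 : 0 <= l%:num * t by rewrite mulr_ge0// ltW.
  have Ug : U (g t) by near: t; exact: near_geo.
  have Uh : U (h t) by near: t; exact: near_geo.
  have Up : U (geo_scale l h t) by near: t; exact: near_geo.
  have Ux : U x by exact: nbhs_singleton.
  have dg : mdist x (g t) = c * t by near: t; exact: Hg.
  have dh : mdist x (h t) = c' * t by near: t; exact: Hh.
  have dp : mdist x (geo_scale l h t) = l%:num * c' * t by near: t; exact: Hp.
  have dph : mdist (geo_scale l h t) (h t) = (1 - l%:num) * c' * t.
    rewrite /= hd ?lt0 ?(ltW t0) ?te' ?(le_lt_trans lt1)//.
    rewrite distrC ger0_norm ?subr_ge0//; ring.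
  have gr : mdist x (g t) < rad / 2 by near: t; exact: near_geo_lt.
  have hr : mdist x (h t) < rad / 2 by near: t; exact: near_geo_lt.
  have gh : mdist (g t) (h t) < m * t by near: t; exact: ghlt.
  have mr : m * t <= rad.
    have : t < rad / (m + 1) by near: t; exact: nbhs_right_lt.
    by rewrite ltr_pdivlMr// mulrDr mulr1 mulrC; lra.
  have hbp : mdist x (geo_scale l h t) + mdist (geo_scale l h t) (h t)
    = mdist x (h t) by rewrite dp dph dh; ring.
  have gr1 : mdist (g t) x <= rad by rewrite metric_sym; lra.
  have hr1 : mdist x (h t) <= rad by lra.
  have ggh : mdist (g t) (h t) <= rad by lra.
  have HS := CAT_stewart catU Ug Ux Uh Up gr1 ggh hr1 hbp.
  rewrite (metric_sym (g t) x) dh dg dp dph in HS.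
  have mdgh : md (mdist (g t) (h t)) <= md (m * t).
    by apply: md_le; [exact: mdist_ge0|exact: ltW|exact: mr].
  have snp : 0 < sn (c' * t).
    by apply: sn_gt0; rewrite mulr_gt0//= -dh; lra.
  have snl : 0 <= sn (l%:num * c' * t).
    rewrite -dp; apply: sn_ge0; rewrite mdist_ge0/=.
    have := mdist_ge0 (geo_scale l h t) (h t); lra.
  have h1 : sn (l%:num * c' * t) * md (mdist (g t) (h t))
      <= sn (l%:num * c' * t) * md (m * t) by rewrite ler_wpM2l.
  have -> : F t = (sn ((1 - l%:num) * c' * t) * md (c * t)
     + sn (l%:num * c' * t) * md (m * t)
     - 4 * (sn (c' * t / 2) * sn (l%:num * c' * t / 2)
          * sn ((1 - l%:num) * c' * t / 2))) / (sn (c' * t)) / t ^+ 2.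
    rewrite /F.
    have <- : c' * t / 2 = c' / 2 * t by ring.
    have <- : l%:num * c' * t / 2 = l%:num * c' / 2 * t by ring.
    have <- : (1 - l%:num) * c' * t / 2 = (1 - l%:num) * c' / 2 * t by ring.
    field; rewrite !gt_eqF//.
  rewrite ler_pM2r ?invr_gt0 ?exprn_gt0// ler_pdivlMr//.
  by rewrite (le_trans HS)// lerB// lerD.
rewrite BE m2.
have : l%:num * e <= e by rewrite ler_piMl// ltW.
lra.
Unshelve. all: by end_near. Qed.

Lemma tscale_tscaleV (l l' : {nonneg R}) g : l%:num * l'%:num = 1 ->
  tscale l (tscale l' (velocity g)) = velocity g.
Proof.
move=> l1; rewrite !tscale_velocity; apply: velocity_eq; near=> t.
by rewrite /= mulrA (mulrC l'%:num) l1 mul1r.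
Unshelve. all: by end_near. Qed.

Let ip_scale_ge (l : {nonneg R}) g h : l%:num <= 1 ->
  l%:num * ip (velocity g) (velocity h)
    <= ip (velocity g) (tscale l (velocity h)).
Proof.
move=> l1; have := geo_dist_scale_le g h l1.
rewrite -!mdist_velocity -tscale_velocity /ip tnorm_scale.
move: (mdist _ _) (mdist _ _) (tnorm _) (tnorm _) => A B a b; lra.
Qed.

Let ip_scale_le1 (l : {nonneg R}) g h : l%:num <= 1 ->
  ip (velocity g) (tscale l (velocity h)) =
  l%:num * ip (velocity g) (velocity h).
Proof.
move=> l1; have [l0|l0] := eqVneq l%:num 0.
  have -> : tscale l (velocity h) = tzero x.
    by apply: tnorm_eq0; rewrite tnorm_scale l0 mul0r.
  by rewrite l0 mul0r ipv0.
apply/eqP; rewrite eq_le ip_scale_ge// andbT.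
have lp : 0 < l%:num by rewrite lt_neqAle eq_sym l0/=.
have lv0 : 0 <= l%:num^-1 by rewrite invr_ge0.
pose l' := NngNum lv0.
have ll' : l%:num * l'%:num = 1 by rewrite /= mulfV.
rewrite -{1}(tscale_tscaleV g ll') ip_scale2.
have := ip_scale_ge h (geo_scale l' g) l1.
rewrite -(tscale_velocity l' g) (tscale_tscaleV g ll').
rewrite (ipC (velocity h)) (ipC (velocity h)) => H.
by rewrite expr2 -mulrA ler_pM2l.
Qed.

(** Homogeneity of the scalar product. The inequality [>=] for [l <= 1] is
    Stewart's; scaling both arguments, an exact homogeneity, turns it into its
    converse, so that no limit of angles has to exist. *)
Lemma ip_scale (l : {nonneg R}) (v w : tcone x) :
  ip v (tscale l w) = l%:num * ip v w.
Proof.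
have H g h : ip (velocity g) (tscale l (velocity h)) =
    l%:num * ip (velocity g) (velocity h).
  have [l1|l1] := leP l%:num 1; first exact: ip_scale_le1.
  have lp : 0 < l%:num by rewrite (lt_trans ltr01).
  have lv0 : 0 <= l%:num^-1 by rewrite invr_ge0.
  pose l' := NngNum lv0.
  have ll' : l'%:num * l%:num = 1 by rewrite /= mulVf// gt_eqF.
  have l'1 : l'%:num <= 1 by rewrite /= invf_le1// ltW.
  have := ip_scale_le1 g (geo_scale l h) l'1.
  rewrite -(tscale_velocity l h) (tscale_tscaleV h ll') => ->.
  by rewrite mulrA (mulrC l%:num) ll' mul1r.
apply: (@tcone_eq _ _ _ (fun v => ip v (tscale l w)) (fun v => l%:num * ip v w)).
- exact: continuous_ip.
- exact: continuous_ipZ.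
move=> g; rewrite ipC (ipC _ w).
apply: (@tcone_eq _ _ _ (fun w => ip (tscale l w) (velocity g))
  (fun w => l%:num * ip w (velocity g))).
- move=> u; apply: (@continuous_comp _ _ _ (tscale l) (fun v => ip v (velocity g))).
    exact: continuous_tscale.
  exact: continuous_ip.
- exact: continuous_ipZ.
by move=> h; rewrite ipC (ipC (velocity h)).
Qed.

End cat_cone.

(** * First variation of the distance *)

Section right_limits.
Context {R : realType}.

Lemma cvg_right_quotient (F : R -> R) (s : R) : is_derive (0 : R) 1 F s ->
  (F h - F 0) / h @[h --> 0^'+] --> s.
Proof.
move=> dF; have := @ex_derive _ _ _ _ _ _ _ dF => /cvg_ex[l Hl].
have lE : l = s.
  by rewrite -(@derive_val _ _ _ _ _ _ _ dF); apply/esym/cvg_lim.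
move: Hl; rewrite lE => /cvg_dnbhs_at_right Hl.
apply: cvg_trans Hl; apply: near_eq_cvg; near=> h.
by rewrite /= addr0 /GRing.scale/= mulr1 mulrC.
Unshelve. all: by end_near. Qed.

(** The derivative of an inverse function, for right limits of [f] at a point
    where only [F \o f] is known to be differentiable. *)
Lemma cvg_inv_derive (F f : R -> R) (l s r : R) : is_derive l 1 F s -> s != 0 ->
  f t @[t --> 0^'+] --> l -> (F (f t) - F l) / t @[t --> 0^'+] --> r ->
  (f t - l) / t @[t --> 0^'+] --> r / s.
Proof.
move=> dF s0 fl Fr.
pose phi (h : R) := if h == 0 then s else h^-1 * (F (h + l) - F l).
have phic : phi h @[h --> nbhs (0 : R)] --> s.
  have phi0 : phi 0 = s by rewrite /phi eqxx.
  suff : {for 0, continuous phi} by rewrite /prop_for /continuous_at phi0.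
  apply/continuous_withinNx; rewrite phi0.
  have := @ex_derive _ _ _ _ _ _ _ dF => /cvg_ex[z Hz].
  have zE : z = s.
    by rewrite -(@derive_val _ _ _ _ _ _ _ dF); apply/esym/cvg_lim.
  rewrite zE in Hz; apply: cvg_trans Hz; apply: near_eq_cvg; near=> h.
  have h0 : h != 0 by near: h; exact: nbhs_dnbhs_neq.
  by rewrite /phi (negbTE h0) /GRing.scale/= mulr1.
have f0 : f t - l @[t --> 0^'+] --> 0.
  have : f t - l @[t --> 0^'+] --> l - l.
    by apply: cvgB; [exact: fl|exact: cvg_cst].
  by rewrite subrr.
have pf : phi (f t - l) @[t --> 0^'+] --> s.
  exact: (@cvg_comp _ _ _ (fun t => f t - l) phi _ _ _ f0 phic).
have H : (F (f t) - F l) / t / phi (f t - l) @[t --> 0^'+] --> r / s.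
  by apply: cvgM => //; exact: cvgV.
apply: cvg_trans H; apply: near_eq_cvg.
have ps : \forall t \near 0^'+, phi (f t - l) != 0.
  have sp : 0 < `|s| by rewrite normr_gt0.
  have /cvgrPdist_lt/(_ _ sp) := pf; apply: filterS => t h.
  by apply/eqP => p0; rewrite p0 subr0 ltxx in h.
near=> t; have : phi (f t - l) != 0 by near: t.
have t0 : t != 0 by rewrite gt_eqF//; near: t; exact: nbhs_right_gt.
rewrite /phi; have [fl0 _|fl0 ph0] := eqVneq (f t - l) 0.
  by rewrite fl0 (subr0_eq fl0) subrr !mul0r.
move: ph0; rewrite subrK mulf_eq0 invr_eq0 negb_or => /andP[_ F0].
by field; rewrite F0 fl0 t0.
Unshelve. all: by end_near. Qed.

End right_limits.

Section first_variation.
Context {R : realType} {kappa : R} {Y : metricType R} {x : Y} {U : set Y}.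
Context (catU : CAT kappa U) (xU : nbhs x U).
Local Notation sn := (sn kappa).
Local Notation cn := (cn kappa).
Local Notation md := (md kappa).
Local Notation rad := (rad kappa).
Implicit Types g h w : geo x.

Definition directed_to (y : Y) w : Prop :=
  [/\ forall t, 0 <= t <= mdist x y -> U (w t), w (mdist x y) = y &
      forall s t, 0 <= s <= mdist x y -> 0 <= t <= mdist x y ->
        mdist (w s) (w t) = `|s - t|].

Lemma directed_to_ex (y : Y) : U y -> x != y -> exists w, directed_to y w.
Proof.
move=> Uy xy; have Ux : U x := nbhs_singleton xU.
have L0 : 0 < mdist x y by rewrite mdist_gt0.
have [g [g0 g1 gU gd]] := catU.1 _ _ Ux Uy.
have in01 t : 0 <= t <= mdist x y -> 0 <= t / mdist x y <= 1.
  by move=> /andP[t0 tL]; rewrite divr_ge0 ?(ltW L0)//= ler_pdivrMr// mul1r.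
have wd s t : 0 <= s <= mdist x y -> 0 <= t <= mdist x y ->
    mdist (g (s / mdist x y)) (g (t / mdist x y)) = 1 * `|s - t|.
  move=> hs ht; rewrite gd; [|exact: in01..].
  rewrite -mulrBl normrM normfV (gtr0_norm L0).
  by rewrite mulrCA mulfV ?gt_eqF// mulr1 mul1r.
have w0 : g (0 / mdist x y) = x by rewrite mul0r.
have wP : exists e c : R, 0 < e /\ forall s t, 0 <= s < e -> 0 <= t < e ->
    mdist (g (s / mdist x y)) (g (t / mdist x y)) = c * `|s - t|.
  exists (mdist x y), 1; split => // s t /andP[s0 sL] /andP[t0 tL].
  by apply: wd; rewrite ?s0 ?t0 ltW.
exists (@Geo R Y x (fun t => g (t / mdist x y)) w0 wP); split => /=.
- by move=> t /in01/gU.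
- by rewrite divff ?gt_eqF.
- by move=> s t hs ht; rewrite wd// mul1r.
Qed.

Context {y : Y} {w : geo x} (Uy : U y) (xy : x != y) (wy : directed_to y w).
Context (yr : mdist x y <= rad / 2).
Local Notation L := (mdist x y).

Let Ux : U x. Proof. exact: nbhs_singleton xU. Qed.
Let L0 : 0 < L. Proof. by rewrite mdist_gt0. Qed.
Let r0 : 0 < rad. Proof. exact: rad_gt0. Qed.

Lemma tnorm_directed_to : tnorm (velocity w) = 1.
Proof.
have [_ _ wd] := wy.
have H : \forall t \near (0 : R)^'+, mdist (w t) x = 1 * t.
  near=> t.
  have t0 : 0 < t by near: t; exact: nbhs_right_gt.
  have tL : t < L by near: t; exact: nbhs_right_lt.
  by rewrite -{2}(geo0 w) wd ?lexx ?(ltW t0) ?(ltW tL) ?(ltW L0)//= subr0 gtr0_norm// mul1r.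
rewrite /tnorm [LHS]mdist_velocity; apply/eqP; rewrite eq_le; apply/andP; split.
- by apply: geo_dist_le; apply: filterS H => t ->.
- by apply: geo_dist_ge; apply: filterS H => t ->.
Unshelve. all: by end_near. Qed.

(** Stewart's inequality in the triangle [y, x, g T], at the point [g t]. *)
Lemma dist_almost_convex g (c e : R) : 0 <= c ->
  (forall s t, 0 <= s < e -> 0 <= t < e -> mdist (g s) (g t) = c * `|s - t|) ->
  (forall t, 0 <= t < e -> U (g t)) -> c * e <= rad / 2 ->
  forall t T, 0 <= t <= T -> T < e ->
  (md (mdist (g t) y) - md L) * sn (c * T) <=
  sn (c * t) * (md (mdist (g T) y) - md L)
  - 4 * (sn (c * T / 2) * sn (c * t / 2) * sn (c * (T - t) / 2)) * cn L.
Proof.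
move=> c0 gd gU ce t T /andP[t0 tT] Te.
have T0 := le_trans t0 tT; have te := le_lt_trans tT Te.
have e0 := le_lt_trans T0 Te.
have cT : c * T <= c * e by rewrite ler_wpM2l// ltW.
have dT : mdist x (g T) = c * T.
  by rewrite -{1}(geo0 g) gd ?lexx ?T0//= sub0r normrN ger0_norm.
have dt : mdist x (g t) = c * t.
  by rewrite -{1}(geo0 g) gd ?lexx ?t0//= sub0r normrN ger0_norm.
have dtT : mdist (g t) (g T) = c * (T - t).
  by rewrite gd ?t0 ?T0//= distrC ger0_norm// subr_ge0.
have h1 : mdist y x <= rad by rewrite (metric_sym y x); move: yr r0; lra.
have h2 : mdist y (g T) <= rad.
  have := metric_triangle y x (g T); rewrite (metric_sym y x); move: yr; lra.
have h3 : mdist x (g T) <= rad by move: r0; lra.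
have h4 : mdist x (g t) + mdist (g t) (g T) = mdist x (g T).
  by rewrite dt dT dtT; ring.
have UT : U (g T) by apply: gU; rewrite T0.
have Ut : U (g t) by apply: gU; rewrite t0.
have := CAT_stewart catU Uy Ux UT Ut h1 h2 h3 h4.
rewrite dt dT dtT !(metric_sym y).
have := snD4 kappa (c * t) (c * (T - t)).
rewrite (_ : c * t + c * (T - t) = c * T); last by ring.
rewrite cn_md.
by move: (sn (c * T)) (sn (c * (T - t))) => A B -> H; nra.
Qed.

Lemma dist_geo_lip g (t : R) : `|mdist (g t) y - L| <= mdist x (g t).
Proof. by rewrite distrC; exact: mdist_lip. Qed.

(** The directional derivative of [mdist _ y] along [g] exists, by the almost
    convexity of [mdist (g _) y]; letting [t] tend to [0] in the latter gives
    the law of cosines as an inequality. *)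
Lemma dist_geo_lim g : exists D : R,
  [/\ (mdist (g t) y - L) / t @[t --> 0^'+] --> D,
      (md (mdist (g t) y) - md L) / t @[t --> 0^'+] --> sn L * D &
      forall e : R, (forall s t, 0 <= s < e -> 0 <= t < e ->
        mdist (g s) (g t) = tnorm (velocity g) * `|s - t|) ->
      (forall t, 0 <= t < e -> U (g t)) -> tnorm (velocity g) * e <= rad / 2 ->
      forall T, 0 < T -> T < e ->
      sn L * D * sn (tnorm (velocity g) * T) <= tnorm (velocity g) *
        (md (mdist (g T) y) - md L - cn L * md (tnorm (velocity g) * T))].
Proof.
have c_ge0 := tnorm_ge0 (velocity g).
have Hg := near_geo_tnorm g.
have [e1 e10 gd1] := geo_tnorm g.
have /near_at_rightP[e2 e20 gU2] := near_geo g xU.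
have := dist_almost_convex (g := g) c_ge0.
move: c_ge0 Hg gd1; move: (tnorm (velocity g)) => c c_ge0 Hg gd1 Hconv.
have Lr : L <= rad by move: yr r0; lra.
have snL0 : 0 < sn L by apply: sn_gt0; rewrite L0.
have cnL0 : 0 <= cn L by apply: cn_ge0; rewrite (ltW L0).
have fL : mdist (g t) y @[t --> 0^'+] --> L.
  apply/cvgrPdist_lt => e e0; near=> t.
  rewrite distrC (le_lt_trans (dist_geo_lip _ _))//; near: t.
  exact: near_geo_lt.
have [c0|c0] := eqVneq c 0.
  have fE : \forall t \near 0^'+, mdist (g t) y = L.
    apply: filterS Hg => t; rewrite c0 mul0r => H.
    by move: H => /mdist_positivity <-.
  exists 0; split.
  - apply: (@cvg_trans _ ((fun=> 0 : R) @ 0^'+)); last exact: cvg_cst.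
    by apply: near_eq_cvg; apply: filterS fE => t ->; rewrite subrr mul0r.
  - rewrite mulr0; apply: (@cvg_trans _ ((fun=> 0 : R) @ 0^'+)); last exact: cvg_cst.
    by apply: near_eq_cvg; apply: filterS fE => t ->; rewrite subrr mul0r.
  - by move=> e _ _ _ T _ _; rewrite c0 mulr0 !mul0r.
have cp : 0 < c by rewrite lt_neqAle eq_sym c0.
pose e := Num.min (Num.min e1 e2) (rad / 2 / c).
have e0 : 0 < e by rewrite !lt_min e10 e20 !divr_gt0.
have gd s t : 0 <= s < e -> 0 <= t < e -> mdist (g s) (g t) = c * `|s - t|.
  move=> /andP[s0 se] /andP[t0 te].
  by apply: gd1; rewrite ?s0 ?t0/=; [move: se|move: te];
    rewrite !lt_min => /andP[/andP[]].
have gU t : 0 <= t < e -> U (g t).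
  rewrite le_eqVlt => /andP[/predU1P[<-|t0]]; first by rewrite geo0.
  by rewrite !lt_min => /andP[/andP[_ te] _]; apply: gU2; rewrite t0.
have ce : c * e <= rad / 2 by rewrite mulrC -ler_pdivlMr// ge_min lexx orbT.
(* the quotient [Q] is monotone by the almost convexity, and bounded below *)
pose Q t := (md (mdist (g t) y) - md L) / sn (c * t).
have snc t : 0 < t -> t < e -> 0 < sn (c * t).
  move=> t0 te; apply: sn_gt0; rewrite mulr_gt0//=.
  have : c * t <= c * e by rewrite ler_pM2l// ltW.
  by move: ce r0; lra.
have Qnd t T : 0 < t -> t <= T -> T < e -> Q t <= Q T.
  move=> t0 tT Te.
  have te := le_lt_trans tT Te; have T0 := lt_le_trans t0 tT.
  rewrite /Q ler_pdivrMr ?snc// mulrAC ler_pdivlMr ?snc//.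
  have := Hconv e gd gU ce t T; rewrite (ltW t0) tT => /(_ isT Te).
  have cTr : c * T <= rad.
    have : c * T <= c * e by rewrite ler_pM2l// ltW.
    by move: ce r0; lra.
  have hE : 0 <= sn (c * T / 2) * sn (c * t / 2) * sn (c * (T - t) / 2) * cn L.
    have ctT : c * t <= c * T by rewrite ler_pM2l.
    have ct0 : 0 < c * t by rewrite mulr_gt0.
    rewrite !mulr_ge0//; apply: sn_ge0; rewrite ?mulrBr; apply/andP; split; lra.
  by move=> h; rewrite [leRHS]mulrC; lra.
have Qcvg : cvg (Q t @[t --> 0^'+]).
  apply: nondecreasing_at_right_is_cvgr.
    near=> T => t s; rewrite !in_itv/= => /andP[t0 tT] /andP[s0 sT] ts.
    apply: Qnd => //; apply: (lt_trans sT); near: T; exact: nbhs_right_lt.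
  have d1 : is_derive (0 : R) 1 (fun h : R => L - c * h) (- c).
    have : is_derive (0 : R) 1 (fun h : R => c * h) c.
      by apply: is_derive_eq; rewrite /GRing.scale/= mulr1.
    by move=> d; rewrite -(sub0r c); apply: is_deriveB.
  have d2 : is_derive (0 : R) 1 (fun z : R => md (L - c * z)) (sn L * - c).
    apply: (is_derive1_comp (f := md) (g := fun h : R => L - c * h)).
    by rewrite mulr0 subr0; exact: is_derive_md.
  have := cvg_right_quotient d2; rewrite mulr0 subr0 => H.
  have H2 : (md (L - c * h) - md L) / h / (sn (c * h) / h) @[h --> 0^'+]
      --> sn L * - c / c.
    by apply: cvgM => //; apply: cvgV => //; exact: cvg_sn.
  rewrite mulrN mulNr mulfK// in H2.
  have lb : - sn L - 1 < - sn L by rewrite ltrBlDr ltrDl.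
  have /near_at_rightP[tau tau0 Htau] : \forall t \near 0^'+,
      - sn L - 1 < (md (L - c * t) - md L) / t / (sn (c * t) / t).
    by exact: (cvgr_gt _ H2).
  near=> T; exists (- sn L - 1) => _ [t /= + <-].
  rewrite in_itv/= => /andP[t0 tT].
  have Tt : T < tau by near: T; exact: nbhs_right_lt.
  have Te : T < e by near: T; exact: nbhs_right_lt.
  have TL : T < L / c by near: T; apply: nbhs_right_lt; rewrite divr_gt0.
  have te := lt_trans tT Te.
  have := Htau t; rewrite t0 (lt_trans tT Tt) => /(_ isT)/ltW/le_trans; apply.
  have tn0 : t != 0 by rewrite gt_eqF.
  rewrite /Q invf_div mulrA divfK// ler_pM2r ?invr_gt0 ?snc// lerB//.
  have dt : mdist x (g t) = c * t.
    by rewrite -{1}(geo0 g) gd ?lexx ?(ltW t0)//= sub0r normrN gtr0_norm.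
  have := dist_geo_lip g t; rewrite dt => /ler_normlP[h1 h2].
  have h3 : c * t <= L.
    rewrite mulrC -ler_pdivlMr// ltW//; exact: lt_trans tT TL.
  have h4 : c * t <= c * e by rewrite ler_pM2l// ltW.
  by apply: md_le; move: yr r0 ce; lra.
pose q := lim (Q t @[t --> 0^'+]).
have HQ : Q t @[t --> 0^'+] --> q by [].
have Hmd : (md (mdist (g t) y) - md L) / t @[t --> 0^'+] --> q * c.
  have : Q t * (sn (c * t) / t) @[t --> 0^'+] --> q * c.
    by apply: cvgM => //; exact: cvg_sn.
  apply: cvg_trans; apply: near_eq_cvg; near=> t.
  have t0 : 0 < t by near: t; exact: nbhs_right_gt.
  have te : t < e by near: t; exact: nbhs_right_lt.
  by rewrite /Q mulrA divfK// gt_eqF// snc.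
have snL1 : sn L != 0 by rewrite gt_eqF.
exists (q * c / sn L); rewrite mulrCA mulfV// mulr1; split => //.
  exact: (cvg_inv_derive (is_derive_md kappa L) snL1 fL Hmd).
move=> e' gd' gU' ce' T T0 Te'.
rewrite (mulrC q) -mulrA ler_pM2l//.
have snT : 0 < sn (c * T).
  apply: sn_gt0; rewrite mulr_gt0//=.
  have : c * T <= c * e' by rewrite ler_pM2l// ltW.
  by move: ce' r0; lra.
have hl : Q t * sn (c * T) @[t --> 0^'+] --> q * sn (c * T).
  by apply: cvgM => //; exact: cvg_cst.
pose G t := md (mdist (g T) y) - md L - 4 * cn L * sn (c * T / 2)
  * (sn (c / 2 * t) / t / (sn (c * t) / t) * sn (c * (T - t) / 2)).
have hr : G t @[t --> 0^'+] --> md (mdist (g T) y) - md L - cn L * md (c * T).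
  have -> : cn L * md (c * T) = 4 * cn L * sn (c * T / 2)
      * (c / 2 / c * sn (c * (T - 0) / 2)).
    rewrite subr0 /md; field.
    exact: c0.
  apply: cvgB; first exact: cvg_cst.
  apply: cvgM; first exact: cvg_cst.
  apply: cvgM.
    by apply: cvgM; [|apply: cvgV => //]; exact: cvg_sn.
  apply: (@cvg_comp _ _ _ (fun t => c * (T - t) / 2) sn); last exact: continuous_sn.
  apply: cvgM; last exact: cvg_cst.
  apply: cvgM; first exact: cvg_cst.
  apply: cvgB; first exact: cvg_cst.
  by apply: cvg_at_right_filter; exact: cvg_id.
apply: (ler_cvg_to hl hr); near=> t.
have t0 : 0 < t by near: t; exact: nbhs_right_gt.
have te : t < e by near: t; exact: nbhs_right_lt.
have tT : t < T by near: t; exact: nbhs_right_lt.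
have := Hconv e' gd' gU' ce' t T; rewrite (ltW t0) (ltW tT) => /(_ isT Te').
have st := snc _ t0 te.
have -> : Q t * sn (c * T)
    = (md (mdist (g t) y) - md L) * sn (c * T) / sn (c * t).
  by rewrite /Q mulrAC.
rewrite ler_pdivrMr// => /le_trans; apply.
rewrite /G le_eqVlt; apply/orP; left; apply/eqP.
have -> : c * t / 2 = c / 2 * t by ring.
by field; rewrite !gt_eqF.
Unshelve. all: by end_near. Qed.

(** First variation formula. Stewart's inequality bounds the derivative [D] from
    below. For the upper bound, the triangle inequality along [w] shows that [g] and
    [w] rescaled by [N] are at distance at least [D + N]; expanding the square of
    the distance by the homogeneity of [ip], the terms linear in [N] give it. *)
Lemma first_variation g :
  (mdist (g t) y - L) / t @[t --> 0^'+] --> - ip (velocity g) (velocity w).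
Proof.
have [D [HD Hmd _]] := dist_geo_lim g.
suff -> : - ip (velocity g) (velocity w) = D by [].
have [wU wL wd] := wy.
have wdy t : 0 <= t <= L -> mdist (w t) y = L - t.
  move=> /andP[t0 tL]; have := wd t L; rewrite wL t0 tL lexx (ltW L0) => -> //.
  by rewrite distrC ger0_norm// subr_ge0.
have w1 := tnorm_directed_to.
have c0 := tnorm_ge0 (velocity g).
have Hg := near_geo_tnorm g.
have snL0 : 0 < sn L by apply: sn_gt0; rewrite L0; move: yr r0; lra.
apply/eqP; rewrite eq_le; apply/andP; split; last first.
- (* compare with the points [w (N t)], and let [N] tend to infinity *)
  have HN (N : {nonneg R}) : 0 < D + N%:num ->
      (D + N%:num) ^+ 2 <= tnorm (velocity g) ^+ 2 + N%:num ^+ 2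
        - 2 * (N%:num * ip (velocity g) (velocity w)).
    move=> DN; rewrite -(ip_scale catU xU).
    have := ip_mdist (velocity g) (tscale N (velocity w)).
    rewrite tnorm_scale w1 mulr1 => <-.
    rewrite ler_sqr ?nnegrE ?mdist_ge0 ?(ltW DN)//.
    rewrite tscale_velocity mdist_velocity.
    apply/ler_addgt0Pl => e e0; rewrite -lerBlDl.
    apply: geo_dist_ge.
    have De : D - e < D by rewrite ltrBlDr ltrDl.
    have HDe := cvgr_gt _ HD _ De.
    have N1 : 0 < N%:num + 1 by rewrite ltr_wpDl.
    have LN : 0 < L / (N%:num + 1) by rewrite divr_gt0.
    near=> t.
    have t0 : 0 < t by near: t; exact: nbhs_right_gt.
    have tN : t < L / (N%:num + 1) by near: t; exact: nbhs_right_lt.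
    have h1 : D - e < (mdist (g t) y - L) / t by near: t; exact: HDe.
    rewrite ltr_pdivlMr// mulrDr mulr1 mulrC in tN.
    rewrite ltr_pdivlMr// in h1.
    have Nt0 : 0 <= N%:num * t by rewrite mulr_ge0// ltW.
    have NtL : N%:num * t <= L by lra.
    have h2 : mdist (w (N%:num * t)) y = L - N%:num * t.
      by apply: wdy; rewrite Nt0.
    have := metric_triangle (g t) (w (N%:num * t)) y; rewrite h2 /=.
    by move: h1; lra.
  rewrite leNgt; apply/negP => H.
  have dp : 0 < D + ip (velocity g) (velocity w) by lra.
  have N0 : 0 <= `|D| + tnorm (velocity g) ^+ 2 / (D + ip (velocity g) (velocity w)) + 1.
    by rewrite !addr_ge0// divr_ge0 ?sqr_ge0// ltW.
  have := HN (NngNum N0) => /=.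
  set N := _ + 1 in N0 *.
  have DN : 0 < D + N.
    have := ler_norm (- D); rewrite normrN => h.
    have : 0 <= tnorm (velocity g) ^+ 2 / (D + ip (velocity g) (velocity w)).
      by rewrite divr_ge0 ?sqr_ge0// ltW.
    by rewrite /N; lra.
  move=> /(_ DN) h.
  have : 2 * N * (D + ip (velocity g) (velocity w)) <= tnorm (velocity g) ^+ 2.
    by have := sqr_ge0 D; lra.
  have : tnorm (velocity g) ^+ 2 < N * (D + ip (velocity g) (velocity w)).
    rewrite -ltr_pdivrMr// /N; have := normr_ge0 D; lra.
  have : 0 <= tnorm (velocity g) ^+ 2 by exact: sqr_ge0.
  lra.
- (* Stewart's inequality in the triangle [g t, x, y], at the point [w t] *)
  have Dc : - tnorm (velocity g) <= D.
    apply: (cvgr_to_ge HD); near=> t.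
    have t0 : 0 < t by near: t; exact: nbhs_right_gt.
    have h : mdist x (g t) = tnorm (velocity g) * t by near: t; exact: Hg.
    have := dist_geo_lip g t; rewrite h => /ler_normlP[h1 h2].
    by rewrite ler_pdivlMr//; lra.
  suff : geo_dist g w ^+ 2 <= 2 * (tnorm (velocity g) ^+ 2 / 2 + D + 1 / 2).
    rewrite -mdist_velocity ip_mdist w1; lra.
  move: c0 Hg Dc; move: (tnorm (velocity g)) => c c0 Hg Dc.
  pose F t := (sn (L - t) * (md (c * t) / t ^+ 2)
    + sn (1 * t) / t * ((md (mdist (g t) y) - md L) / t)
    + sn L * (md (1 * t) / t ^+ 2)) / sn L.
  have FB : F t @[t --> 0^'+] --> c ^+ 2 / 2 + D + 1 / 2.
    have -> : c ^+ 2 / 2 + D + 1 / 2 = (sn (L - 0) * (c ^+ 2 / 2) + 1 * (sn L * D)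
        + sn L * (1 ^+ 2 / 2)) / sn L.
      by rewrite subr0; field; rewrite gt_eqF.
    apply: cvgM; last exact: cvg_cst.
    apply: cvgD; last by apply: cvgM; [exact: cvg_cst|exact: cvg_md].
    apply: cvgD; last by apply: cvgM => //; exact: cvg_sn.
    apply: cvgM; last exact: cvg_md.
    apply: (@cvg_comp _ _ _ (fun t => L - t) sn); last exact: continuous_sn.
    apply: cvgB; first exact: cvg_cst.
    by apply: cvg_at_right_filter; exact: cvg_id.
  apply: (geo_dist_sqr_le (kappa := kappa) _ FB).
    have r2 : 0 < rad / 2 by rewrite divr_gt0.
    near=> t.
    have t0 : 0 < t by near: t; exact: nbhs_right_gt.
    have tL : t < L by near: t; exact: nbhs_right_lt.
    have gx : mdist x (g t) = c * t by near: t; exact: Hg.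
    have gr : mdist x (g t) < rad / 2 by near: t; exact: near_geo_lt.
    have Ug : U (g t) by near: t; exact: near_geo.
    have Uw : U (w t) by apply: wU; rewrite (ltW t0) ltW.
    have dxw : mdist x (w t) = t.
      rewrite -{1}(geo0 w) wd ?lexx ?(ltW L0) ?(ltW t0) ?(ltW tL)//.
      by rewrite sub0r normrN gtr0_norm.
    have dwy : mdist (w t) y = L - t.
      by apply: wdy; rewrite (ltW t0) ltW.
    have h1 : mdist (g t) x <= rad by rewrite (metric_sym (g t)); move: r0; lra.
    have h2 : mdist (g t) y <= rad.
      by have := metric_triangle (g t) x y; rewrite (metric_sym (g t) x); move: yr; lra.
    have h3 : L <= rad by move: yr r0; lra.
    have h4 : mdist x (w t) + mdist (w t) y = L by rewrite dxw dwy; ring.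
    have := CAT_stewart catU Ug Ux Uy Uw h1 h2 h3 h4.
    rewrite dxw dwy (metric_sym (g t) x) gx.
    have := stewart_base kappa L t => hb HS.
    have t2 : 0 < t ^+ 2 by rewrite exprn_gt0.
    have -> : F t = (sn (L - t) * md (c * t)
      + sn t * (md (mdist (g t) y) - md L) + sn L * md t) / sn L / t ^+ 2.
      by rewrite /F !mul1r; field; rewrite !gt_eqF.
    rewrite ler_pM2r ?invr_gt0// ler_pdivlMr// (le_trans HS)//.
    by rewrite -hb; lra.
  have := sqr_ge0 (c - 1); lra.
Unshelve. all: by end_near. Qed.

End first_variation.

Arguments directed_to {R Y x} U y w.

(** * Density of the directions to a dense set *)

Lemma cvg_at_right_unique (R : realType) (f : R -> R) (a b : R) :
  f t @[t --> 0^'+] --> a -> f t @[t --> 0^'+] --> b -> a = b.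
Proof. by move=> /cvg_lim <- // /cvg_lim <-. Qed.

Section directions.
Context {R : realType} {kappa : R} {Y : metricType R} {x : Y} {U : set Y}.
Context (catU : CAT kappa U) (xU : nbhs x U).
Local Notation sn := (sn kappa).
Local Notation cn := (cn kappa).
Local Notation md := (md kappa).
Local Notation rad := (rad kappa).

Lemma ddist_unique (y : Y) (D : tcone x -> R) : continuous D ->
  (forall g : geo x,
    (mdist (g h) y - mdist x y) / h @[h --> 0^'+] --> D (velocity g)) ->
  ddist y = D.
Proof.
move=> cD HD; rewrite /ddist; set P := (X in get X).
have [cD' HD'] : P (get P) by apply: getPex; exists D.
apply/funext; apply: tcone_eq => // g.
exact: cvg_at_right_unique (HD' g) (HD g).
Qed.

Lemma ddist_self (v : tcone x) : ddist x v = tnorm v.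
Proof.
suff -> : ddist x = (@tnorm R Y x) by [].
apply: ddist_unique; first exact: (@continuous_mdist _ (tcone x)).
move=> g; apply: (@cvg_trans _ ((fun=> tnorm (velocity g)) @ 0^'+)).
  apply: near_eq_cvg; near=> t.
  have t0 : 0 < t by near: t; exact: nbhs_right_gt.
  have -> : mdist (g t) x = tnorm (velocity g) * t.
    by rewrite metric_sym; near: t; exact: near_geo_tnorm.
  by rewrite mdistxx subr0 mulfK// gt_eqF.
exact: cvg_cst.
Unshelve. all: by end_near. Qed.

Lemma ddist_ip (y : Y) (w : geo x) : U y -> x != y -> directed_to U y w ->
  mdist x y <= rad / 2 -> forall v, ddist y v = - ip v (velocity w).
Proof.
move=> Uy xy wy yr v; rewrite (@ddist_unique y (fun v => - ip v (velocity w)))//.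
  have -> : (fun v => - ip v (velocity w)) = (fun v => -1 * ip v (velocity w)).
    by apply/funext => u; rewrite mulN1r.
  exact: continuous_ipZ.
by move=> g; exact: (first_variation catU xU Uy xy wy yr).
Qed.

(** The inequality that survives in the limit in [dist_geo_lim], with the
    derivative identified by the first variation formula. *)
Lemma law_of_cosines (y : Y) (w g : geo x) (e : R) : U y -> x != y ->
  directed_to U y w -> mdist x y <= rad / 2 ->
  (forall s t, 0 <= s < e -> 0 <= t < e ->
     mdist (g s) (g t) = tnorm (velocity g) * `|s - t|) ->
  (forall t, 0 <= t < e -> U (g t)) -> tnorm (velocity g) * e <= rad / 2 ->
  forall T, 0 < T -> T < e ->
  tnorm (velocity g) * (md (mdist x y)
     + cn (mdist x y) * md (tnorm (velocity g) * T) - md (mdist (g T) y))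
  <= sn (mdist x y) * ip (velocity g) (velocity w) * sn (tnorm (velocity g) * T).
Proof.
move=> Uy xy wy yr gd gU ce T T0 Te.
have [D [HD _ /(_ _ gd gU ce _ T0 Te)]] := dist_geo_lim catU xU Uy xy yr g.
have HD' := first_variation catU xU Uy xy wy yr (g := g).
have <- : - D = ip (velocity g) (velocity w).
  apply/eqP; rewrite eqr_oppLR; apply/eqP.
  exact: cvg_at_right_unique HD HD'.
lra.
Qed.

(** By the law of cosines, a geodesic [g] is close to the geodesics directed to
    the points [y] close to [g T], for [T] small. *)
Lemma directions_dense_geo (A : set Y) (g : geo x) (r e : R) : dense A ->
  0 < tnorm (velocity g) -> 0 < r -> 0 < e ->
  exists y w (l : {nonneg R}), [/\ A y, mdist x y < r, mdist x y <= rad / 2 &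
    [/\ U y, x != y, directed_to U y w &
        mdist (velocity g) (tscale l (velocity w)) < e]].
Proof.
move=> dA cp r0 e0.
have [e1 e10 gd1] := geo_tnorm g.
have /near_at_rightP[e2 e20 gU2] := near_geo g xU.
have [rho rho0 rhoU] := nbhs_mdist_ex xU.
have radp := rad_gt0 kappa.
have [l lE] : exists l : {nonneg R}, l%:num = tnorm (velocity g).
  by exists (NngNum (ltW cp)).
have [c cE] : exists c, c = tnorm (velocity g) by exists (tnorm (velocity g)).
rewrite -cE in cp gd1 lE.
(* points [y] with [mdist (g T) y < d * c * T] will have
   [c * (1 - 3 * d) <= ip (velocity g) (velocity w)], hence
   [mdist (velocity g) (tscale c (velocity w)) ^+ 2 <= 6 * d * c ^+ 2] *)
pose d := Num.min (1 / 4) (e ^+ 2 / (7 * c ^+ 2)).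
have d0 : 0 < d.
  by rewrite lt_min divr_gt0//= divr_gt0 ?exprn_gt0// mulr_gt0// exprn_gt0.
have d1 : d <= 1 / 4 by rewrite ge_min lexx.
have de : 6 * d * c ^+ 2 < e ^+ 2.
  have : d <= e ^+ 2 / (7 * c ^+ 2) by rewrite ge_min lexx orbT.
  rewrite ler_pdivlMr ?mulr_gt0 ?exprn_gt0// => h.
  have : 0 < d * c ^+ 2 by rewrite mulr_gt0// exprn_gt0.
  by lra.
(* the two sides of the law of cosines divided by [T ^+ 2], with [mdist x y]
   and [mdist (g T) y] replaced by their bounds *)
pose F (T : R) := md ((1 - d) * c * T) / T ^+ 2
  + (1 - `|kappa| * md ((1 + d) * c * T)) * (md (c * T) / T ^+ 2)
  - md (d * c * T) / T ^+ 2.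
pose G (T : R) := (1 - 3 * d) * (sn ((1 + d) * c * T) / T * (sn (c * T) / T)).
have FL : F T @[T --> 0^'+] --> ((1 - d) * c) ^+ 2 / 2
    + (1 - `|kappa| * 0) * (c ^+ 2 / 2) - (d * c) ^+ 2 / 2.
  apply: cvgB; last exact: cvg_md.
  apply: cvgD; first exact: cvg_md.
  apply: cvgM; last exact: cvg_md.
  apply: cvgB; first exact: cvg_cst.
  apply: cvgM; first exact: cvg_cst.
  have : md ((1 + d) * c * T) @[T --> 0^'+] --> md ((1 + d) * c * 0).
    apply: (@cvg_comp _ _ _ (fun T => (1 + d) * c * T) md); last exact: continuous_md.
    apply: cvgM; first exact: cvg_cst.
    by apply: cvg_at_right_filter; exact: cvg_id.
  by rewrite mulr0 md0.
have GL : G T @[T --> 0^'+] --> (1 - 3 * d) * ((1 + d) * c * c).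
  by apply: cvgM; [exact: cvg_cst|apply: cvgM; exact: cvg_sn].
have FG : 0 < ((1 - d) * c) ^+ 2 / 2
    + (1 - `|kappa| * 0) * (c ^+ 2 / 2) - (d * c) ^+ 2 / 2
    - (1 - 3 * d) * ((1 + d) * c * c).
  have -> : ((1 - d) * c) ^+ 2 / 2
    + (1 - `|kappa| * 0) * (c ^+ 2 / 2) - (d * c) ^+ 2 / 2
    - (1 - 3 * d) * ((1 + d) * c * c) = c ^+ 2 * (d + 3 * d ^+ 2) by field.
  by rewrite mulr_gt0 ?exprn_gt0// addr_gt0// mulr_gt0// exprn_gt0.
have HFG : \forall T \near 0^'+, 0 < F T - G T.
  by apply: (cvgr_gt _ _ _ FG); exact: cvgB.
have c2 : 0 < 2 * c by rewrite mulr_gt0.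
have m0 : 0 < Num.min (Num.min r rho) (rad / 2) / (2 * c).
  by rewrite divr_gt0// !lt_min r0 rho0 divr_gt0.
pose e3 := Num.min (Num.min e1 e2) (rad / 2 / c).
have e30 : 0 < e3 by rewrite !lt_min e10 e20 !divr_gt0.
have [T [T0 TF Tm Te]] : exists T, [/\ 0 < T, 0 < F T - G T,
    T < Num.min (Num.min r rho) (rad / 2) / (2 * c) & T < e3].
  near (0 : R)^'+ => T; exists T; split; near: T => //.
  - exact: nbhs_right_gt.
  - exact: nbhs_right_lt.
  - exact: nbhs_right_lt.
have gd s t : 0 <= s < e3 -> 0 <= t < e3 -> mdist (g s) (g t) = c * `|s - t|.
  move=> /andP[s0 se] /andP[t0 te].
  by apply: gd1; rewrite ?s0 ?t0/=; [move: se|move: te];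
    rewrite !lt_min => /andP[/andP[]].
have gU t : 0 <= t < e3 -> U (g t).
  rewrite le_eqVlt => /andP[/predU1P[<-|t0]].
    by rewrite geo0 => _; exact: nbhs_singleton.
  by rewrite !lt_min => /andP[/andP[_ te] _]; apply: gU2; rewrite t0.
have ce : c * e3 <= rad / 2 by rewrite mulrC -ler_pdivlMr// ge_min lexx orbT.
have cT : 0 < c * T by rewrite mulr_gt0.
have dcT : 0 < d * (c * T) by rewrite mulr_gt0.
have [y Ay hy] := dense_mdist (g T) dA dcT.
have dxT : mdist x (g T) = c * T.
  by rewrite -{1}(geo0 g) gd ?lexx ?(ltW T0)//= sub0r normrN gtr0_norm.
have L1 : mdist x y < (1 + d) * (c * T).
  by have := metric_triangle x (g T) y; lra.
have L2 : (1 - d) * (c * T) < mdist x y.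
  by have := metric_triangle x y (g T); rewrite (metric_sym y); lra.
have L3 : 0 < mdist x y by apply: le_lt_trans L2; rewrite mulr_ge0 ?ltW//; lra.
have L4 : mdist x y < 2 * c * T.
  apply: (lt_trans L1); rewrite -mulrA ltr_pM2r//; lra.
rewrite ltr_pdivlMr// (mulrC T) !lt_min -andbA in Tm.
have /and3P[Tr Trho Trad] := Tm.
have Uy : U y by apply: rhoU; exact: lt_trans Trho.
have xy : x != y by rewrite -mdist_gt0.
have yr : mdist x y <= rad / 2 by rewrite ltW// (lt_trans L4).
have [w wy] := directed_to_ex catU xU Uy xy.
exists y, w, l; split => //; first exact: lt_trans Tr.
split => //.
have := law_of_cosines (g := g) (e := e3) Uy xy wy yr.
rewrite -cE => /(_ gd gU ce _ T0 Te) HL.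
suff ipc : c * (1 - 3 * d) <= ip (velocity g) (velocity w).
  have w1 := tnorm_directed_to xy wy.
  rewrite -ltr_sqr ?nnegrE ?mdist_ge0 ?(ltW e0)//.
  rewrite ip_mdist tnorm_scale w1 mulr1 (ip_scale catU xU) lE -cE.
  have : c * (c * (1 - 3 * d)) <= c * ip (velocity g) (velocity w).
    by rewrite ler_pM2l.
  lra.
have dr : (1 + d) * c * T <= rad.
  have : (1 + d) * c * T <= 2 * (c * T) by rewrite -mulrA ler_pM2r//; lra.
  by move: Trad radp; lra.
have snL0 : 0 < sn (mdist x y) by apply: sn_gt0; rewrite L3; move: yr radp; lra.
have cTr : c * T <= rad.
  have : c * T <= c * e3 by rewrite ler_pM2l// ltW.
  by move: ce radp; lra.
have snT0 : 0 < sn (c * T) by apply: sn_gt0; rewrite cT.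
have s1 : sn (mdist x y) <= sn ((1 + d) * c * T).
  by apply/ltW/sn_lt => //; [exact: ltW|rewrite -mulrA].
have m1 : md ((1 - d) * c * T) <= md (mdist x y).
  apply: md_le; rewrite -?mulrA ?(ltW L2)//; last by move: yr radp; lra.
  by rewrite mulr_ge0 ?(ltW cT)//; lra.
have m2 : md (mdist (g T) y) <= md (d * c * T).
  apply: md_le; [exact: mdist_ge0|by rewrite -mulrA ltW|].
  have : d * (c * T) <= 1 * (c * T) by rewrite ler_pM2r//; lra.
  by rewrite mul1r -mulrA => h; exact: le_trans cTr.
have m3 : md (mdist x y) <= md ((1 + d) * c * T).
  by apply: md_le => //; [exact: mdist_ge0|rewrite -mulrA ltW].
have c1 : 1 - `|kappa| * md ((1 + d) * c * T) <= cn (mdist x y).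
  rewrite cn_md lerB// (le_trans (ler_norm _))// normrM (ger0_norm (md_ge0 _ _)).
  by rewrite ler_wpM2l.
have m4 : 0 <= md (c * T) by exact: md_ge0.
have T2 : 0 < T ^+ 2 by rewrite exprn_gt0.
have key : (1 - 3 * d) * (sn ((1 + d) * c * T) * sn (c * T)) <
    md ((1 - d) * c * T) + (1 - `|kappa| * md ((1 + d) * c * T)) * md (c * T)
    - md (d * c * T).
  rewrite -subr_gt0.
  have -> : md ((1 - d) * c * T)
    + (1 - `|kappa| * md ((1 + d) * c * T)) * md (c * T) - md (d * c * T)
    - (1 - 3 * d) * (sn ((1 + d) * c * T) * sn (c * T)) = (F T - G T) * T ^+ 2.
    by rewrite /F /G; field; rewrite gt_eqF.
  by rewrite mulr_gt0.
have k1 : (1 - `|kappa| * md ((1 + d) * c * T)) * md (c * T)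
    <= cn (mdist x y) * md (c * T) by rewrite ler_wpM2r.
have k2 : (1 - 3 * d) * (sn (mdist x y) * sn (c * T))
    <= (1 - 3 * d) * (sn ((1 + d) * c * T) * sn (c * T)).
  rewrite ler_wpM2l//; first by lra.
  by rewrite ler_pM2r.
have k3 : c * ((1 - 3 * d) * (sn (mdist x y) * sn (c * T))) <=
  sn (mdist x y) * ip (velocity g) (velocity w) * sn (c * T).
  by apply: le_trans HL; rewrite ler_pM2l//; lra.
rewrite -(ler_pM2r (mulr_gt0 snL0 snT0)); lra.
Unshelve. all: by end_near. Qed.

Lemma directions_dense (A : set Y) (u : tcone x) (r e : R) : dense A ->
  u != tzero x -> 0 < r -> 0 < e ->
  exists y w (l : {nonneg R}), [/\ A y, mdist x y < r, tnorm w = 1,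
    forall v, ddist y v = - ip v w & mdist u (tscale l w) < e].
Proof.
move=> dA u0 r0 e0.
have un : 0 < tnorm u by rewrite /tnorm mdist_gt0.
have m0 : 0 < Num.min (e / 2) (tnorm u) by rewrite lt_min un divr_gt0.
have [g] := tcone_dense u m0; rewrite lt_min => /andP[ug1 ug2].
have cp : 0 < tnorm (velocity g).
  have := mdist_lip u (velocity g) (tzero x); rewrite -!/(tnorm _).
  by move=> /ler_normlP[h1 h2]; lra.
have e20 : 0 < e / 2 by rewrite divr_gt0.
have [y [w [l [Ay yr yrad [Uy xy wy H]]]]] := directions_dense_geo dA cp r0 e20.
exists y, (velocity w), l; split => //; first exact: (tnorm_directed_to xy wy).
  exact: ddist_ip.
rewrite (le_lt_trans (metric_triangle _ (velocity g) _))// [ltRHS]splitr.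
exact: ltrD.
Qed.

End directions.

Section small_balls.
Context {R : realType} {kappa : R} {Y : metricType R} {x : Y} {U : set Y}.
Context (catU : CAT kappa U).
Local Notation rad := (rad kappa).

(** Small balls are convex by Stewart's inequality, and the comparison with the
    model triangles is inherited by subsets. *)
Lemma CAT_closed_ball (r s : R) : (forall y, mdist x y < r -> U y) ->
  0 < s -> s < r -> s <= rad / 4 -> CAT kappa [set y | mdist x y <= s].
Proof.
move=> rU s0 sr srad.
have radp := rad_gt0 kappa.
have sU y : mdist x y <= s -> U y by move=> h; apply: rU; exact: le_lt_trans sr.
have Ux : U x by apply: sU; rewrite mdistxx ltW.
split; last by move=> a b c p /sU Ua /sU Ub /sU Uc /sU Up; exact: catU.2.
move=> b c /= xb xc.
have [g [g0 g1 gU gd]] := catU.1 _ _ (sU _ xb) (sU _ xc).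
exists g; split => // t t01.
set L := mdist b c.
have bp : mdist b (g t) = L * t.
  have /andP[t0 _] := t01.
  by rewrite -{1}g0 gd ?lexx ?ler01// sub0r normrN ger0_norm.
have pc : mdist (g t) c = L * (1 - t).
  have /andP[_ t1] := t01.
  by rewrite -{1}g1 gd ?lexx ?ler01// distrC ger0_norm// subr_ge0.
have L2 : L <= 2 * s.
  by have := metric_triangle b x c; rewrite (metric_sym b x) /L; lra.
have [L0|L0] := eqVneq L 0.
  by move: bp; rewrite L0 mul0r => /mdist_positivity <-.
have Lp : 0 < L by rewrite lt_neqAle eq_sym L0 mdist_ge0.
have bpc : mdist b (g t) + mdist (g t) c = mdist b c.
  by rewrite bp pc -/L; ring.
have h1 : mdist x b <= rad by lra.
have h2 : mdist x c <= rad by lra.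
have h3 : mdist b c <= rad by rewrite -/L; lra.
have := CAT_stewart catU Ux (sU _ xb) (sU _ xc) (gU _ t01) h1 h2 h3 bpc.
have := snD4 kappa (mdist b (g t)) (mdist (g t) c); rewrite bpc.
have b1 := mdist_ge0 b (g t); have b2 := mdist_ge0 (g t) c.
have bpL : mdist b (g t) <= L by rewrite /L -bpc lerDl.
have pcL : mdist (g t) c <= L by rewrite /L -bpc lerDr.
have s1 : 0 <= sn kappa (mdist b (g t)).
  by apply: sn_ge0; rewrite b1 (le_trans bpL).
have s2 : 0 <= sn kappa (mdist (g t) c).
  by apply: sn_ge0; rewrite b2 (le_trans pcL).
have sr' : s <= rad by lra.
have m1 : sn kappa (mdist (g t) c) * md kappa (mdist x b) <=
    sn kappa (mdist (g t) c) * md kappa s.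
  by rewrite ler_wpM2l// md_le// mdist_ge0.
have m2 : sn kappa (mdist b (g t)) * md kappa (mdist x c) <=
    sn kappa (mdist b (g t)) * md kappa s.
  by rewrite ler_wpM2l// md_le// mdist_ge0.
have cs : 0 <= cn kappa s by apply: cn_ge0; rewrite (ltW s0).
have E0 : 0 <= sn kappa (mdist b c / 2) * sn kappa (mdist b (g t) / 2)
    * sn kappa (mdist (g t) c / 2).
  rewrite !mulr_ge0//; apply: sn_ge0; rewrite -/L; apply/andP; split; lra.
rewrite -/L in E0 *.
set E := (X in 0 <= X) in E0 *.
have cE : 0 <= E * cn kappa s by rewrite mulr_ge0.
rewrite cn_md in cE.
have sL : 0 < sn kappa L by apply: sn_gt0; rewrite Lp.
rewrite -/L -/E => h4; rewrite -/E => HS.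
have : md kappa (mdist x (g t)) * sn kappa L <= md kappa s * sn kappa L.
  by apply: (le_trans HS); rewrite h4; lra.
rewrite ler_pM2r// => hmd; rewrite leNgt; apply/negP => slt.
have : md kappa s < md kappa (mdist x (g t)).
  apply: md_lt => //; first exact: ltW.
  have := metric_triangle x b (g t); lra.
by rewrite ltNge hmd.
Qed.

(** This relates the ball in which [ddist] is controlled to the balls of a
    CAT(kappa) neighborhood. *)
Lemma catball_ball (r s : R) : (forall y, mdist x y < r -> U y) ->
  0 < s -> s < r -> s <= rad / 4 ->
  forall y, mdist x y < s -> catball kappa x y.
Proof.
move=> rU s0 sr srad y ys.
rewrite /catball /=; apply: (@lt_le_trans _ _ s%:E); first by rewrite lte_fin.
apply: ereal_sup_ubound; exists s => //=; split.
  have radp := rad_gt0 kappa.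
  apply: (@le_trans _ _ (4^-1%:E * (2%:E * diam_model kappa))%E); last first.
    by rewrite muleA -EFinM (_ : 4^-1 * 2 = 2^-1 :> R)//; field.
  apply: (@le_trans _ _ (4^-1%:E * (4 * rad)%:E)%E).
    by rewrite -EFinM lee_fin; lra.
  by apply: lee_wpmul2l; [rewrite lee_fin|exact: rad_diam].
exact: (CAT_closed_ball rU s0 sr srad).
Qed.

End small_balls.

(** All that is used of the geometry of [Y]: around each point there is a ball
    on which the comparison with the distance functions is available, and in
    the tangent cones of which the scalar product is homogeneous and the
    directions to a dense set of points are dense. *)
Definition good_ball (R : realType) (kappa : R) (Y : metricType R) (A : set Y)
    (x0 : Y) (r : R) : Prop :=
  forall x, mdist x0 x < r -> [/\ catball kappa x0 x,
    forall l (v w : tcone x), ip v (tscale l w) = l%:num * ip v w,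
    forall y (v : tcone x), mdist x0 y < r -> `|ddist y v| <= tnorm v &
    forall (u : tcone x) (e : R), u != tzero x -> 0 < e ->
      exists y w (l : {nonneg R}), [/\ A y, mdist x0 y < r, tnorm w = 1,
        forall v : tcone x, ddist y v = - ip v w &
        mdist u (tscale l w) < e]].

Lemma good_ball_ex (R : realType) (kappa : R) (Y : metricType R) (A : set Y) :
  local_CAT kappa Y -> dense A ->
  forall x0, exists2 r : R, 0 < r & good_ball kappa A x0 r.
Proof.
move=> catY dA x0; have [U x0U catU] := catY x0.
have [rho rho0 rhoU] := nbhs_mdist_ex x0U.
have radp := rad_gt0 kappa.
pose r := Num.min (rho / 2) (rad kappa / 4).
have r0 : 0 < r by rewrite lt_min !divr_gt0.
have rrho : r < rho.
  have : r <= rho / 2 by rewrite ge_min lexx.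
  by lra.
have rrad : r <= rad kappa / 4 by rewrite ge_min lexx orbT.
exists r => // x xr.
have near_x y : mdist x y < r - mdist x0 x -> mdist x0 y < r.
  by have := metric_triangle x0 x y; lra.
have xr0 : 0 < r - mdist x0 x by rewrite subr_gt0.
have xU : nbhs x U.
  apply: (nbhs_mdist_in xr0) => y /near_x yr.
  by apply: rhoU; exact: lt_trans rrho.
have dirE y : mdist x0 y < r -> x != y -> exists2 w : geo x, directed_to U y w &
    forall v, ddist y v = - ip v (velocity w).
  move=> yr xy.
  have Uy : U y by apply: rhoU; exact: lt_trans rrho.
  have [w wy] := directed_to_ex catU xU Uy xy; exists w => //.
  apply: (ddist_ip catU xU Uy xy wy).
  by have := metric_triangle x x0 y; rewrite (metric_sym x x0); lra.
split.
- exact: (catball_ball catU rhoU r0 rrho rrad).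
- by move=> l v w; exact: (ip_scale catU xU).
- move=> y v yr; have [<-|xy] := eqVneq x y.
    by rewrite ddist_self ger0_norm// tnorm_ge0.
  have [w wy ->] := dirE y yr xy.
  rewrite normrN (le_trans (norm_ip _ _))// (tnorm_directed_to xy wy) mulr1//.
- move=> u e u0 e0.
  have [y [w [l [Ay yr w1 dw uw]]]] := directions_dense catU xU dA u0 xr0 e0.
  by exists y, w, l; split => //; exact: near_x.
Qed.

(** * Linear algebra in tangent cones *)

Section scalar_product.
Context {R : realType} {T : metricType R} (nrm : T -> R) (ip : T -> T -> R).
Context (nrm_ge0 : forall v, 0 <= nrm v) (ipC : forall v w, ip v w = ip w v)
  (ip_mdist : forall v w,
    mdist v w ^+ 2 = nrm v ^+ 2 + nrm w ^+ 2 - 2 * ip v w).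
Context {v1 v2 a s : T} (Ha : forall w, ip a w = ip v1 w + ip v2 w)
  (Hs : forall w, ip s w = ip v1 w - ip v2 w).

Let ipvv v : ip v v = nrm v ^+ 2.
Proof. by have := ip_mdist v v; rewrite mdistxx expr0n/=; lra. Qed.

Let sqr_sum : nrm a ^+ 2 = nrm v1 ^+ 2 + nrm v2 ^+ 2 + 2 * ip v1 v2.
Proof. rewrite -ipvv Ha !(ipC _ a) !Ha !ipvv (ipC v2 v1); lra. Qed.

Let sqr_diff : nrm s ^+ 2 = nrm v1 ^+ 2 + nrm v2 ^+ 2 - 2 * ip v1 v2.
Proof. rewrite -ipvv Hs !(ipC _ s) !Hs !ipvv (ipC v2 v1); lra. Qed.

Lemma parallelogram :
  nrm a ^+ 2 + nrm s ^+ 2 = 2 * (nrm v1 ^+ 2 + nrm v2 ^+ 2).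
Proof. rewrite sqr_sum sqr_diff; lra. Qed.

Lemma mdist_diff : mdist v1 v2 = nrm s.
Proof.
apply/eqP; rewrite -(@eqrXn2 _ 2)// ?mdist_ge0// ?nrm_ge0//.
by rewrite ip_mdist sqr_diff.
Qed.

Lemma half_sum_midpoint (h : T) : nrm h = nrm a / 2 ->
  (forall w, ip w h = ip w a / 2) ->
  mdist v1 h = mdist v1 v2 / 2 /\ mdist h v2 = mdist v1 v2 / 2.
Proof.
move=> hn hi; have d0 : 0 <= mdist v1 v2 / 2 by rewrite divr_ge0 ?mdist_ge0.
rewrite (metric_sym h); split; apply/eqP; rewrite -(@eqrXn2 _ 2)// ?mdist_ge0//;
  apply/eqP; rewrite expr_div_n !ip_mdist hn hi expr_div_n sqr_sum.
- by rewrite (ipC v1 a) Ha ipvv (ipC v2 v1); lra.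
- by rewrite (ipC v2 a) Ha ipvv; lra.
Qed.

Lemma sum_double_midpoint (m p : T) : mdist v1 m = mdist v1 v2 / 2 ->
  mdist m v2 = mdist v1 v2 / 2 -> nrm p = 2 * nrm m ->
  (forall w, ip w p = 2 * ip w m) -> a = p.
Proof.
move=> m1 m2 np ipp; rewrite metric_sym in m2.
have e1 := ip_mdist v1 m; have e2 := ip_mdist v2 m; have e3 := ip_mdist v1 v2.
rewrite m1 expr_div_n in e1; rewrite m2 expr_div_n in e2.
apply: mdist_positivity; apply/eqP; rewrite -sqrf_eq0; apply/eqP.
by rewrite ip_mdist np ipp Ha sqr_sum exprMn; lra.
Qed.

End scalar_product.

Section cone_algebra.
Context {R : realType} {Y : metricType R} {x : Y}.
Implicit Types u v w a s : tcone x.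

(** Two vectors whose scalar products with all others add up are summed by
    [toplus]: if [a] represents [v1 + v2], then half of [a] is a midpoint of [v1]
    and [v2], which gives the existence of midpoints, and the double of any
    midpoint is at distance [0] from [a]. The two other identities are the
    bilinear computations of an inner product space. *)
Lemma cone_sum v1 v2 a s :
  (forall l v w, ip v (tscale l w) = l%:num * ip v w) ->
  (forall w, ip a w = ip v1 w + ip v2 w) ->
  (forall w, ip s w = ip v1 w - ip v2 w) ->
  [/\ a = toplus v1 v2, mdist v1 v2 = tnorm s
    & tnorm a ^+ 2 + tnorm s ^+ 2 = 2 * (tnorm v1 ^+ 2 + tnorm v2 ^+ 2)].
Proof.
move=> hom Ha Hs.
split; last exact: (parallelogram (@ipC _ _ x) (@ip_mdist _ _ x) Ha Hs).
- pose P := [set m : tcone x | mdist v1 m = mdist v1 v2 / 2 /\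
    mdist m v2 = mdist v1 v2 / 2].
  have h0 : 0 <= 2^-1 :> R by rewrite invr_ge0.
  have Ph : P (tscale (NngNum h0) a).
    apply: (half_sum_midpoint (@ipC _ _ x) (@ip_mdist _ _ x) Ha).
      by rewrite tnorm_scale mulrC.
    by move=> w; rewrite hom mulrC.
  have [m1 m2] : P (tmidpoint v1 v2) by apply: getPex; exists (tscale (NngNum h0) a).
  apply: (sum_double_midpoint (@ipC _ _ x) (@ip_mdist _ _ x) Ha m1 m2).
    by rewrite tnorm_scale.
  by move=> w; rewrite hom.
- exact: (mdist_diff (@tnorm_ge0 _ _ x) (@ipC _ _ x) (@ip_mdist _ _ x) Hs).
Qed.

Context {kappa : R} {A : set Y} {x0 : Y} {r : R}.
Context (gb : good_ball kappa A x0 r) (xr : mdist x0 x < r).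

Lemma continuous_lin3 (T : metricType R) (f g h : T -> R) (c1 c2 : R) :
  continuous f -> continuous g -> continuous h ->
  continuous (fun t => f t - (c1 * g t + c2 * h t)).
Proof.
move=> cf cg ch v; apply: cvgB; first exact: cf.
by apply: cvgD; apply: cvgM; (try exact: cvg_cst); [exact: cg|exact: ch].
Qed.

(** The differentials of the distances are the opposites of the scalar products
    with unit directions; the multiples of these being dense, they determine the
    scalar product with all vectors. *)
Lemma ip_of_ddist a v1 v2 (c1 c2 : R) :
  (forall y, A y -> mdist x0 y < r ->
    ddist y a = c1 * ddist y v1 + c2 * ddist y v2) ->
  forall w, ip a w = c1 * ip v1 w + c2 * ip v2 w.
Proof.
move=> H u; have [_ _ _ dirs] := gb xr; have [_ hom _ _] := gb xr.
have [->|u0] := eqVneq u (tzero x); first by rewrite !ipv0 !mulr0 addr0.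
pose phi u := ip u a - (c1 * ip u v1 + c2 * ip u v2).
have cphi : continuous phi.
  by apply: (@continuous_lin3 (tcone x)); exact: continuous_ip.
apply/eqP; rewrite -subr_eq0 !(ipC _ u) -/(phi u) -normr_le0 leNgt.
apply/negP => phi0.
have /cvgrPdist_lt/(_ _ phi0)/nbhs_mdist_ex[e e0 He] := cphi u.
have [y [w [l [Ay yr w1 dw uw]]]] := dirs u e u0 e0.
have := He _ uw; rewrite {2}/phi !(ipC (tscale l w)) !hom.
have dH := H y Ay yr; rewrite !dw in dH.
move: dH (phi u); move: (ip a w) (ip v1 w) (ip v2 w) => i i1 i2 dH z.
have -> : i = c1 * i1 + c2 * i2 by lra.
rewrite (_ : l%:num * (c1 * i1 + c2 * i2) - (c1 * (l%:num * i1) + c2 * (l%:num * i2)) = 0).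
  by rewrite subr0 ltxx.
by ring.
Qed.

(** The norm of [v] is nearly attained by its scalar product with a unit
    direction close to that of [v]. *)
Lemma tnorm_le_ddist v (M : R) : 0 <= M ->
  (forall y, A y -> mdist x0 y < r -> `|ddist y v| <= M) -> tnorm v <= M.
Proof.
move=> M0 H; have [_ hom _ dirs] := gb xr.
have [->|v0] := eqVneq v (tzero x); first by rewrite tnorm_tzero.
have vp : 0 < tnorm v by rewrite /tnorm mdist_gt0.
apply/ler_addgt0Pl => e e0.
pose d := Num.min e (tnorm v / 2).
have d0 : 0 < d by rewrite lt_min e0 divr_gt0.
have [y [w [l [Ay yr w1 dw vw]]]] := dirs v d v0 d0.
have Hy := H y Ay yr; rewrite dw normrN in Hy.
have lE : tnorm (tscale l w) = l%:num by rewrite tnorm_scale w1 mulr1.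
have := mdist_lip v (tscale l w) (tzero x); rewrite -!/(tnorm _) lE => hl.
have := ip_mdist v (tscale l w); rewrite lE hom => hd.
have d0' := mdist_ge0 v (tscale l w).
have de : d <= e by rewrite ge_min lexx.
have dv : d <= tnorm v / 2 by rewrite ge_min lexx orbT.
have := ler_norm (ip v w); move: hl hd vw d0' Hy vp dv.
move: (mdist v _) (tnorm v) (l%:num) (ip v w) => D n k i.
move=> /ler_normlP[h1 h2] hd Dd D0 Hi np dn ii.
have kp : 0 < k by lra.
have h3 : D ^+ 2 <= d * d by rewrite expr2 ler_pM// ltW.
have dk : d <= k by lra.
have h4 : d * d <= d * k by rewrite ler_pM2l.
have h5 := sqr_ge0 (n - k).
have h6 : k * i <= k * M by rewrite ler_pM2l//; lra.
have h7 : d * k <= e * k by rewrite ler_pM2r.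
rewrite -(ler_pM2l kp).
have : 0 <= e * k by rewrite mulr_ge0// ltW.
lra.
Qed.

End cone_algebra.

(** * Measures on separable metric spaces *)

Section borel_metric.
Context {R : realType} {Y : completeMetricType R}.

Lemma open_mball (x : Y) (r : R) : open [set y | mdist x y < r].
Proof.
rewrite openE => y /= xy; apply: (@nbhs_mdist_in _ _ _ (r - mdist x y)).
  by rewrite subr_gt0.
by move=> z yz /=; rewrite (le_lt_trans (metric_triangle _ y _))// -ltrBrDl.
Qed.

Lemma measurable_open (U : set Y) : open U -> measurable (U : set (borel Y)).
Proof. by move=> oU; exact: sub_sigma_algebra. Qed.

Lemma measurable_mball (x : Y) (r : R) :
  measurable ([set y | mdist x y < r] : set (borel Y)).
Proof. exact: (measurable_open (open_mball x r)). Qed.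

Lemma mbounded_mball (x : Y) (r : R) : mbounded [set y | mdist x y < r].
Proof.
exists (r + r) => y z /= xy xz.
rewrite (le_trans (metric_triangle _ x _))// (metric_sym y).
by rewrite lerD// ltW.
Qed.

Lemma continuous_measurable (f : Y -> R) : continuous f ->
  measurable_fun setT (f : borel Y -> R).
Proof.
move=> /continuousP cf; apply: (measurability _ (RGenOpens.measurableE R)).
move=> _ [_ [a [b ->] <-]]; rewrite setTI; apply: measurable_open.
exact/cf/interval_open.
Qed.

Context (sepY : separable Y).

Lemma dense_seq : exists d : nat -> Y, dense (range d).
Proof.
have [D cD dD] := sepY.
have [f finj] := countable_injP D cD.
pose d n := get [set y | D y /\ f y = n].
exists d => O O0 oO; have [y [Oy Dy]] := dD O O0 oO.
exists y; split => //; exists (f y) => //.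
have [Dd fd] : [set z | D z /\ f z = f y] (d (f y)).
  by apply: getPex; exists y.
by apply: finj; rewrite ?inE.
Qed.

(** The balls centered on a dense sequence, with radii [1 / k], which fit in one
    of the given balls are countably many, and they cover the space. *)
Lemma lindelof (P : Y -> R -> Prop) : (forall x, exists2 r, 0 < r & P x r) ->
  exists (xs : nat -> Y) (rs : nat -> R), (forall i, P (xs i) (rs i)) /\
    forall x, exists i, mdist (xs i) x < rs i.
Proof.
move=> HP; have [d dd] := dense_seq.
have HP' x : exists r : R, 0 < r /\ P x r by have [r] := HP x; exists r.
have [r Hr] := boolp.choice HP'.
pose B (nk : nat * nat) : set Y := [set y | mdist (d nk.1) y < nk.2.+1%:R^-1].
pose C (nk : nat * nat) := [set x | B nk `<=` [set y | mdist x y < r x]].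
pose xs i : Y := get (C (odflt (0, 0)%N (unpickle i))).
exists xs, (r \o xs); split; first by move=> i; exact: (Hr (xs i)).2.
move=> x; have r20 : 0 < r x / 2 by rewrite divr_gt0// (Hr x).1.
have [k kr] : exists k : nat, k.+1%:R^-1 < r x / 2.
  near \oo => k; exists k; near: k.
  exact: (near_infty_natSinv_lt (PosNum r20)).
have k0 : 0 < k.+1%:R^-1 :> R by rewrite invr_gt0.
have [_ [n _ <-]] := dense_mdist x dd k0; rewrite metric_sym => dx.
have Cx : C (n, k) x.
  move=> y /= dy; rewrite (le_lt_trans (metric_triangle _ (d n) _))//.
  by rewrite [ltRHS]splitr ltrD// (lt_trans _ kr)// metric_sym.
have := @getPex _ (C (n, k)) (ex_intro _ x Cx).
exists (pickle (n, k)); rewrite /= /xs pickleK /=.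
by apply: H.
Unshelve. all: by end_near. Qed.

End borel_metric.

Section almost_everywhere_facts.
Context {d : measure_display} {T : measurableType d} {R : realType}.
Context (mu : {measure set T -> \bar R}).

Lemma ae_cover (B : nat -> set T) (P : T -> Prop) :
  (forall x, exists i, B i x) ->
  (forall i, {ae mu, forall x, B i x -> P x}) -> {ae mu, forall x, P x}.
Proof.
move=> cov H; have := ae_foralln H; apply: filterS => x Hx.
by have [i Bx] := cov x; exact: (Hx i).
Qed.

Lemma measurable_fun_cover (B : nat -> set T) (f : T -> R) :
  (forall x, exists i, B i x) -> (forall i, measurable (B i)) ->
  (forall i, measurable_fun (B i) f) -> measurable_fun setT f.
Proof.
move=> cov mB mf; have -> : setT = \bigcup_i B i.
  by apply/seteqP; split => // x _; have [i Bx] := cov x; exists i.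
exact/measurable_fun_bigcup.
Qed.

(** An integral of a real-valued function that is finite forces integrability,
    as [+oo - +oo = -oo]. *)
Lemma integrable_of_fin_num (f : T -> R) : measurable_fun setT f ->
  (\int[mu]_x (f x)%:E)%E \is a fin_num -> mu.-integrable setT (EFin \o f).
Proof.
move=> mf ffin; apply/integrableP; split; first exact/measurable_EFinP.
by rewrite -[X in (X < _)%E]/(\int[mu]_(x in setT) `|(f x)%:E|)%E integral_fin_num_abs.
Qed.

Lemma integrable_boundedM (f g : T -> R) (M : R) : measurable_fun setT f ->
  (forall x, `|f x| <= M) -> mu.-integrable setT (EFin \o g) ->
  mu.-integrable setT (EFin \o (fun x => f x * g x)).
Proof.
move=> mf fM ig; have mg := measurable_int mu ig.
apply: (@le_integrable _ _ _ mu setT _ _ (fun x => (M * g x)%:E)) => //.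
- by apply/measurable_EFinP; apply: measurable_funM => //; apply/measurable_EFinP.
- move=> x _ /=; rewrite lee_fin !normrM ler_wpM2r//.
  by rewrite (le_trans (fM x))// ler_norm.
- by under eq_fun do rewrite EFinM; exact: integrableZl.
Qed.

Lemma Rintegral_ae_eq (f g : T -> R) : measurable_fun setT f ->
  measurable_fun setT g -> {ae mu, forall x, f x = g x} ->
  (\int[mu]_x f x)%R = (\int[mu]_x g x)%R.
Proof.
move=> mf mg fg; congr fine; apply: ae_eq_integral => //.
- exact/measurable_EFinP.
- exact/measurable_EFinP.
by apply: filterS fg => x /= ->.
Qed.

Lemma integrable_ae_eq (f g : T -> R) : measurable_fun setT f ->
  measurable_fun setT g -> {ae mu, forall x, f x = g x} ->
  mu.-integrable setT (EFin \o f) -> mu.-integrable setT (EFin \o g).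
Proof.
move=> mf mg fg /integrableP[_ fi]; apply/integrableP; split.
  exact/measurable_EFinP.
rewrite (le_lt_trans _ fi)// le_eqVlt; apply/orP; left; apply/eqP.
apply: ae_eq_integral => //.
- by apply: measurableT_comp => //; exact/measurable_EFinP.
- by apply: measurableT_comp => //; exact/measurable_EFinP.
by apply: filterS fg => x /= ->.
Qed.

Lemma Rintegral_cvg (f_ : nat -> T -> R) (f g : T -> R) :
  (forall n, measurable_fun setT (f_ n)) -> measurable_fun setT f ->
  {ae mu, forall x, f_ n x @[n --> \oo] --> f x} ->
  mu.-integrable setT (EFin \o g) ->
  {ae mu, forall x, forall n, `|f_ n x| <= g x} ->
  (\int[mu]_x f_ n x)%R @[n --> \oo] --> (\int[mu]_x f x)%R.
Proof.
move=> mf_ mf ff ig fg.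
have mE h : measurable_fun setT h -> measurable_fun setT (EFin \o h : T -> \bar R).
  by move=> mh; exact/measurable_EFinP.
have ff' : {ae mu, forall x, setT x -> (f_ n x)%:E @[n --> \oo] --> (f x)%:E}.
  apply: filterS ff => x h _; apply: cvg_EFin => //; exact: nearW.
have fg' : {ae mu, forall x, forall n, setT x -> (`|(f_ n x)%:E| <= (g x)%:E)%E}.
  by apply: filterS fg => x h n _; rewrite lee_fin; exact: h.
have [fi _ H] := dominated_convergence measurableT (fun n => mE _ (mf_ n))
  (mE _ mf) ff' ig fg'.
apply: (@fine_cvg R).
rewrite fineK//; exact: (integrable_fin_num measurableT fi).
Qed.

End almost_everywhere_facts.

Section lipschitz_dense.
Context {R : realType} {Y : completeMetricType R}.
Implicit Types f g : Y -> R.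

Lemma lipschitz_cont f : is_lipschitz f -> continuous f.
Proof. by move=> [L fL]; exact: (lipschitz_continuous fL). Qed.

Lemma lipschitz_measurable f : is_lipschitz f ->
  measurable_fun setT (f : borel Y -> R).
Proof. by move=> /lipschitz_cont/continuous_measurable. Qed.

Lemma lipschitz_ge0 f : is_lipschitz f ->
  exists2 L : R, 0 <= L & forall y z, `|f y - f z| <= L * mdist y z.
Proof.
move=> [L fL]; exists `|L| => // y z.
by rewrite (le_trans (fL y z))// ler_wpM2r ?mdist_ge0// ler_norm.
Qed.

Lemma lipschitz_cst (c : R) : is_lipschitz (fun _ : Y => c).
Proof. by exists 0 => y z; rewrite subrr normr0 mul0r. Qed.

Lemma lipschitz_lin (a : R) f g : is_lipschitz f -> is_lipschitz g ->
  is_lipschitz (fun y => a * f y + g y).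
Proof.
move=> [L fL] [K gK]; exists (`|a| * L + K) => y z.
have -> : a * f y + g y - (a * f z + g z) = a * (f y - f z) + (g y - g z) by ring.
rewrite (le_trans (ler_normD _ _))// mulrDl lerD// normrM -mulrA.
by rewrite ler_wpM2l.
Qed.

Lemma lipschitz_max f g : is_lipschitz f -> is_lipschitz g ->
  is_lipschitz (fun y => Num.max (f y) (g y)).
Proof.
move=> /lipschitz_ge0[L L0 fL] /lipschitz_ge0[K K0 gK]; exists (L + K) => y z.
have d0 := mdist_ge0 y z; have := fL y z; have := gK y z.
have h1 : 0 <= L * mdist y z by rewrite mulr_ge0.
have h2 : 0 <= K * mdist y z by rewrite mulr_ge0.
rewrite mulrDl; move: h1 h2; move: (L * _) (K * _) => l k l0 k0.
rewrite !ler_norml => /andP[h1 h2] /andP[h3 h4].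
rewrite /Num.max; case: ltP => h5; case: ltP => h6; apply/andP; split; lra.
Qed.

Lemma lipschitz_mdist (y : Y) : is_lipschitz (mdist y).
Proof.
by exists 1 => z w; rewrite mul1r !(metric_sym y) mdist_lip.
Qed.

Definition plateau (U : set Y) (n : nat) (x : Y) : R :=
  Num.min 1 (n%:R * inf [set mdist x z | z in ~` U]).

Section plateau_facts.
Context (U : set Y) (U0 : ~` U !=set0).
Let dU x := inf [set mdist x z | z in ~` U].

Let dU_le x z : (~` U) z -> dU x <= mdist x z.
Proof.
move=> Uz; apply: ge_inf; last by exists z.
by exists 0 => _ [w _ <-]; exact: mdist_ge0.
Qed.

Let dU_ge x (a : R) : (forall z, (~` U) z -> a <= mdist x z) -> a <= dU x.
Proof.
move=> H; apply: lb_le_inf; first by have [z Uz] := U0; exists (mdist x z); exists z.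
by move=> _ [z Uz <-]; exact: H.
Qed.

Let dU_ge0 x : 0 <= dU x. Proof. by apply: dU_ge => z _; exact: mdist_ge0. Qed.

Let dU_lip x y : dU x <= dU y + mdist x y.
Proof.
rewrite -lerBlDr; apply: dU_ge => z Uz; rewrite lerBlDr.
by rewrite (le_trans (dU_le x Uz))// addrC metric_triangle.
Qed.

Lemma plateau01 n x : 0 <= plateau U n x <= 1.
Proof. by rewrite le_min ler01 mulr_ge0 ?dU_ge0//= ge_min lexx. Qed.

Lemma plateau_lipschitz n : is_lipschitz (plateau U n).
Proof.
exists n%:R => x y; rewrite /plateau -/(dU x) -/(dU y).
have h1 : n%:R * dU x <= n%:R * dU y + n%:R * mdist x y.
  by rewrite -mulrDr ler_wpM2l.
have h2 : n%:R * dU y <= n%:R * dU x + n%:R * mdist x y.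
  by rewrite -mulrDr ler_wpM2l// (metric_sym x).
have h3 : 0 <= n%:R * mdist x y by rewrite mulr_ge0// mdist_ge0.
move: h1 h2 h3; move: (n%:R * dU x) (n%:R * dU y) (n%:R * mdist x y) => a b c h1 h2 h3.
rewrite ler_norml /Num.min; case: ltP => h5; case: ltP => h6; apply/andP; split; lra.
Qed.

Lemma plateau_cvg x : open U -> plateau U n x @[n --> \oo] --> (\1_U x : R).
Proof.
move=> oU; have [Ux|Ux] := pselect (U x); last first.
  have d0 : dU x = 0.
    by apply/eqP; rewrite eq_le dU_ge0 andbT -(mdistxx x); exact: dU_le.
  rewrite indicE memNset// /plateau -/(dU x) d0.
  by under eq_fun do rewrite mulr0 (min_r ler01); exact: cvg_cst.
have [r r0 rU] : exists2 r : R, 0 < r & forall y, mdist x y < r -> U y.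
  by apply: nbhs_mdist_ex; exact: open_nbhs_nbhs.
have dr : r <= dU x.
  by apply: dU_ge => z Uz; rewrite leNgt; apply/negP => /rU.
rewrite indicE mem_set//; apply: (@cvg_trans _ ((fun=> 1 : R) @ \oo)).
  apply: near_eq_cvg; near=> n; rewrite /plateau -/(dU x); apply/esym/min_l.
  have : r^-1 <= n%:R by near: n; exact: nbhs_infty_ger.
  rewrite -[r^-1]mul1r ler_pdivrMr// => h.
  by rewrite (le_trans h)// ler_wpM2l.
exact: cvg_cst.
Unshelve. all: by end_near. Qed.

End plateau_facts.

Context (mu : {measure set (borel Y) -> \bar R}) (k : borel Y -> R).
Context (ik : mu.-integrable setT (EFin \o k)).

Let mk : measurable_fun setT k.
Proof. by apply/measurable_EFinP; exact: (measurable_int mu ik). Qed.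

Let mkn : measurable_fun setT (fun x : borel Y => `|k x|).
Proof. exact: measurableT_comp. Qed.

Let L1approx (A : set (borel Y)) := measurable A /\ forall e : R, 0 < e ->
  exists psi : Y -> R, [/\ is_lipschitz psi, forall x, 0 <= psi x <= 1 &
    \int[mu]_x (`|psi x - \1_A x| * `|k x|) < e].

Let ikn : mu.-integrable setT (EFin \o (fun x => `|k x|)).
Proof. exact: (integrable_norm ik). Qed.

Let int_bd (f : borel Y -> R) (M : R) : measurable_fun setT f ->
  (forall x, `|f x| <= M) ->
  mu.-integrable setT (EFin \o (fun x => `|f x| * `|k x|)).
Proof.
move=> mf fM; apply: (integrable_boundedM (M := M)) => //.
- exact: measurableT_comp.
- by move=> x; rewrite normr_id.
Qed.

Let bd01 (a b : R) : 0 <= a <= 1 -> 0 <= b <= 1 -> `|a - b| <= 1.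
Proof. by move=> /andP[? ?] /andP[? ?]; rewrite ler_norml; apply/andP; split; lra. Qed.

Let ind01 (A : set (borel Y)) x : 0 <= (\1_A x : R) <= 1.
Proof. by rewrite indicE; case: (_ \in _); rewrite /= ?lexx ?ler01. Qed.

Let mind (A : set (borel Y)) : measurable A ->
  measurable_fun setT (\1_A : borel Y -> R).
Proof. by move=> mA; exact: measurable_indic. Qed.

Let int_dom (f g h : borel Y -> R) : measurable_fun setT f -> measurable_fun setT g ->
  measurable_fun setT h -> (forall x, `|f x| <= 1) -> (forall x, `|g x| <= 1) ->
  (forall x, `|h x| <= 1) -> (forall x, `|f x| <= `|g x| + `|h x|) ->
  \int[mu]_x (`|f x| * `|k x|) <=
  \int[mu]_x (`|g x| * `|k x|) + \int[mu]_x (`|h x| * `|k x|).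
Proof.
move=> mf mg mh f1 g1 h1 fgh.
have If := int_bd mf f1; have Ig := int_bd mg g1; have Ih := int_bd mh h1.
rewrite -RintegralD//; apply: le_Rintegral => //.
- have -> : EFin \o (fun x => `|g x| * `|k x| + `|h x| * `|k x|) =
      ((EFin \o (fun x => `|g x| * `|k x|)%R) \+ (EFin \o (fun x => `|h x| * `|k x|)%R))%E.
    by apply/funext => x; rewrite /= EFinD.
  exact: integrableD.
- by move=> x _; rewrite -mulrDl ler_wpM2r.
Qed.

Let approxU A B : L1approx A -> L1approx B -> L1approx (A `|` B).
Proof.
move=> [mA HA] [mB HB]; split; first exact: measurableU.
move=> e e0; have e20 : 0 < e / 2 by rewrite divr_gt0.
have [f [lf f01 fA]] := HA _ e20; have [g [lg g01 gB]] := HB _ e20.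
have max01 x : 0 <= Num.max (f x) (g x) <= 1.
  have /andP[? ?] := f01 x; have /andP[? ?] := g01 x.
  by rewrite le_max ge_max; apply/andP; split; [apply/orP; left|apply/andP; split].
exists (fun y => Num.max (f y) (g y)); split => //; first exact: lipschitz_max.
have mf := lipschitz_measurable lf; have mg := lipschitz_measurable lg.
have mm := lipschitz_measurable (lipschitz_max lf lg).
apply: (@le_lt_trans _ _ (\int[mu]_x (`|f x - \1_A x| * `|k x|)
  + \int[mu]_x (`|g x - \1_B x| * `|k x|))); last by rewrite [ltRHS]splitr ltrD.
apply: (int_dom (f := fun x => Num.max (f x) (g x) - \1_(A `|` B) x)
  (g := fun x => f x - \1_A x) (h := fun x => g x - \1_B x)).
- by apply: measurable_funB => //; apply: mind; exact: measurableU.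
- by apply: measurable_funB => //; exact: mind.
- by apply: measurable_funB => //; exact: mind.
- by move=> x; exact: bd01.
- by move=> x; exact: bd01.
- by move=> x; exact: bd01.
move=> x; have := f01 x; have := g01 x.
rewrite !indicE in_setU; move: (f x) (g x) => a b.
case: (x \in A); case: (x \in B) => /= /andP[b0 b1] /andP[a0 a1];
  rewrite ?subr0 ?(distrC _ 1);
  rewrite /Num.max; case: ltP => ab;
  rewrite !ger0_norm ?subr_ge0//; lra.
Qed.

Let approx_bigcup F : (forall n : nat, L1approx (F n)) ->
  L1approx (\bigcup_n F n).
Proof.
move=> HF; split; first by apply: bigcupT_measurable => n; have [] := HF n.
move=> e e0; have e20 : 0 < e / 2 by rewrite divr_gt0.
pose B n := \big[setU/set0]_(i < n) F i.
have HB n : L1approx (B n).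
  rewrite /B; elim: n => [|n IH]; last by rewrite big_ord_recr; exact: approxU.
  rewrite big_ord0; split; first exact: measurable0.
  move=> e' e'0; exists (fun=> 0); split; first exact: lipschitz_cst.
    by move=> x; rewrite lexx ler01.
  under eq_Rintegral do rewrite indic0 subrr normr0 mul0r.
  by rewrite Rintegral_cst// mul0r.
have mB n : measurable (B n) by have [] := HB n.
have mU : measurable (\bigcup_n F n).
  by apply: bigcupT_measurable => n; have [] := HF n.
have cB : \int[mu]_x (`|\1_(B n) x - \1_(\bigcup_n F n) x| * `|k x|)
    @[n --> \oo] --> \int[mu]_x 0%R.
  apply: (Rintegral_cvg (g := fun x => `|k x|)) => //.
  - move=> n; apply: measurable_funM; last exact: mkn.
    apply: measurableT_comp => //.
    by apply: measurable_funB; exact: mind.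
  - apply: aeW => x; apply: (@cvg_trans _ ((fun=> 0 : R) @ \oo)); last exact: cvg_cst.
    apply: near_eq_cvg; have [[i _ Fx]|Fx] := pselect ((\bigcup_n F n) x).
      exists i.+1 => // n /= hn.
      rewrite !indicE !mem_set ?subrr ?normr0 ?mul0r//; first by exists i.
      by rewrite /B -bigcup_mkord; exists i.
    near=> n; rewrite !indicE !memNset ?subrr ?normr0 ?mul0r//.
    by rewrite /B -bigcup_mkord => -[i _ Fi]; apply: Fx; exists i.
  - apply: aeW => x n; rewrite normrM !normr_id ler_piMl//; exact: bd01.
rewrite Rintegral_cst// mul0r in cB.
have /cvgrPdist_lt/(_ _ e20)[n _ /(_ n (leqnn n))] := cB.
rewrite sub0r normrN => /(le_lt_trans (ler_norm _)) hn.
have [psi [lpsi psi01 psiB]] := (HB n).2 _ e20.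
exists psi; split => //.
apply: (@le_lt_trans _ _ (\int[mu]_x (`|psi x - \1_(B n) x| * `|k x|)
  + \int[mu]_x (`|\1_(B n) x - \1_(\bigcup_n F n) x| * `|k x|))).
  have mpsi := lipschitz_measurable lpsi.
  apply: (int_dom (f := fun x => psi x - \1_(\bigcup_n F n) x)
    (g := fun x => psi x - \1_(B n) x)
    (h := fun x => \1_(B n) x - \1_(\bigcup_n F n) x)).
  - by apply: measurable_funB => //; exact: mind.
  - by apply: measurable_funB => //; exact: mind.
  - by apply: measurable_funB => //; exact: mind.
  - by move=> x; exact: bd01.
  - by move=> x; exact: bd01.
  - by move=> x; exact: bd01.
  - by move=> x; exact: ler_distD.
by rewrite [ltRHS]splitr ltrD.
Unshelve. all: by end_near. Qed.

Let approxC A : L1approx A -> L1approx (setT `\` A).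
Proof.
move=> [mA HA]; rewrite setTD; split; first exact: measurableC.
move=> e e0; have [psi [lpsi psi01 psiA]] := HA e e0.
exists (fun y => -1 * psi y + 1); split.
- by apply: lipschitz_lin => //; exact: lipschitz_cst.
- by move=> x; have := psi01 x; lra.
- apply: le_lt_trans psiA; rewrite le_eqVlt; apply/orP; left; apply/eqP.
  apply: eq_Rintegral => x _.
  have -> : -1 * psi x + 1 - \1_(~` A) x = - (psi x - \1_A x).
    by rewrite !indicE in_setC; case: (_ \in _) => /=; lra.
  by rewrite normrN.
Qed.

Let approx_open (U : set Y) : open U -> L1approx (U : set (borel Y)).
Proof.
move=> oU; have mU := measurable_open oU; split => // e e0.
have [U0|U0] := pselect (~` U !=set0); last first.
  exists (fun=> 1); split; first exact: lipschitz_cst.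
    by move=> x; rewrite lexx ler01.
  under eq_Rintegral => x _.
    rewrite indicE mem_set; last first.
      by apply: contrapT => Ux; apply: U0; exists x.
    rewrite subrr normr0 mul0r; over.
  by rewrite Rintegral_cst// mul0r.
have cU : \int[mu]_x (`|plateau U n x - \1_U x| * `|k x|)
    @[n --> \oo] --> \int[mu]_x 0%R.
  apply: (Rintegral_cvg (g := fun x => `|k x|)) => //.
  - move=> n; apply: measurable_funM; last exact: mkn.
    apply: measurableT_comp => //.
    apply: measurable_funB; last exact: mind.
    by apply: lipschitz_measurable; apply: plateau_lipschitz.
  - apply: aeW => x; rewrite -(mul0r `|k x|); apply: cvgM; last exact: cvg_cst.
    rewrite -(normr0 R) -(subrr (\1_U x : R)); apply: cvg_norm.
    by apply: cvgB; [exact: plateau_cvg|exact: cvg_cst].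
  - apply: aeW => x n; rewrite normrM !normr_id ler_piMl//.
    by apply: bd01; [exact: plateau01|exact: ind01].
rewrite Rintegral_cst// mul0r in cU.
have /cvgrPdist_lt/(_ _ e0)[n _ /(_ n (leqnn n))] := cU.
rewrite sub0r normrN => /(le_lt_trans (ler_norm _)) hn.
exists (plateau U n); split => //; first exact: plateau_lipschitz.
by move=> x; exact: plateau01.
Qed.

Let L1approx_measurable (A : set (borel Y)) : measurable A -> L1approx A.
Proof.
suff : (measurable : set (set (borel Y))) `<=` L1approx by apply.
apply: smallest_sub; last by move=> U; exact: approx_open.
split; first by have := approx_open open0.
- exact: approxC.
- exact: approx_bigcup.
Qed.

(** Lipschitz functions approximate the indicator of [k < 0] in
    [L^1(|k| mu)], since the sets whose indicators they approximate form a
    sigma-algebra containing the open sets. *)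
Lemma ae_ge0_of_lipschitz :
  (forall psi : Y -> R, is_lipschitz psi -> (forall x, 0 <= psi x <= 1) ->
    0 <= \int[mu]_x (psi x * k x)) ->
  {ae mu, forall x, 0 <= k x}.
Proof.
move=> H; pose N : set (borel Y) := [set x | k x < 0].
have mN : measurable N.
  rewrite /N -[X in measurable X]setTI.
  have -> : setT `&` [set x | k x < 0] = setT `&` k @^-1` `]-oo, 0[.
    by apply/seteqP; split => x /=; rewrite in_itv.
  exact: mk.
have m1 := mind mN.
have If (f : borel Y -> R) (M : R) : measurable_fun setT f -> (forall x, `|f x| <= M) ->
    mu.-integrable setT (EFin \o (fun x => f x * k x)).
  by move=> mf fM; exact: (integrable_boundedM mf fM).
have n1 (a : R) : 0 <= a <= 1 -> `|a| <= 1 by move=> /andP[a0]; rewrite ger0_norm.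
have IN := If _ 1 m1 (fun x => n1 _ (ind01 N x)).
have le0 : \int[mu]_x `|\1_N x * k x| <= 0.
  apply/ler_addgt0Pl => e e0; rewrite addr0.
  have [psi [lpsi psi01 psiN]] := (L1approx_measurable mN).2 e e0.
  have := H psi lpsi psi01.
  have mpsi := lipschitz_measurable lpsi.
  have md : measurable_fun setT (fun x : borel Y => psi x - \1_N x).
    exact: measurable_funB.
  have bd x : `|psi x - \1_N x| <= 1 by exact: bd01.
  have Id := If _ 1 md bd.
  have -> : \int[mu]_x (psi x * k x) = \int[mu]_x ((psi x - \1_N x) * k x)
      + \int[mu]_x (\1_N x * k x).
    rewrite -RintegralD//; apply: eq_Rintegral => x _; ring.
  have -> : \int[mu]_x `|\1_N x * k x| = - \int[mu]_x (\1_N x * k x).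
    rewrite -mulN1r -RintegralZl//; apply: eq_Rintegral => x _.
    rewrite indicE; case: (boolP (x \in N)) => [|_]; last by rewrite !mul0r normr0 mulr0.
    by rewrite inE => /ltW kx; rewrite mul1r ler0_norm// mulN1r.
  have : \int[mu]_x ((psi x - \1_N x) * k x) <= \int[mu]_x (`|psi x - \1_N x| * `|k x|).
    apply: le_Rintegral => //; first exact: (int_bd md bd).
    by move=> x _; rewrite -normrM ler_norm.
  lra.
have eq0 : (\int[mu]_x `|(\1_N x * k x)%:E| = 0)%E.
  have fin : (\int[mu]_x `|(\1_N x * k x)%:E|)%E \is a fin_num.
    exact: (integrable_fin_num measurableT (integrable_norm IN)).
  rewrite -(fineK fin); congr EFin; apply/eqP; rewrite eq_le le0/=.
  by apply: fine_ge0; apply: integral_ge0.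
have /(ae_eq_integral_abs mu measurableT) := eq0.
move=> /(_ (measurable_int mu IN)); apply: filterS => x /(_ I)/= [].
rewrite leNgt => h; apply/negP => kx.
by move: h; rewrite indicE mem_set// mul1r => h; rewrite h ltxx in kx.
Qed.

End lipschitz_dense.

(** * Calculus of derivations *)

Section test_functions.
Context {R : realType} {Y : completeMetricType R}.
Implicit Types f g w : Y -> R.

Lemma LIPb_bound f : LIPb f -> exists2 M : R, 0 <= M & forall x, `|f x| <= M.
Proof.
move=> [_ [M fM]]; exists `|M| => // x.
by rewrite (le_trans (fM x))// ler_norm.
Qed.

Lemma LIPb_measurable f : LIPb f -> measurable_fun setT (f : borel Y -> R).
Proof. by move=> [/lipschitz_measurable]. Qed.

Lemma LIPb_cst (c : R) : LIPb (fun _ : Y => c).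
Proof. by split; [exact: lipschitz_cst|exists `|c|]. Qed.

Lemma LIPb_lin (a : R) f g : LIPb f -> LIPb g -> LIPb (fun y => a * f y + g y).
Proof.
move=> [lf [M fM]] [lg [N gN]]; split; first exact: lipschitz_lin.
exists (`|a| * M + N) => x; rewrite (le_trans (ler_normD _ _))// lerD//.
by rewrite normrM ler_wpM2l.
Qed.

Lemma LIPb_mul f g : LIPb f -> LIPb g -> LIPb (fun y => f y * g y).
Proof.
move=> Lf Lg; have [M M0 fM] := LIPb_bound Lf; have [N N0 gN] := LIPb_bound Lg.
have [/lipschitz_ge0[L L0 fL] _] := Lf; have [/lipschitz_ge0[K K0 gK] _] := Lg.
split; last by exists (M * N) => x; rewrite normrM ler_pM.
exists (M * K + N * L) => y z.
have -> : f y * g y - f z * g z = f y * (g y - g z) + g z * (f y - f z) by ring.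
rewrite (le_trans (ler_normD _ _))// !normrM mulrDl -!mulrA.
by rewrite lerD// ler_pM.
Qed.

Lemma LIPb_min f g : LIPb f -> LIPb g -> LIPb (fun y => Num.min (f y) (g y)).
Proof.
move=> Lf Lg.
have -> : (fun y => Num.min (f y) (g y)) =
    (fun y => -1 * Num.max (-1 * f y + 0) (-1 * g y + 0) + 0).
  apply/funext => y; rewrite /Num.min /Num.max !addr0 !mulN1r ltrN2.
  by case: ltP => h; rewrite ?opprK//; case: ltP => // h'; lra.
apply: LIPb_lin; last exact: LIPb_cst.
have [M M0 fM] := LIPb_bound Lf; have [N N0 gN] := LIPb_bound Lg.
split.
  apply: lipschitz_max; apply: lipschitz_lin; try exact: lipschitz_cst.
    by case: Lf.
  by case: Lg.
exists (M + N) => x; have := fM x; have := gN x.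
rewrite !ler_norml => /andP[? ?] /andP[? ?].
by rewrite /Num.max; case: ltP => _; apply/andP; split; lra.
Qed.

(** Truncation brings the distance from [y] into the domain of derivations. *)
Definition tdist (y : Y) (M : R) (x : Y) : R := Num.min (mdist y x) M.

Lemma tdist_eq y M x : mdist y x <= M -> tdist y M x = mdist y x.
Proof. exact: min_l. Qed.

Lemma tdist_lip1 y M x z : `|tdist y M x - tdist y M z| <= mdist x z.
Proof.
have := mdist_lip x z y; rewrite !(metric_sym _ y).
have := mdist_ge0 x z; rewrite /tdist; move: (mdist _ _) (mdist y x) (mdist y z) => d a c d0.
rewrite !ler_norml => /andP[h1 h2].
by rewrite /Num.min; case: ltP => h3; case: ltP => h4; apply/andP; split; lra.
Qed.

Lemma LIPb_tdist y M : LIPb (tdist y M).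
Proof.
split; first by exists 1 => x z; rewrite mul1r tdist_lip1.
exists `|M| => x; have := mdist_ge0 y x; rewrite /tdist /Num.min; case: ltP => h d0.
  by rewrite ger0_norm// (le_trans (ltW h))// ler_norm.
by [].
Qed.

Lemma Lip_ge0 f (A : set Y) : 0 <= Lip f A.
Proof.
rewrite /Lip; set E := [set L | _].
have [E0|/set0P/negP/negPn/eqP ->] := pselect (E !=set0); last by rewrite inf0.
by apply: lb_le_inf => // L [].
Qed.

Lemma Lip_le f (A : set Y) (L : R) : 0 <= L ->
  (forall y z, A y -> A z -> `|f y - f z| <= L * mdist y z) -> Lip f A <= L.
Proof.
move=> L0 fL; apply: ge_inf; last by split.
by exists 0 => K [].
Qed.

Lemma LIPb_Lip1 f : LIPb f -> Lip f setT <= 1 ->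
  forall x z, `|f x - f z| <= mdist x z.
Proof.
move=> [/lipschitz_ge0[L L0 fL] _] f1 x z.
have d0 := mdist_ge0 x z.
apply/ler_addgt0Pl => e e0.
have p0 : 0 < e / (mdist x z + 1) by rewrite divr_gt0// ltr_wpDl.
have [|K [K0 fK] K1] := @inf_adherent _ [set L : R | 0 <= L /\
    forall y z, setT y -> setT z -> `|f y - f z| <= L * mdist y z] _ p0.
  by split; [exists L; split => // *; exact: fL|exists 0 => K []].
rewrite (le_trans (fK x z I I))//.
have K2 : K <= 1 + e / (mdist x z + 1).
  by rewrite (le_trans (ltW K1))// lerD2r.
rewrite (le_trans (ler_wpM2r d0 K2))// mulrDl mul1r addrC lerD2r.
rewrite mulrAC ler_pdivrMr ?ltr_wpDl//.
by apply: ler_wpM2l; [exact: ltW|rewrite lerDl].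
Qed.

(** The locality of derivations comes from here, by their bound in terms of
    [lipa]. *)
Lemma lipa_eq0 f (U : set Y) x : open U -> (forall y, U y -> f y = 0) -> U x ->
  lipa f x = 0.
Proof.
move=> oU f0 Ux.
have [r r0 rU] : exists2 r : R, 0 < r & forall y, mdist x y < r -> U y.
  by apply: nbhs_mdist_ex; exact: open_nbhs_nbhs.
apply: cvg_lim => //; apply: (@cvg_trans _ ((fun=> 0 : R) @ (0 : R)^'+)); last exact: cvg_cst.
apply: near_eq_cvg; near=> s.
have sr : s < r by near: s; exact: nbhs_right_lt.
apply/esym/eqP; rewrite eq_le Lip_ge0 andbT; apply: Lip_le => // y z.
rewrite ballEmdist /= => xy xz; rewrite !f0 ?subrr ?normr0 ?mul0r//.
  by apply: rU; exact: lt_trans xz sr.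
by apply: rU; exact: lt_trans xy sr.
Unshelve. all: by end_near. Qed.

(** A derivation can be computed on [soft_abs e w], the square of which is a
    polynomial in [w], though not on the absolute value of [w] that it tends to
    with [e]. *)
Definition soft_abs (e : R) w (y : Y) : R := Num.sqrt (w y ^+ 2 + e).

Lemma soft_abs_gt0 (e : R) w y : 0 < e -> 0 < soft_abs e w y.
Proof. by move=> e0; rewrite sqrtr_gt0 ltr_wpDl// sqr_ge0. Qed.

Lemma soft_abs_sqr (e : R) w y : 0 < e -> soft_abs e w y ^+ 2 = w y ^+ 2 + e.
Proof. by move=> e0; rewrite sqr_sqrtr// addr_ge0 ?sqr_ge0// ltW. Qed.

Lemma soft_abs_ge (e : R) w y : 0 < e -> `|w y| <= soft_abs e w y.
Proof.
move=> e0; rewrite -(@ler_pXn2r _ 2) ?nnegrE ?normr_ge0 ?(ltW (soft_abs_gt0 _ _ e0))//.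
by rewrite soft_abs_sqr// real_normK ?num_real// lerDl ltW.
Qed.

Lemma soft_abs_le (e : R) w y : 0 < e <= 1 -> soft_abs e w y <= `|w y| + 1.
Proof.
move=> /andP[e0 e1].
rewrite -(@ler_pXn2r _ 2) ?nnegrE ?addr_ge0// ?(ltW (soft_abs_gt0 _ _ e0))//.
rewrite soft_abs_sqr// sqrrD real_normK ?num_real// expr1n mulr1.
have := normr_ge0 (w y); rewrite mulr2n; lra.
Qed.

Lemma LIPb_soft_abs (e : R) w : 0 < e <= 1 -> LIPb w -> LIPb (soft_abs e w).
Proof.
move=> e01 Lw; have /andP[e0 e1] := e01.
have [M M0 wM] := LIPb_bound Lw; have [[L wL] _] := Lw; split; last first.
  exists (M + 1) => x; rewrite ger0_norm ?(ltW (soft_abs_gt0 _ _ e0))//.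
  by rewrite (le_trans (soft_abs_le _ _ e01))// lerD2r.
exists L => y z; apply: le_trans (wL y z).
have sy := soft_abs_gt0 w y e0; have sz := soft_abs_gt0 w z e0.
have ay := soft_abs_ge w y e0; have az := soft_abs_ge w z e0.
rewrite -(@ler_pM2r _ (soft_abs e w y + soft_abs e w z)) ?addr_gt0//.
rewrite -{1}(gtr0_norm (addr_gt0 sy sz)) -normrM.
have -> : (soft_abs e w y - soft_abs e w z) * (soft_abs e w y + soft_abs e w z)
    = (w y - w z) * (w y + w z).
  by rewrite -!subr_sqr !soft_abs_sqr//; ring.
rewrite normrM ler_wpM2l// (le_trans (ler_normD _ _))//; exact: lerD.
Qed.

End test_functions.

(** Predicates on [Y] are predicates on [borel Y] only up to conversion, so that
    the filter structure has to be declared for them. *)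
#[global] Instance ae_borel_filter {R : realType} {Y : completeMetricType R}
  (mu : {measure set (borel Y) -> \bar R}) :
  @Filter Y (nbhs (almost_everywhere mu)).
Proof. exact (@ae_filter_ringOfSetsType _ (borel Y) R mu). Qed.

Section derivation.
Context {R : realType} {Y : completeMetricType R}.
Context {mu : {measure set (borel Y) -> \bar R}}.
Context {b : (Y -> R) -> (Y -> R)} (Db : is_derivation mu b).
Implicit Types f g w : Y -> R.

Lemma der_measurable f : LIPb f -> measurable_fun setT (b f : borel Y -> R).
Proof. by case: Db => H _ _ _; exact: H. Qed.

Lemma der_lin (a : R) f g : LIPb f -> LIPb g ->
  {ae mu, forall x, b (fun y => a * f y + g y) x = a * b f x + b g x}.
Proof. by case: Db => _ H _ _; exact: H. Qed.

Lemma der_mul f g : LIPb f -> LIPb g ->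
  {ae mu, forall x, b (fun y => f y * g y) x = f x * b g x + g x * b f x}.
Proof. by case: Db => _ _ H _; exact: H. Qed.

(** By the Leibniz rule for [1 = 1 * 1], the derivative of [1] is twice itself. *)
Lemma der_cst (c : R) : {ae mu, forall x, b (fun=> c) x = 0}.
Proof.
have L1 := LIPb_cst (1 : R) : LIPb (fun _ : Y => (1 : R)).
have := der_mul L1 L1; have := der_lin (c - 1) L1 L1.
have -> : (fun _ : Y => (c - 1) * 1 + 1) = (fun=> c) by apply/funext => y; ring.
have -> : (fun _ : Y => 1 * 1) = (fun=> 1 : R) by apply/funext => y; ring.
apply: filterS2 => x -> h; have -> : b (fun=> 1) x = 0 by lra.
by rewrite mulr0 addr0.
Qed.

Lemma der_local0 (U : set Y) f : open U -> LIPb f -> (forall y, U y -> f y = 0) ->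
  {ae mu, forall x, U x -> b f x = 0}.
Proof.
move=> oU Lf f0; have [_ _ _ [g _ /(_ f Lf)]] := Db.
apply: filterS => x bfx Ux.
move: bfx; rewrite (lipa_eq0 oU f0 Ux) mulr0 => ?.
by apply/eqP; rewrite -normr_le0.
Qed.

Lemma der_local (U : set Y) f g : open U -> LIPb f -> LIPb g ->
  (forall y, U y -> f y = g y) -> {ae mu, forall x, U x -> b f x = b g x}.
Proof.
move=> oU Lf Lg fg.
have := der_lin (-1) Lg Lf.
have : {ae mu, forall x, U x -> b (fun y => -1 * g y + f y) x = 0}.
  apply: der_local0 => //; first exact: LIPb_lin.
  by move=> y Uy; rewrite fg//; ring.
apply: filterS2 => x h1 h2 Ux; move: (h1 Ux); rewrite h2; lra.
Qed.

(** The Leibniz rule gives the chain rule for the square root. *)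
Lemma der_soft_abs (e : R) w : 0 < e <= 1 -> LIPb w ->
  {ae mu, forall x, soft_abs e w x * b (soft_abs e w) x = w x * b w x}.
Proof.
move=> e01 Lw; have Lu := LIPb_soft_abs e01 Lw; have /andP[e0 _] := e01.
move: (der_mul Lu Lu).
have -> : (fun y => soft_abs e w y * soft_abs e w y) =
    (fun y => 1 * (w y * w y) + e).
  by apply/funext => y; rewrite -expr2 soft_abs_sqr// mul1r expr2.
move=> h1; have h2 := der_lin 1 (LIPb_mul Lw Lw) (LIPb_cst e).
have h3 := der_mul Lw Lw; have h4 := der_cst e.
near=> x.
have : soft_abs e w x * b (soft_abs e w) x + soft_abs e w x * b (soft_abs e w) x
    = b (fun y => 1 * (w y * w y) + e) x by apply/esym; near: x.
have -> : b (fun y => 1 * (w y * w y) + e) x =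
  1 * b (fun y => w y * w y) x + b (fun=> e) x by near: x.
have -> : b (fun y => w y * w y) x = w x * b w x + w x * b w x by near: x.
have -> : b (fun=> e) x = 0 by near: x.
lra.
Unshelve. all: by end_near. Qed.

Definition soft_min (e : R) f g (y : Y) : R :=
  - 2^-1 * soft_abs e (fun y => -1 * g y + f y) y +
    (2^-1 * f y + (2^-1 * g y + 0)).

Lemma LIPb_soft_min (e : R) f g : 0 < e <= 1 -> LIPb f -> LIPb g ->
  LIPb (soft_min e f g).
Proof.
move=> e01 Lf Lg; do !(apply: LIPb_lin => //); last exact: LIPb_cst.
by apply: LIPb_soft_abs => //; exact: LIPb_lin.
Qed.

(** The derivative of [soft_min] is a convex combination of those of [f] and
    [g]. *)
Lemma der_soft_min (e : R) f g (U : set Y) (G : Y -> R) : 0 < e <= 1 ->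
  LIPb f -> LIPb g ->
  {ae mu, forall x, U x -> b f x <= G x} ->
  {ae mu, forall x, U x -> b g x <= G x} ->
  {ae mu, forall x, U x -> b (soft_min e f g) x <= G x}.
Proof.
move=> e01 Lf Lg fG gG; have /andP[e0 _] := e01.
pose w y := -1 * g y + f y.
have Lw : LIPb w by exact: LIPb_lin.
have Lu := LIPb_soft_abs e01 Lw.
have L0 : LIPb (fun _ : Y => (0 : R)) by exact: LIPb_cst.
have Lg0 := LIPb_lin 2^-1 Lg L0; have Lf0 := LIPb_lin 2^-1 Lf Lg0.
have h0 := der_cst 0; have h1 := der_lin 2^-1 Lg L0.
have h2 := der_lin 2^-1 Lf Lg0; have h3 := der_lin (- 2^-1) Lu Lf0.
have h4 := der_soft_abs e01 Lw; have h5 := der_lin (-1) Lg Lf.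
near=> x => Ux.
have e0' : b (fun=> 0) x = 0 by near: x.
have e1 : b (fun y => 2^-1 * g y + 0) x = 2^-1 * b g x + b (fun=> 0) x by near: x.
have e2 : b (fun y => 2^-1 * f y + (2^-1 * g y + 0)) x =
  2^-1 * b f x + b (fun y => 2^-1 * g y + 0) x by near: x.
have e3 : b (soft_min e f g) x = - 2^-1 * b (soft_abs e w) x +
  b (fun y => 2^-1 * f y + (2^-1 * g y + 0)) x by near: x.
have e4 : soft_abs e w x * b (soft_abs e w) x = w x * b w x by near: x.
have e5 : b w x = -1 * b g x + b f x by near: x.
have e6 : b f x <= G x by move: Ux; near: x.
have e7 : b g x <= G x by move: Ux; near: x.
rewrite e3 e2 e1 e0'.
have u0 := soft_abs_gt0 w x e0; have := soft_abs_ge w x e0.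
move: u0 e4 e5 e6 e7.
move: (soft_abs e w x) (b (soft_abs e w) x) (b w x) (w x) (b f x) (b g x) (G x).
move=> u bu bw w' p q g' u0 e4 e5 e6 e7 /ler_normlP[a1 a2].
rewrite -(ler_pM2l u0).
have h6 : (u - w') * (g' - p) >= 0 by rewrite mulr_ge0 ?subr_ge0.
have h7 : (u + w') * (g' - q) >= 0.
  by rewrite mulr_ge0 ?subr_ge0//; lra.
have : w' * bw = w' * p - w' * q by rewrite e5; ring.
lra.
Unshelve. all: by end_near. Qed.

End derivation.

(** * Integration by parts and upper bounds for derivatives *)

Section integration_by_parts.
Context {R : realType} {Y : completeMetricType R}.
Context {mu : {measure set (borel Y) -> \bar R}}.
Implicit Types f g h phi : Y -> R.

Definition zero_off (p : Y) (r : R) f := forall x, r <= mdist p x -> f x = 0.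

Lemma zero_off_mbounded p r f : zero_off p r f -> mbounded [set x | f x != 0].
Proof.
move=> f0; exists (r + r) => y z /= fy fz.
have lt_r x : f x != 0 -> mdist p x < r by case: ltP => // /f0 ->; rewrite eqxx.
rewrite (le_trans (metric_triangle _ p _))// (metric_sym y).
by rewrite lerD// ltW// lt_r.
Qed.

Lemma integrable_test f g p r : LIPb f -> zero_off p r f ->
  integrable_on_bounded mu g ->
  mu.-integrable setT (EFin \o (fun x => f x * g x)).
Proof.
move=> Lf f0 ig; have [M _ fM] := LIPb_bound Lf.
pose B : set (borel Y) := [set x | mdist p x < r].
have mB : measurable B by exact: measurable_mball.
have iB : mu.-integrable setT (EFin \o (g \_ B : borel Y -> R)).
  by rewrite -restrict_EFin; apply/(integrable_mkcond _ mB)/ig/mbounded_mball.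
have -> : (fun x => f x * g x) = (fun x => f x * (g \_ B) x).
  apply/funext => x; rewrite patchE; case: ifPn => //.
  by rewrite notin_setE /B /= => /negP; rewrite -leNgt => /f0 ->; rewrite !mul0r.
exact: (integrable_boundedM (LIPb_measurable Lf) fM iB).
Qed.

Lemma Rintegral_ae_ge0 f : measurable_fun setT (f : borel Y -> R) ->
  {ae mu, forall x, 0 <= f x} -> 0 <= \int[mu]_x f x.
Proof.
move=> mf f0; have -> : \int[mu]_x f x = \int[mu]_x `|f x|.
  apply: Rintegral_ae_eq => //; first exact: measurableT_comp.
  by apply: filterS f0 => x /ger0_norm.
exact: Rintegral_ge0.
Qed.

(** The divergence in a form that can be manipulated with real integrals, and
    which, unlike membership in [Der22], visibly passes to differences. *)
Definition has_div (b : (Y -> R) -> (Y -> R)) h : Prop :=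
  [/\ is_derivation mu b, integrable_on_bounded mu h
    & forall f p r, LIPb f -> zero_off p r f ->
      mu.-integrable setT (EFin \o (b f : borel Y -> R)) /\
      \int[mu]_x b f x = - \int[mu]_x (f x * h x)].

(** The finiteness of the integral of [f * h] forces [b f] to be integrable. *)
Lemma has_div_Der22 b : Der22 mu b -> exists h, has_div b h.
Proof.
move=> [Db _ [h [_ ih bh] _]]; exists h; split => // f p r Lf f0.
have := bh f Lf.1 (zero_off_mbounded f0).
have ifh := integrable_test Lf f0 ih.
have fin := integrable_fin_num measurableT ifh.
have mbf : measurable_fun setT (b f : borel Y -> R) := der_measurable Db Lf.
move=> E; split.
  by apply: integrable_of_fin_num => //; rewrite E fin_numN.
by rewrite /Rintegral E fineN.
Qed.

Section combination.
Context (b1 b2 b : (Y -> R) -> (Y -> R)) (c : R).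
Context (bE : forall f x, b f x = b1 f x + c * b2 f x).

Lemma is_derivation_comb :
  is_derivation mu b1 -> is_derivation mu b2 -> is_derivation mu b.
Proof.
move=> D1 D2; split.
- move=> f Lf; have -> : b f = (fun x => b1 f x + c * b2 f x) by exact/funext.
  apply: measurable_funD; first exact: (der_measurable D1).
  by apply: measurable_funM => //; exact: (der_measurable D2).
- move=> a f g Lf Lg; have := der_lin D1 a Lf Lg; have := der_lin D2 a Lf Lg.
  by apply: filterS2 => x h1 h2; rewrite !bE h1 h2; ring.
- move=> f g Lf Lg; have := der_mul D1 Lf Lg; have := der_mul D2 Lf Lg.
  by apply: filterS2 => x h1 h2; rewrite !bE h1 h2; ring.
- have [_ _ _ [g1 mg1 b1g]] := D1; have [_ _ _ [g2 mg2 b2g]] := D2.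
  exists (fun x => g1 x + `|c| * g2 x).
    by apply: measurable_funD => //; exact: measurable_funM.
  move=> f Lf; have := b1g f Lf; have := b2g f Lf; apply: filterS2 => x h2 h1.
  rewrite bE (le_trans (ler_normD _ _))// mulrDl lerD// normrM -mulrA.
  by rewrite ler_wpM2l.
Qed.

End combination.

Lemma has_div_sub b1 b2 h1 h2 : has_div b1 h1 -> has_div b2 h2 ->
  has_div (b1 - b2) (h1 - h2).
Proof.
move=> [D1 ih1 H1] [D2 ih2 H2].
have bE f x : (b1 - b2) f x = b1 f x + -1 * b2 f x.
  by rewrite mulN1r.
split; first exact: (is_derivation_comb bE).
- by move=> B mB bB; have := integrableB mB (ih1 B mB bB) (ih2 B mB bB).
- move=> f p r Lf f0; have [i1 e1] := H1 f p r Lf f0; have [i2 e2] := H2 f p r Lf f0.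
  have if1 := integrable_test Lf f0 ih1; have if2 := integrable_test Lf f0 ih2.
  split; first by have := integrableB measurableT i1 i2.
  have -> : \int[mu]_x (b1 - b2) f x = \int[mu]_x (b1 f x - b2 f x) by [].
  rewrite RintegralB// e1 e2.
  have -> : \int[mu]_x (f x * (h1 - h2) x) = \int[mu]_x (f x * h1 x - f x * h2 x).
    by apply: eq_Rintegral => x _; rewrite -mulrBr.
  by rewrite RintegralB//; lra.
Qed.

Context {b : (Y -> R) -> (Y -> R)} {h : Y -> R} (bh : has_div b h).

Let Db : is_derivation mu b. Proof. by case: bh. Qed.

(** The divergence of [b] applied to [phi * f] moves the derivative away from
    [f]. *)
Lemma der_parts phi f p r : LIPb phi -> zero_off p r phi -> LIPb f ->
  [/\ mu.-integrable setT (EFin \o (b phi : borel Y -> R)),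
      mu.-integrable setT (EFin \o (fun x : borel Y => phi x * b f x))
    & \int[mu]_x (phi x * b f x) =
      (- \int[mu]_x (f x * (phi x * h x))) - \int[mu]_x (f x * b phi x)].
Proof.
move=> Lphi phi0 Lf; have [_ ih H] := bh.
have [iphi _] := H phi p r Lphi phi0.
have Lp := LIPb_mul Lphi Lf.
have p0 : zero_off p r (fun x => phi x * f x) by move=> x /phi0 ->; rewrite mul0r.
have [ip Ep] := H _ p r Lp p0.
have mf := LIPb_measurable Lf; have [M _ fM] := LIPb_bound Lf.
have ifphi := integrable_boundedM mf fM iphi.
have mpb : measurable_fun setT (fun x : borel Y => phi x * b f x).
  by apply: measurable_funM; [exact: LIPb_measurable|exact: (der_measurable Db)].
pose q (x : borel Y) := b (fun x => phi x * f x) x - f x * b phi x.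
have iq : mu.-integrable setT (EFin \o q) by have := integrableB measurableT ip ifphi.
have mq : measurable_fun setT q by apply/measurable_EFinP; exact: (measurable_int mu iq).
have qE : {ae mu, forall x, q x = phi x * b f x}.
  have := der_mul Db Lphi Lf; apply: filterS => x; rewrite /q => ->; ring.
split => //; first exact: (integrable_ae_eq mq mpb qE).
rewrite -(Rintegral_ae_eq mq mpb qE) RintegralB// Ep; congr (- _ - _).
by apply: eq_Rintegral => x _; ring.
Qed.

(** Only the values of [f] enter the right hand side of [der_parts], and only on
    the support of [phi], off which [b phi] vanishes by locality. As locality
    concerns open sets, the sphere of radius [r] is avoided by a larger ball. *)
Lemma der_parts_cvg phi (f_ : nat -> Y -> R) f p (r rho M : R) :
  LIPb phi -> zero_off p r phi -> r < rho -> 0 <= M ->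
  (forall n, LIPb (f_ n)) -> LIPb f ->
  (forall n x, mdist p x < rho -> `|f_ n x| <= M) ->
  (forall x, mdist p x < rho -> f_ n x @[n --> \oo] --> f x) ->
  \int[mu]_x (phi x * b (f_ n) x) @[n --> \oo] --> \int[mu]_x (phi x * b f x).
Proof.
move=> Lphi phi0 rrho M0 Lf_ Lf f_M f_f.
have [_ ih _] := bh.
have [iphi _ ->] := der_parts Lphi phi0 Lf.
have En n : \int[mu]_x (phi x * b (f_ n) x) =
    (- \int[mu]_x (f_ n x * (phi x * h x))) - \int[mu]_x (f_ n x * b phi x).
  by have [_ _ ->] := der_parts Lphi phi0 (Lf_ n).
under eq_fun do rewrite En.
have ihphi := integrable_test Lphi phi0 ih.
have mE (g : borel Y -> R) : mu.-integrable setT (EFin \o g) -> measurable_fun setT g.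
  by move=> ig; apply/measurable_EFinP; exact: (measurable_int mu ig).
have dom (g : borel Y -> R) : mu.-integrable setT (EFin \o g) ->
    {ae mu, forall x, rho <= mdist p x -> g x = 0} ->
    \int[mu]_x (f_ n x * g x) @[n --> \oo] --> \int[mu]_x (f x * g x).
  move=> ig g0; have mg := mE _ ig.
  apply: (Rintegral_cvg (g := fun x => M * `|g x|)).
  - by move=> n; apply: measurable_funM => //; exact: LIPb_measurable.
  - by apply: measurable_funM => //; exact: LIPb_measurable.
  - apply: filterS g0 => x gx; have [/f_f fx|/gx ->] := ltP (mdist p x) rho.
      by apply: cvgM => //; exact: cvg_cst.
    by rewrite mulr0; under eq_fun do rewrite mulr0; exact: cvg_cst.
  - by have := integrableZl measurableT M (integrable_norm ig).
  - apply: filterS g0 => x gx n; rewrite normrM.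
    have [xr|/gx ->] := ltP (mdist p x) rho; last by rewrite normr0 !mulr0.
    by rewrite ler_wpM2r// f_M.
apply: cvgB; first apply: cvgN.
  apply: dom => //; apply: aeW => x hx; rewrite phi0 ?mul0r//.
  by rewrite (le_trans _ hx)// ltW.
apply: dom => //.
have oU : open [set x | r < mdist p x].
  have -> : [set x | r < mdist p x] = mdist p @^-1` [set t | r < t] by [].
  apply: open_comp; last exact: open_gt.
  by move=> x _; have := @lipschitz_cont R Y _ (lipschitz_mdist p) x.
have : {ae mu, forall x, r < mdist p x -> b phi x = 0}.
  by apply: (der_local0 Db oU Lphi) => y /ltW/phi0.
by apply: filterS => x hx h1; apply: hx; exact: lt_le_trans h1.
Qed.

End integration_by_parts.

Section upper_bounds.
Context {R : realType} {Y : completeMetricType R}.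
Context {mu : {measure set (borel Y) -> \bar R}}.
Context {b : (Y -> R) -> (Y -> R)} {h : Y -> R} (bh : has_div (mu := mu) b h).
Context {G : Y -> R} (iG : integrable_on_bounded mu G).
Implicit Types f g : Y -> R.

Let Db : is_derivation mu b. Proof. by case: bh. Qed.

(** Upper bounds for derivatives pass to pointwise limits of functions: tested
    against a nonnegative Lipschitz function, [b f] becomes by integration by
    parts an integral of [f]. *)
Lemma der_le_lim (f_ : nat -> Y -> R) f p (rho M : R) : 0 <= M ->
  (forall n, LIPb (f_ n)) -> LIPb f ->
  (forall n x, mdist p x < rho -> `|f_ n x| <= M) ->
  (forall x, mdist p x < rho -> f_ n x @[n --> \oo] --> f x) ->
  (forall n, {ae mu, forall x, mdist p x < rho -> b (f_ n) x <= G x}) ->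
  {ae mu, forall x, mdist p x < rho -> b f x <= G x}.
Proof.
move=> M0 Lf_ Lf f_M f_f f_G.
suff H r : r < rho -> {ae mu, forall x, mdist p x < r -> b f x <= G x}.
  have Hn n : {ae mu, forall x, mdist p x < rho - n.+1%:R^-1 -> b f x <= G x}.
    by apply: H; rewrite ltrBlDr ltrDl invr_gt0.
  have := ae_foralln Hn; apply: filterS => x Hx xrho.
  have d0 : 0 < rho - mdist p x by rewrite subr_gt0.
  near \oo => n; apply: (Hx n).
  rewrite ltrBrDr addrC -ltrBrDr; near: n.
  exact: (near_infty_natSinv_lt (PosNum d0)).
move=> rrho.
(* a Lipschitz function positive exactly on the ball of radius [r] *)
pose phi0 y := -1 * tdist p r y + r.
have Lphi0 : LIPb phi0 by apply: LIPb_lin; [exact: LIPb_tdist|exact: LIPb_cst].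
have phi0_off : zero_off p r phi0.
  by move=> x rx; rewrite /phi0 /tdist min_r// mulN1r addNr.
have phi0_ge0 x : 0 <= phi0 x.
  by rewrite /phi0 mulN1r addrC subr_ge0 /tdist ge_min lexx orbT.
have phi0_gt0 x : mdist p x < r -> 0 < phi0 x.
  by move=> xr; rewrite /phi0 mulN1r addrC subr_gt0 tdist_eq// ltW.
pose k (x : borel Y) := phi0 x * G x - phi0 x * b f x.
have iphiG (phi : Y -> R) : LIPb phi -> zero_off p r phi ->
    mu.-integrable setT (EFin \o (fun x => phi x * G x)).
  by move=> Lphi phi_off; exact: (integrable_test Lphi phi_off iG).
have [_ ibf _] := der_parts bh Lphi0 phi0_off Lf.
have ik : mu.-integrable setT (EFin \o k).
  by have := integrableB measurableT (iphiG _ Lphi0 phi0_off) ibf.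
suff : {ae mu, forall x, 0 <= k x}.
  apply: filterS => x; rewrite /k -mulrBr => kx xr.
  by rewrite -subr_ge0; move: kx; rewrite pmulr_rge0// phi0_gt0.
apply: (ae_ge0_of_lipschitz ik) => psi lpsi psi01.
have Lpsi : LIPb psi.
  by split => //; exists 1 => x; have /andP[p0 p1] := psi01 x; rewrite ger0_norm.
have Lphi := LIPb_mul Lpsi Lphi0.
have phi_off : zero_off p r (fun x => psi x * phi0 x).
  by move=> x /phi0_off ->; rewrite mulr0.
have phi_ge0 x : 0 <= psi x * phi0 x.
  by rewrite mulr_ge0//; have /andP[] := psi01 x.
have -> : \int[mu]_x (psi x * k x) =
    \int[mu]_x ((psi x * phi0 x) * G x - (psi x * phi0 x) * b f x).
  by apply: eq_Rintegral => x _; rewrite /k; ring.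
have [_ ibf' _] := der_parts bh Lphi phi_off Lf.
rewrite RintegralB//; last exact: iphiG.
rewrite subr_ge0.
have := der_parts_cvg bh Lphi phi_off rrho M0 Lf_ Lf f_M f_f.
move=> cv; rewrite -(cvg_lim _ cv)//.
apply: limr_le; first by apply/cvg_ex; eexists; exact: cv.
near=> n.
have [_ ibfn _] := der_parts bh Lphi phi_off (Lf_ n).
rewrite -subr_ge0 -RintegralB//; last exact: iphiG.
apply: Rintegral_ae_ge0.
  apply/measurable_EFinP.
  by have /measurable_int := integrableB measurableT (iphiG _ Lphi phi_off) ibfn.
have := f_G n; apply: filterS => x Hx.
have [xr|/phi_off ->] := ltP (mdist p x) r; last by rewrite !mul0r subr0.
rewrite -mulrBr mulr_ge0// subr_ge0; apply: Hx; exact: lt_trans xr rrho.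
Unshelve. all: by end_near. Qed.

(** The soft minima satisfy the same upper bound, and tend to the minimum. *)
Lemma der_le_min f g p (rho : R) : LIPb f -> LIPb g ->
  {ae mu, forall x, mdist p x < rho -> b f x <= G x} ->
  {ae mu, forall x, mdist p x < rho -> b g x <= G x} ->
  {ae mu, forall x, mdist p x < rho -> b (fun y => Num.min (f y) (g y)) x <= G x}.
Proof.
move=> Lf Lg fG gG.
have [M M0 fM] := LIPb_bound Lf; have [N N0 gN] := LIPb_bound Lg.
pose e n : R := n.+1%:R^-1.
have e01 n : 0 < e n <= 1.
  by rewrite invr_gt0 ltr0Sn/= invf_le1// ler1n.
apply: (@der_le_lim (fun n => soft_min (e n) f g) _ p rho (M + N + 1)).
- by rewrite !addr_ge0.
- by move=> n; exact: LIPb_soft_min.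
- exact: LIPb_min.
- move=> n x _; rewrite /soft_min.
  have /andP[e0 e1] := e01 n.
  have u0 := soft_abs_gt0 (fun y => -1 * g y + f y) x e0.
  have u1 := soft_abs_le (fun y => -1 * g y + f y) x (e01 n).
  move: u0 u1 (fM x) (gN x); move: (soft_abs _ _ _) (f x) (g x) => u a c u0 u1.
  have : `|-1 * c + a| <= `|a| + `|c|.
    by rewrite mulN1r addrC (le_trans (ler_normB _ _)).
  move: u1; move: `|-1 * c + a| => t u1 ut h1 h2.
  move: (ler_norm a) (ler_norm c) (ler_norm (- a)) (ler_norm (- c)).
  rewrite !normrN ler_norml => *; apply/andP; split; lra.
- move=> x _; rewrite /soft_min.
  pose w := -1 * g x + f x.
  have -> : Num.min (f x) (g x) = - 2^-1 * `|w| + (2^-1 * f x + (2^-1 * g x + 0)).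
    rewrite /w /Num.min; case: ltP => fg.
      by rewrite ltr0_norm; lra.
    by rewrite ger0_norm; lra.
  apply: cvgD; last exact: cvg_cst.
  apply: cvgM; first exact: cvg_cst.
  have -> : `|w| = Num.sqrt (w ^+ 2 + 0) by rewrite addr0 sqrtr_sqr.
  apply: (@cvg_comp _ _ _ (fun n => w ^+ 2 + e n) Num.sqrt); last first.
    exact: sqrt_continuous.
  apply: cvgD; first exact: cvg_cst.
  exact: cvg_harmonic.
- by move=> n; exact: der_soft_min.
Qed.

(** A function [f] with Lipschitz constant [1] is the infimum over [y] of
    [f y + mdist y], hence a limit of finite minima of such functions. *)
Lemma der_le_dist (d : nat -> Y) f p (rho : R) : dense (range d) ->
  (forall x, 0 <= G x) -> LIPb f -> (forall x z, `|f x - f z| <= mdist x z) ->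
  (forall n, mdist p (d n) < rho -> {ae mu, forall x, mdist p x < rho ->
    b (tdist (d n) (rho + rho)) x <= G x}) ->
  {ae mu, forall x, mdist p x < rho -> b f x <= G x}.
Proof.
move=> dd G0 Lf f1 dG; have [M M0 fM] := LIPb_bound Lf.
(* on the ball the truncation at [rho + rho] has no effect; points [d n] off
   the ball contribute the constant [M], an upper bound of [f] *)
pose e n := if mdist p (d n) < rho
  then fun y => 1 * tdist (d n) (rho + rho) y + f (d n) else fun=> M.
pose m := fix m n y := if n is n'.+1 then Num.min (m n' y) (e n' y) else M.
have Le n : LIPb (e n).
  rewrite /e; case: ifPn => _; last exact: LIPb_cst.
  by apply: LIPb_lin; [exact: LIPb_tdist|exact: LIPb_cst].
have Lm n : LIPb (m n).
  by elim: n => [|n IH]; [exact: LIPb_cst|exact: LIPb_min].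
have cG c : {ae mu, forall x, mdist p x < rho -> b (fun=> c) x <= G x}.
  by have := der_cst Db c; apply: filterS => x ->.
have eG n : {ae mu, forall x, mdist p x < rho -> b (e n) x <= G x}.
  rewrite /e; case: ifPn => [dn|_]; last exact: cG.
  have := dG n dn; have := der_cst Db (f (d n)).
  have := der_lin Db 1 (LIPb_tdist (d n) (rho + rho)) (LIPb_cst (f (d n))).
  by apply: filterS3 => x -> -> h1 h2; rewrite mul1r addr0 h1.
have mG n : {ae mu, forall x, mdist p x < rho -> b (m n) x <= G x}.
  elim: n => [|n IH]; first exact: cG.
  exact: (der_le_min (Lm n) (Le n) IH (eG n)).
have td n x : mdist p (d n) < rho -> mdist p x < rho ->
    tdist (d n) (rho + rho) x = mdist (d n) x.
  move=> h1 h2; rewrite tdist_eq// (le_trans (metric_triangle _ p _))//.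
  by rewrite (metric_sym _ p) lerD// ltW.
have fm n x : mdist p x < rho -> f x <= m n x.
  move=> xr; elim: n => [|n IH]; first by rewrite (le_trans (ler_norm _)).
  rewrite /= le_min IH/= /e; case: ifPn => [dn|_]; last by rewrite (le_trans (ler_norm _)).
  rewrite td// mul1r -lerBlDr (le_trans (ler_norm _))// metric_sym; exact: f1.
have mM n x : m n x <= M.
  by elim: n => [|n IH] //=; rewrite ge_min IH.
have mono n k x : (n <= k)%N -> m k x <= m n x.
  move=> /subnK <-; elim: (k - n)%N => [|j IH] //.
  by rewrite addSn /= ge_min IH.
apply: (@der_le_lim m f p rho M) => //.
- move=> n x xr; rewrite ler_norml mM andbT.
  by rewrite (le_trans _ (fm n x xr))//; have /ler_normlP[] := fM x; lra.
- move=> x xr; apply/cvgrPdist_le => eps eps0.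
  pose del := Num.min (eps / 2) (rho - mdist p x).
  have del0 : 0 < del by rewrite lt_min divr_gt0//= subr_gt0.
  have [_ [k _ <-] xk] := dense_mdist x dd del0.
  have xk1 : mdist x (d k) <= eps / 2.
    by apply: ltW; apply: lt_le_trans xk _; rewrite ge_min lexx.
  have xk2 : mdist p (d k) < rho.
    rewrite (le_lt_trans (metric_triangle _ x _))// addrC -ltrBrDr.
    by apply: lt_le_trans xk _; rewrite ge_min lexx orbT.
  exists k.+1 => // n /= kn.
  rewrite ler0_norm ?subr_le0 ?fm// opprB lerBlDr.
  apply: (le_trans (mono _ _ x kn)); rewrite /= ge_min /e xk2 td// mul1r.
  apply/orP; right; have /ler_normlP[] := f1 x (d k).
  move: xk1; rewrite (metric_sym (d k)); lra.
Qed.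

End upper_bounds.

(** * Sections representing derivations *)

Section extension_to_distances.
Context {R : realType} {Y : completeMetricType R}.
Context {mu : {measure set (borel Y) -> \bar R}}.

(** On the annuli around [y] on which the integer part of [mdist y] is constant,
    the truncations of [mdist y] at the next integer glue together. *)
Lemma der_ext_mdist (b : (Y -> R) -> (Y -> R)) (y : Y) (M : R) :
  is_derivation mu b ->
  {ae mu, forall x, mdist y x < M -> der_ext mu b (mdist y) x = b (tdist y M) x}.
Proof.
move=> Db.
pose T n : Y -> R := tdist y n%:R.
pose h x := b (T (Num.truncn (mdist y x)).+1) x.
have trunc x : (Num.truncn (mdist y x))%:R <= mdist y x
    < (Num.truncn (mdist y x)).+1%:R by apply: truncn_itv; exact: mdist_ge0.
have Hh : exists h : Y -> R, measurable_fun setT (h : borel Y -> R) /\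
    forall (c : Y) (r : R) (f' : Y -> R), LIPb f' ->
      (forall z, ball c r z -> f' z = mdist y z) ->
      {ae mu, forall x, ball c r x -> h x = b f' x}.
  exists h; split.
    pose B n : set (borel Y) := [set x | mdist y x < n.+1%:R] `\` [set x | mdist y x < n%:R].
    have Bt n x : B n x -> Num.truncn (mdist y x) = n.
      move=> [/= h1 /negP]; rewrite -leNgt => h2.
      by apply: truncn_def; rewrite h2.
    apply: (measurable_fun_cover (B := B)).
    - move=> x; exists (Num.truncn (mdist y x)); have /andP[h1 h2] := trunc x.
      by split => //=; apply/negP; rewrite -leNgt.
    - by move=> n; apply: measurableD; exact: measurable_mball.
    - move=> n; apply: (eq_measurable_fun (b (T n.+1) : borel Y -> R)).
        by move=> x; rewrite inE => /Bt xn; rewrite /h xn.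
      by apply: measurable_funTS; exact: (der_measurable Db (LIPb_tdist _ _)).
  move=> c r f' Lf' f'E.
  have Hn n : {ae mu, forall x, (ball c r `&` [set x | mdist y x < n%:R]) x ->
      b (T n) x = b f' x}.
    apply: (der_local Db) => //; last by move=> z [/f'E -> /ltW/tdist_eq].
      by apply: openI; [rewrite ballEmdist|]; exact: open_mball.
    exact: LIPb_tdist.
  have := ae_foralln Hn; apply: filterS => x Hx cx; apply: Hx; split => //=.
  by have /andP[] := trunc x.
have [_ H] := @getPex _ [set h : Y -> R | measurable_fun setT (h : borel Y -> R) /\
    forall (c : Y) (r : R) (f' : Y -> R), LIPb f' ->
      (forall z, ball c r z -> f' z = mdist y z) ->
      {ae mu, forall x, ball c r x -> h x = b f' x}] Hh.
have := H y M (tdist y M) (LIPb_tdist _ _).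
rewrite ballEmdist; apply.
by move=> z /= /ltW/tdist_eq.
Qed.

Lemma der_ext_comb (b1 b2 b : (Y -> R) -> (Y -> R)) (c : R) (y : Y) :
  (forall f x, b f x = b1 f x + c * b2 f x) ->
  is_derivation mu b1 -> is_derivation mu b2 ->
  {ae mu, forall x, der_ext mu b (mdist y) x =
    der_ext mu b1 (mdist y) x + c * der_ext mu b2 (mdist y) x}.
Proof.
move=> bE D1 D2; have D := is_derivation_comb bE D1 D2.
have H (n : nat) : {ae mu, forall x, mdist y x < n%:R -> der_ext mu b (mdist y) x =
    der_ext mu b1 (mdist y) x + c * der_ext mu b2 (mdist y) x}.
  have := der_ext_mdist y n%:R D2; have := der_ext_mdist y n%:R D1.
  have := der_ext_mdist y n%:R D; apply: filterS3 => x e e1 e2 xn.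
  by rewrite e// bE e1// e2.
have := ae_foralln H; apply: filterS => x Hx; apply: (Hx (Num.truncn (mdist y x)).+1).
by have /andP[] := truncn_itv (mdist_ge0 y x).
Qed.

End extension_to_distances.

Section sections.
Context {R : realType} {kappa : R} {Y : completeMetricType R}.
Context {mu : {measure set (borel Y) -> \bar R}}.
Context (mu_fin : forall B : set (borel Y),
  measurable B -> mbounded (B : set Y) -> (mu B < +oo)%E).
Context {d : nat -> Y} (dd : dense (range d)).
Context {xs : nat -> Y} {rs : nat -> R}
  (gb : forall i : nat, good_ball kappa (range d) (xs i) (rs i))
  (cov : forall x, exists i, mdist (xs i) x < rs i).

Lemma section_ddist_measurable (v : forall x : Y, tcone x) (x0 y : Y) :
  borel_section kappa v -> catball kappa x0 y ->
  measurable_fun setT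
    (fun x : borel Y => tbundle_ddist kappa x0 y (existT _ x (v x))).
Proof.
move=> mv x0y _ B mB; rewrite setTI.
have := mv measurableT (tbundle_ddist kappa x0 y @^-1` B).
rewrite setTI; apply; apply: sub_sigma_algebra; right.
by exists x0, y, B.
Qed.

(** On a ball of the cover the norm is the supremum of the differentials of
    countably many distance functions. *)
Lemma tnorm_measurable (v : forall x : Y, tcone x) : borel_section kappa v ->
  measurable_fun setT (fun x : borel Y => tnorm (v x)).
Proof.
move=> mv; pose B i : set (borel Y) := [set x | mdist (xs i) x < rs i].
apply: (measurable_fun_cover (B := B)) => // i; first exact: measurable_mball.
pose F n : borel Y -> R := if mdist (xs i) (d n) < rs i
  then fun x => `|tbundle_ddist kappa (xs i) (d n) (existT _ x (v x))| else fun=> 0.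
have mF n : measurable_fun setT (F n).
  rewrite /F; case: ifPn => [dn|_]; last exact: measurable_cst.
  apply: measurableT_comp => //; apply: section_ddist_measurable => //.
  by have [] := gb dn.
have FE n x : B i x -> mdist (xs i) (d n) < rs i -> F n x = `|ddist (d n) (v x)|.
  move=> Bx dn; rewrite /F dn /tbundle_ddist /=.
  by have [-> _ _ _] := gb Bx.
apply: (measurability _ (RGenOInfty.measurableE R)) => _ [_ [a ->] <-].
have -> : B i `&` (fun x => tnorm (v x)) @^-1` `]a, +oo[ =
    B i `&` \bigcup_n (F n @^-1` `]a, +oo[).
  apply/seteqP; split => x [Bx /=].
    rewrite in_itv /= andbT => ax; split => //; apply: contrapT => H.
    have Fa n : F n x <= a.
      rewrite leNgt; apply/negP => h; apply: H; exists n => //=.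
      by rewrite in_itv /= h.
    have a0 : 0 <= a by apply: le_trans (Fa 0%N); rewrite /F; case: ifP.
    move: ax; rewrite ltNge (tnorm_le_ddist (@gb i) Bx a0)//.
    by move=> _ [n _ <-] dn; rewrite -(FE n x).
  move=> [n _ /=]; rewrite !in_itv /= !andbT => aF; split => //.
  apply: lt_le_trans aF _; have [dn|dn] := ltP (mdist (xs i) (d n)) (rs i).
    by rewrite FE//; have [_ _ Hd _] := gb Bx; exact: Hd.
  by rewrite /F ltNge dn; exact: tnorm_ge0.
apply: measurableI; first exact: measurable_mball.
apply: bigcupT_measurable => n; rewrite -[X in measurable X]setTI.
exact: mF.
Qed.

(** [t <= 1 + t ^+ 2], and bounded sets have finite measure. *)
Lemma tnorm_integrable (v : forall x : Y, tcone x) : L2_section kappa mu v ->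
  integrable_on_bounded mu (fun x => tnorm (v x)).
Proof.
move=> [mv v2] B mB bB.
pose G (x : borel Y) := tnorm (v x).
have mG : measurable_fun setT G by exact: tnorm_measurable.
have mG2 : measurable_fun setT (fun x => G x ^+ 2).
  exact: measurable_funX.
have i2 : mu.-integrable setT (EFin \o (fun x => G x ^+ 2)).
  apply/integrableP; split; first exact/measurable_EFinP.
  apply: le_lt_trans v2; rewrite le_eqVlt; apply/orP; left; apply/eqP.
  by apply: eq_integral => x _; rewrite /= ger0_norm// sqr_ge0.
have i1 : mu.-integrable B (EFin \o (fun=> 1 : R)).
  apply/integrableP; split; first exact: measurable_cst.
  rewrite [X in (X < _)%E](_ : _ = (\int[mu]_(x in B) (1%:E)))%E; last first.
    by apply: eq_integral => x _; rewrite /= normr1.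
  by rewrite integral_cst// mul1e; exact: mu_fin.
have i2B : mu.-integrable B (EFin \o (fun x => G x ^+ 2)).
  exact: (integrableS measurableT).
apply: (le_integrable mB _ _ (integrableD mB i1 i2B)).
  by apply/measurable_EFinP; exact: measurable_funTS.
move=> x _; rewrite /= lee_fin -/(G x).
have G0 : 0 <= G x := tnorm_ge0 (v x).
rewrite ger0_norm// ger0_norm ?addr_ge0 ?sqr_ge0//.
move: G0; move: (G x) => t t0; have := sqr_ge0 (t - 1); rewrite sqrrB expr1n mulr1 mulr2n; lra.
Qed.

Lemma represents_ddist b v i : represents_F kappa mu b v ->
  {ae mu, forall x, mdist (xs i) x < rs i -> forall n, mdist (xs i) (d n) < rs i ->
    ddist (d n) (v x) = der_ext mu b (mdist (d n)) x}.
Proof.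
move=> [_ Fv].
have H n : {ae mu, forall x, mdist (xs i) x < rs i -> mdist (xs i) (d n) < rs i ->
    ddist (d n) (v x) = der_ext mu b (mdist (d n)) x}.
  have [dn|dn] := ltP (mdist (xs i) (d n)) (rs i); last first.
    by apply: aeW.
  have [catd _ _ _] := gb dn; have := Fv (xs i) (d n) catd.
  apply: filterS => x Hx xr _; apply: Hx.
  by have [] := gb xr.
by have := ae_foralln H; apply: filterS => x Hx xr n; exact: Hx.
Qed.

(** The scalar product with [F(b)] depends linearly on [b], because the
    differentials of the distances, which determine it, do. *)
Lemma represents_ip (b1 b2 b : (Y -> R) -> (Y -> R)) v1 v2 v (c : R) :
  (forall f x, b f x = b1 f x + c * b2 f x) ->
  is_derivation mu b1 -> is_derivation mu b2 ->
  represents_F kappa mu b1 v1 -> represents_F kappa mu b2 v2 ->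
  represents_F kappa mu b v ->
  {ae mu, forall x, forall w, ip (v x) w = ip (v1 x) w + c * ip (v2 x) w}.
Proof.
move=> bE D1 D2 F1 F2 F; apply: (ae_cover (B := fun i => [set x : borel Y | mdist (xs i) x < rs i])) => // i.
have dE n := der_ext_comb (d n) bE D1 D2; have := ae_foralln dE.
have h1 := represents_ddist i F1; have h2 := represents_ddist i F2.
have h := represents_ddist i F => hd.
near=> x => xr w.
have e1 n : mdist (xs i) (d n) < rs i ->
  ddist (d n) (v1 x) = der_ext mu b1 (mdist (d n)) x by move: xr n; near: x.
have e2 n : mdist (xs i) (d n) < rs i ->
  ddist (d n) (v2 x) = der_ext mu b2 (mdist (d n)) x by move: xr n; near: x.
have e n : mdist (xs i) (d n) < rs i ->
  ddist (d n) (v x) = der_ext mu b (mdist (d n)) x by move: xr n; near: x.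
have ed n : der_ext mu b (mdist (d n)) x =
  der_ext mu b1 (mdist (d n)) x + c * der_ext mu b2 (mdist (d n)) x.
  by move: n; near: x.
rewrite -[ip (v1 x) w]mul1r; refine (@ip_of_ddist R Y x kappa (range d) (xs i) (rs i) (@gb i) xr
  (v x) (v1 x) (v2 x) 1 c _ w).
by move=> _ [n _ <-] dn; rewrite e// e1// e2// ed mul1r.
Unshelve. all: by end_near. Qed.

(** The differentials of the distances are bounded by the norm, hence so are the
    derivatives of all functions with Lipschitz constant [1], by [der_le_dist].
    Conversely an upper bound for the derivatives of the distances and of their
    opposites bounds the norm, by [tnorm_le_ddist]. *)
Lemma represents_norm b h v : has_div (mu := mu) b h -> represents_F kappa mu b v ->
  is_ess_sup mu [set b f | f in [set f | LIPb f /\ Lip f setT <= 1]]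
    (fun x => tnorm (v x)).
Proof.
move=> bh Fv; have [Db _ _] := bh; have [Lv _] := Fv.
pose B i : set (borel Y) := [set x | mdist (xs i) x < rs i].
have td i n x : mdist (xs i) (d n) < rs i -> mdist (xs i) x < rs i ->
    mdist (d n) x < rs i + rs i.
  move=> h1 h2; rewrite (le_lt_trans (metric_triangle _ (xs i) _))//.
  by rewrite metric_sym ltrD.
have bd i n : mdist (xs i) (d n) < rs i -> {ae mu, forall x, mdist (xs i) x < rs i ->
    b (tdist (d n) (rs i + rs i)) x = ddist (d n) (v x)}.
  move=> dn; have := represents_ddist i Fv.
  have := der_ext_mdist (d n) (rs i + rs i) Db; apply: filterS2 => x h1 h2 xr.
  by rewrite h2// h1//; exact: td.
split; first exact: (tnorm_measurable Lv.1).
- move=> _ [f [Lf f1] <-]; apply: (ae_cover (B := B)) => // i.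
  apply: (der_le_dist bh (tnorm_integrable Lv) (d := d) (p := xs i)) => //.
  + by move=> x; exact: tnorm_ge0.
  + exact: LIPb_Lip1.
  + move=> n dn; have := bd i n dn; apply: filterS => x Hx xr; rewrite Hx//.
    by have [_ _ Hd _] := gb xr; rewrite (le_trans (ler_norm _))//; exact: Hd.
- move=> g mg bg.
  have Lip1 f : LIPb f -> (forall x z, `|f x - f z| <= mdist x z) ->
      {ae mu, forall x, b f x <= g x}.
    move=> Lf f1; apply: bg; exists f => //; split => //.
    by apply: Lip_le => // x z _ _; rewrite mul1r.
  have g0 : {ae mu, forall x, 0 <= g x}.
    have := der_cst Db 0; have : {ae mu, forall x, b (fun=> 0) x <= g x}.
      apply: Lip1; first exact: LIPb_cst.
      by move=> x z; rewrite subrr normr0 mdist_ge0.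
    by apply: filterS2 => x h1 h2; rewrite -h2.
  apply: (ae_cover (B := B)) => // i.
  have bg' n : {ae mu, forall x, mdist (xs i) x < rs i ->
      mdist (xs i) (d n) < rs i -> `|ddist (d n) (v x)| <= g x}.
    have [dn|dn] := ltP (mdist (xs i) (d n)) (rs i); last first.
      by apply: aeW.
    pose t := tdist (d n) (rs i + rs i).
    have Lt : LIPb t by exact: LIPb_tdist.
    have L0 := LIPb_cst (0 : R) : LIPb (fun _ : Y => (0 : R)).
    have h1 : {ae mu, forall x, b t x <= g x} by apply: Lip1 => // x z; exact: tdist_lip1.
    have h2 : {ae mu, forall x, b (fun y => -1 * t y + 0) x <= g x}.
      apply: Lip1; first exact: LIPb_lin.
      move=> x z; have -> : -1 * t x + 0 - (-1 * t z + 0) = t z - t x by ring.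
      by rewrite distrC; exact: tdist_lip1.
    have h3 := der_lin Db (-1) Lt L0; have h4 := der_cst Db 0.
    have h5 := bd i n dn.
    near=> x => xr _.
    have <- : b t x = ddist (d n) (v x) by move: xr; near: x.
    have e1 : b t x <= g x by near: x.
    have e2 : b (fun y => -1 * t y + 0) x <= g x by near: x.
    have e3 : b (fun y => -1 * t y + 0) x = -1 * b t x + b (fun=> 0) x by near: x.
    have e4 : b (fun=> 0) x = 0 by near: x.
    rewrite ler_norml e1 andbT; move: e2; rewrite e3 e4; lra.
  have := ae_foralln bg'; move: g0; apply: filterS2 => x gx Hx xr.
  apply: (tnorm_le_ddist (@gb i) xr) => // _ [n _ <-]; exact: Hx.
Unshelve. all: by end_near. Qed.

(** Essential suprema are unique up to almost everywhere equality. *)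
Lemma represents_der_norm b h v : has_div (mu := mu) b h -> represents_F kappa mu b v ->
  {ae mu, forall x, tnorm (v x) = der_norm mu b x}.
Proof.
move=> bh Fv; have E := represents_norm bh Fv.
have [m1 u1 l1] := E.
have [m2 u2 l2] := @getPex _ (is_ess_sup mu
  [set b f | f in [set f | LIPb f /\ Lip f setT <= 1]]) (ex_intro _ _ E).
have := l1 _ m2 u2; have := l2 _ m1 u1; apply: filterS2 => x h1 h2.
by apply/eqP; rewrite eq_le h2.
Qed.

End sections.

Theorem corollary6p4 (R : realType) (kappa : R) (Y : completeMetricType R)
    (sepY : separable Y) (catY : local_CAT kappa Y)
    (mu : {measure set (borel Y) -> \bar R})
    (mu_fin : forall B : set (borel Y),
      measurable B -> mbounded (B : set Y) -> (mu B < +oo)%E)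
    (b1 b2 : (Y -> R) -> (Y -> R)) (Db1 : Der22 mu b1) (Db2 : Der22 mu b2)
    (v1 v2 vadd vsub : forall x : Y, tcone x)
    (Fv1 : represents_F kappa mu b1 v1)
    (Fv2 : represents_F kappa mu b2 v2)
    (Fvadd : represents_F kappa mu (b1 + b2) vadd)
    (Fvsub : represents_F kappa mu (b1 - b2) vsub) :
  {ae mu, forall x : Y,
    [/\ vadd x = toplus (v1 x) (v2 x),
        mdist (v1 x) (v2 x) = der_norm mu (b1 - b2) x
      & tnorm (vadd x) ^+ 2 + tnorm (vsub x) ^+ 2
        = 2 * (tnorm (v1 x) ^+ 2 + tnorm (v2 x) ^+ 2)]}.
Proof.
have [d dd] := dense_seq sepY.
have [xs [rs [gb cov]]] := lindelof sepY (good_ball_ex catY dd).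
have [h1 H1] := has_div_Der22 Db1; have [h2 H2] := has_div_Der22 Db2.
have [D1 _ _] := H1; have [D2 _ _] := H2.
have addE f x : (b1 + b2) f x = b1 f x + 1 * b2 f x by rewrite mul1r.
have subE f x : (b1 - b2) f x = b1 f x + -1 * b2 f x by rewrite mulN1r.
have hadd := represents_ip gb cov addE D1 D2 Fv1 Fv2 Fvadd.
have hsub := represents_ip gb cov subE D1 D2 Fv1 Fv2 Fvsub.
have hnorm := represents_der_norm mu_fin dd gb cov (has_div_sub H1 H2) Fvsub.
near=> x.
have ea w : ip (vadd x) w = ip (v1 x) w + ip (v2 x) w.
  by rewrite -[ip (v2 x) w]mul1r; move: w; near: x.
have es w : ip (vsub x) w = ip (v1 x) w - ip (v2 x) w.
  by rewrite -mulN1r; move: w; near: x.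
have en : tnorm (vsub x) = der_norm mu (b1 - b2) x by near: x.
have [i xr] := cov x; have [_ hom _ _] := gb i x xr.
by rewrite -en; exact: (cone_sum hom ea es).
Unshelve. all: by end_near. Qed.
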